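(* Let $G$ be a finitely generated amenable group with $S\subseteq G$ a finite generating set and $(X_n)_{n\in\mathbb{N}}$ a sofic approximation of $G$. Let $K$ be a number field with ring of integers $\mathcal{O}$, and let $a\in\mathcal{O}[F(S)]$. Then the sequence of probability measures $(\nu_{X_n}^a)_{n\in\mathbb{N}}$ on the set $\mathcal{I}(\mathcal{O})$ of ideals of $\mathcal{O}$ converges strongly to some probability measure $\nu_G^a$ on $\mathcal{I}(\mathcal{O})$, independent of the sofic approximation $(X_n)_{n\in\mathbb{N}}$. That is, there is a probability measure $\nu_G^a$ on $\mathcal{I}(\mathcal{O})$, the same for all sofic approximations $(X_n)_{n\in\mathbb{N}}$ of $G$, such that $\lim_{n\to\infty}\nu_{X_n}^a(\Omega)=\nu_G^a(\Omega)$ for every subset $\Omega\subseteq\mathcal{I}(\mathcal{O})$.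
   Context: $F(S)$ is the free group on $S$ and $G=F(S)/N$ with $N\trianglelefteq F(S)$ the kernel of the canonical surjection. A sequence $(X_n)_{n\in\mathbb{N}}$ of finite (right) $F(S)$-sets is a sofic approximation of $G$ if for every $r\in\mathbb{N}$ one has $\lim_{n\to\infty}|P_r(X_n)|/|X_n|=1$, where $P_r(X_n)$ is the set of $x\in X_n$ such that for every $w\in B_r(1_{F(S)})$ (the ball of radius $r$ around the identity in the word metric of $F(S)$ with respect to $S$) one has $xw=x$ if and only if $w\in N$. $\mathcal{I}(\mathcal{O})$ is the set of all ideals of $\mathcal{O}$ (including $0$ and $\mathcal{O}$), a countable set equipped with the $\sigma$-algebra of all its subsets. $\mathcal{O}[X_n]$ is the free $\mathcal{O}$-module on $X_n$, on which $\mathcal{O}[F(S)]$ acts on the right. Definition of $\nu_{X_n}^a$: Let $M_n=\mathcal{O}[X_n]/\mathcal{O}[X_n]a$. Since $\mathcal{O}$ is a Dedekind domain, $M_n\cong \mathcal{O}/I_1\oplus\dotsb\oplus\mathcal{O}/I_t\oplus J_1\oplus\dotsb\oplus J_r$ with non-zero ideals $I_i,J_j$ of $\mathcal{O}$ such that $I_t\subseteq\dotsb\subseteq I_1\subsetneq\mathcal{O}$; the ideals $I_1,\dotsc,I_t$ and the number $r$ are unique. Let $s=|X_n|-t-r\ge 0$. Then $\nu_{X_n}^a=\frac{1}{|X_n|}\big(s\,\delta_{\mathcal{O}}+\sum_{i=1}^t\delta_{I_i}+r\,\delta_0\big)$, where $\delta_I$ is the Dirac measure at $I$. *)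

(* Defs.v *)
From HB Require Import structures.
From mathcomp Require Import all_boot all_order all_algebra all_field.
From mathcomp Require Import finmap.
From mathcomp Require Import all_classical all_reals all_analysis.

Set Implicit Arguments.
Unset Strict Implicit.
Unset Printing Implicit Defensive.

Import Order.TTheory GRing.Theory Num.Theory numFieldNormedType.Exports.

Local Open Scope classical_set_scope.
Local Open Scope ring_scope.

(** * Free groups *)

(* The letter (s, false) stands for s and (s, true) for s^-1; elements of the
   free group are reduced words. *)
Section FreeGroup.
Variable A : choiceType.
Implicit Types (l : A * bool) (u v w : seq (A * bool)).

Definition letter_inv l := (l.1, ~~ l.2).

Definition reduced w := sorted (fun l m => m != letter_inv l) w.

Record free_group := FreeGroup { word :> seq (A * bool); _ : reduced word }.
HB.instance Definition _ := [isSub for word].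
HB.instance Definition _ := [Choice of free_group by <:].

Definition cons_reduce l w :=
  if w is m :: w' then if m == letter_inv l then w' else l :: w else [:: l].

Definition word_mul u v := foldr cons_reduce v u.

Definition word_inv u := rev (map letter_inv u).

Lemma letter_invK : involutive letter_inv.
Proof. by case=> s b; rewrite /letter_inv /= negbK. Qed.

Lemma reduced_cons l w : reduced (l :: w) -> reduced w.
Proof. exact: path_sorted. Qed.

Lemma cons_reduced l w : reduced w -> reduced (cons_reduce l w).
Proof.
case: w => [|m w] //= mw; case: ifP => [_|ml]; first exact: path_sorted mw.
by rewrite /= ml.
Qed.

Lemma word_mul_reduced u v : reduced v -> reduced (word_mul u v).
Proof. by move=> rv; elim: u => //= l u; exact: cons_reduced. Qed.

Lemma cons_reduceE l w : reduced (l :: w) -> cons_reduce l w = l :: w.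
Proof. by case: w => [|m w] //= /andP[/negbTE ->]. Qed.

Lemma cons_reduceK l w :
  reduced w -> cons_reduce (letter_inv l) (cons_reduce l w) = w.
Proof.
case: w => [|m w]; first by rewrite /= letter_invK eqxx.
move=> mw /=; case: eqP => [ml|_]; last by rewrite /= letter_invK eqxx.
by rewrite -ml cons_reduceE.
Qed.

Lemma word_mul_cons_reduce l u v : reduced v ->
  word_mul (cons_reduce l u) v = cons_reduce l (word_mul u v).
Proof.
move=> rv; case: u => [|m u] //=; case: eqP => [->|_] //=.
have := cons_reduceK (letter_inv l) (word_mul_reduced u rv).
by rewrite letter_invK => ->.
Qed.

Lemma word_mulA u v w : reduced w ->
  word_mul u (word_mul v w) = word_mul (word_mul u v) w.
Proof. by move=> rw; elim: u => //= l u ->; rewrite word_mul_cons_reduce. Qed.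

Lemma word_mul0 u : reduced u -> word_mul u [::] = u.
Proof.
elim: u => //= l u IHu rlu; rewrite IHu; last exact: reduced_cons rlu.
exact: cons_reduceE.
Qed.

Lemma word_inv_reduced u : reduced u -> reduced (word_inv u).
Proof.
rewrite /reduced /word_inv rev_sorted sorted_map; apply: sub_sorted => l m /=.
by rewrite letter_invK eq_sym.
Qed.

Lemma word_mulVl u : reduced u -> word_mul (word_inv u) u = [::].
Proof.
elim: u => //= l u IHu rlu.
rewrite /word_inv map_cons rev_cons -cats1 /word_mul foldr_cat /= letter_invK eqxx.
exact/IHu/(reduced_cons rlu).
Qed.

Lemma word_invK : involutive word_inv.
Proof.
move=> u; rewrite /word_inv map_rev revK -map_comp -[RHS]map_id.
by apply: eq_map => l /=; rewrite letter_invK.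
Qed.

Definition free_one : free_group := @FreeGroup [::] isT.
Definition free_mul (u v : free_group) : free_group :=
  FreeGroup (word_mul_reduced u (valP v)).
Definition free_inv (u : free_group) : free_group :=
  FreeGroup (word_inv_reduced (valP u)).

Lemma free_mulA : associative free_mul.
Proof. by move=> u v w; apply/val_inj/word_mulA/valP. Qed.
Lemma free_mul1g : left_id free_one free_mul.
Proof. by move=> u; apply/val_inj. Qed.
Lemma free_mulg1 : right_id free_one free_mul.
Proof. by move=> u; apply/val_inj/word_mul0/valP. Qed.
Lemma free_mulVg : left_inverse free_one free_inv free_mul.
Proof. by move=> u; apply/val_inj/word_mulVl/valP. Qed.
Lemma free_mulgV : right_inverse free_one free_inv free_mul.
Proof.
move=> u; apply/val_inj => /=; rewrite -{1}[word u]word_invK.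
exact/word_mulVl/word_inv_reduced/valP.
Qed.

HB.instance Definition _ := isGroup.Build free_group
  free_mulA free_mul1g free_mulg1 free_mulVg free_mulgV.

(* The ball around 1 in the word metric: the word length of an element of the
   free group is the length of its reduced word. *)
Definition ball1 (r : nat) : set free_group := [set w | (size w <= r)%N].

End FreeGroup.

(* The canonical homomorphism F(S) -> G. *)
Definition free_eval (G : groupType) (S : {fset G}) (w : free_group S) : G :=
  (\prod_(l <- w) (if l.2 then (fsval l.1)^-1 else fsval l.1))%g.

(** * Amenability and sofic approximations *)

(* Foelner's condition; passing to inverses exchanges left and right translates,
   so the side does not matter. *)
Definition amenable (G : groupType) : Prop :=
  forall (E : {fset G}) (e : rat), 0 < e ->
  exists2 F : {fset G}, F != fset0 & forall g, g \in E ->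
    let gF := [fset (g * x)%g | x in F]%fset in
    #|` ((F `\` gF) `|` (gF `\` F))%fset|%:R <= e * #|` F|%:R.

Record finite_right_set (F : groupType) := FiniteRightSet {
  carrier :> finType;
  ract : carrier -> F -> carrier;
  ract1 : forall x, ract x 1%g = x;
  ractM : forall x u v, ract x (u * v)%g = ract (ract x u) v
}.

Section Sofic.
Variables (G : groupType) (S : {fset G}).

Definition good_points (r : nat) (X : finite_right_set (free_group S)) :
    pred X :=
  fun x => `[< forall w, ball1 r w -> (ract x w = x <-> free_eval w = 1%g) >].

Arguments good_points r X x : clear implicits.

Definition sofic_approximation (R : realType)
    (X : nat -> finite_right_set (free_group S)) : Prop :=
  forall r,
    (#|good_points r (X n)|%:R / #|{: X n}|%:R : R) @[n --> \oo] --> (1 : R).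

End Sofic.

Arguments good_points {G S} r X x.

(** * Submodules, quotients and ideals *)

Record submodule (R : comNzRingType) (V : lmodType R) := Submodule {
  submod_pred : V -> bool;
  _ : submod_closed submod_pred
}.

HB.instance Definition _ (R : comNzRingType) (V : lmodType R) :=
  gen_eqMixin (submodule V).
HB.instance Definition _ (R : comNzRingType) (V : lmodType R) :=
  gen_choiceMixin (submodule V).

Section Submodule.
Variables (R : comNzRingType) (V : lmodType R).
Implicit Types N : submodule V.

Definition pred_of_submodule N : {pred V} := let: Submodule P _ := N in P.
Coercion pred_of_submodule : submodule >-> pred_sort.

Lemma submodule_closed N : submod_closed N.
Proof. by case: N. Qed.

Lemma submodule_ext N N' : N =i N' -> N = N'.
Proof.
case: N N' => [N hN] [N' hN'] eqN; have {}eqN : N = N' by exact/funext/eqN.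
by case: N' / eqN hN' => hN'; congr Submodule; exact: Prop_irrelevance.
Qed.

HB.instance Definition _ N :=
  GRing.isSubmodClosed.Build R V (pred_of_submodule N) (submodule_closed N).

Record submod_type N := SubmodElt {
  submod_val :> V;
  _ : submod_val \in N
}.
HB.instance Definition _ N := [isSub for @submod_val N].
HB.instance Definition _ N := [Choice of submod_type N by <:].
HB.instance Definition _ N := [SubChoice_isSubLmodule of submod_type N by <:].

Definition quotient_module N := Quotient.quot N.
HB.instance Definition _ N := GRing.Zmodule.on (quotient_module N).

Section Scale.
Variable N : submodule V.
Local Open Scope quotient_scope.

Definition quotient_scale (c : R) (x : quotient_module N) : quotient_module N :=
  \pi_(Quotient.quot N) (c *: repr (x : Quotient.quot N)).

Lemma pi_quotient_scale c x :
  quotient_scale c (\pi_(Quotient.quot N) x) = \pi_(Quotient.quot N) (c *: x).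
Proof.
apply/eqP; rewrite -Quotient.idealrBE -scalerBr rpredZ//.
by rewrite Quotient.idealrBE reprK.
Qed.

Lemma quotient_scaleA c d x :
  quotient_scale c (quotient_scale d x) = quotient_scale (c * d) x.
Proof. by rewrite -[x]reprK (pi_quotient_scale d) !pi_quotient_scale scalerA. Qed.

Lemma quotient_scale1 : left_id 1 quotient_scale.
Proof. by move=> x; rewrite -[x]reprK pi_quotient_scale scale1r. Qed.

Lemma quotient_scaleDr : right_distributive quotient_scale +%R.
Proof.
move=> c x y; rewrite -[x]reprK -[y]reprK -raddfD.
by rewrite !pi_quotient_scale scalerDr raddfD.
Qed.

Lemma quotient_scaleDl x :
  {morph quotient_scale^~ x : c d / c + d}.
Proof. by move=> c d; rewrite -[x]reprK !pi_quotient_scale scalerDl raddfD. Qed.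

HB.instance Definition _ := GRing.Zmodule_isLmodule.Build R (quotient_module N)
  quotient_scaleA quotient_scale1 quotient_scaleDr quotient_scaleDl.
End Scale.

Lemma submod0_closed : submod_closed (pred1 (0 : V)).
Proof. by split=> [|c u v /eqP-> /eqP->]; rewrite inE ?scaler0 ?addr0. Qed.
Definition submod0 : submodule V := Submodule submod0_closed.

Lemma submodT_closed : submod_closed (@predT V).
Proof. by []. Qed.
Definition submodT : submodule V := Submodule submodT_closed.

End Submodule.

Definition ideal (R : comNzRingType) := submodule R^o.
HB.instance Definition _ R := Choice.on (ideal R).
Definition ideal0 (R : comNzRingType) : ideal R := submod0 R^o.
Definition ideal1 (R : comNzRingType) : ideal R := submodT R^o.

HB.instance Definition _ R := isPointed.Build (ideal R) (ideal0 R).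
HB.instance Definition _ R := @isMeasurable.Build default_measure_display
  (ideal R) discrete_measurable discrete_measurable0
  discrete_measurableC discrete_measurableU.

Fixpoint direct_sum (R : comNzRingType) (Ms : seq (lmodType R)) : lmodType R :=
  if Ms is M :: Ms' then (M * direct_sum Ms')%type else 'rV[R]_0.

Definition lmod_isomorphic (R : comNzRingType) (M N : lmodType R) : Prop :=
  exists f : {linear M -> N}, bijective f.

(** * The measures attached to an element of the group ring *)

Section Measure.
Variables (R : realType) (A : comNzRingType).

(* M is isomorphic to A/I_1 + ... + A/I_t + J_1 + ... + J_r, where r = d.2 and
   d.1 = [:: I_1; ...; I_t] with I_t <= ... <= I_1 proper non-zero ideals. *)
Definition has_invariants (M : lmodType A) (d : seq (ideal A) * nat) : Prop :=
  let: (Is, r) := d in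
  [/\ {in Is, forall I : ideal A, I != ideal0 A /\ I != ideal1 A},
      sorted (fun I I' : ideal A => `[< {subset I' <= I} >]) Is &
      exists Js : seq (ideal A),
        [/\ size Js = r,
            {in Js, forall J : ideal A, J != ideal0 A} &
            lmod_isomorphic M
              (direct_sum ([seq (quotient_module J : lmodType A) | J <- Is] ++
                           [seq (submod_type J : lmodType A) | J <- Js]))]].

(* 1/n (s delta_A + sum_i delta_{I_i} + r delta_0), with s = n - t - r.
   Truncated subtraction is harmless: over a Dedekind domain, a module with
   these invariants that is generated by n elements satisfies t + r <= n. *)
Definition invariant_measure (n : nat) (Is : seq (ideal A)) (r : nat) :
    {measure set (ideal A) -> \bar R} :=
  mscale (n%:R^-1 : R)%:nng
    (measure_add (mscale ((n - size Is - r)%N%:R)%:nng \d_(ideal1 A))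
      (measure_add (msum (fun i => \d_(nth (ideal0 A) Is i)) (size Is))
                   (mscale (r%:R)%:nng \d_(ideal0 A)))).

Lemma invariant_measureE n Is r (Omega : set (ideal A)) :
  invariant_measure n Is r Omega =
  ((n%:R^-1)%:E * ((n - size Is - r)%N%:R%:E * \d_(ideal1 A) Omega +
     (\sum_(I <- Is) \d_I Omega + r%:R%:E * \d_(ideal0 A) Omega)))%E.
Proof.
rewrite /invariant_measure /mscale /=; congr (_ * _)%E.
rewrite [LHS]measure_addE; congr (_ + _)%E.
rewrite [LHS]measure_addE; congr (_ + _)%E; rewrite /= /msum.
by rewrite (big_nth (ideal0 A)) big_mkord.
Qed.

End Measure.

Definition group_ring (A : comNzRingType) (F : choiceType) := {fsfun F -> A with 0}.

Section Convolution.
Variables (A : comNzRingType) (F : groupType) (X : finite_right_set F).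
Variable a : group_ring A F.

(* Right multiplication by a on A[X], where v : {ffun X -> A^o} stands for the
   formal sum of the v x * x. *)
Definition rconv (v : {ffun X -> A^o}) : {ffun X -> A^o} :=
  [ffun y => \sum_(w <- finsupp a) \sum_(x | ract x w == y) (v x : A) * a w].

Lemma rconv_is_linear : linear rconv.
Proof.
move=> c u v; apply/ffunP => y; rewrite !ffunE scaler_sumr -big_split /=.
apply: eq_bigr => w _; rewrite scaler_sumr -big_split /=.
by apply: eq_bigr => x _; rewrite !ffunE /= mulrDl scalerAl.
Qed.
HB.instance Definition _ := GRing.isLinear.Build A
  {ffun X -> A^o} {ffun X -> A^o} *:%R rconv rconv_is_linear.

Definition rconv_image_pred : pred {ffun X -> A^o} :=
  fun u => `[< exists v, u = rconv v >].

Lemma rconv_image_closed : submod_closed rconv_image_pred.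
Proof.
split=> [|c _ _ /asboolP[u ->] /asboolP[v ->]]; apply/asboolP.
  by exists 0; rewrite raddf0.
by exists (c *: u + v); rewrite linearP.
Qed.

Definition rconv_image : submodule {ffun X -> A^o} :=
  Submodule rconv_image_closed.

End Convolution.

Section Nu.
Variables (R : realType) (A : comNzRingType) (F : groupType).

(* Over a Dedekind domain A, the invariants of A[X]/A[X]a exist and are unique;
   the branch mzero is never taken in that case. *)
Definition nu (X : finite_right_set F) (a : group_ring A F) :
    {measure set (ideal A) -> \bar R} :=
  if pselect (exists d, has_invariants (quotient_module (rconv_image X a)) d) is left h
  then let d := projT1 (cid h) in invariant_measure R #|{: X}| d.1 d.2
  else mzero.

End Nu.

(** * Rings of integers *)

Section RingOfIntegers.
Variable K : fieldExtType rat.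

Definition is_integral : pred K :=
  fun x => `[< integralOver (intr : int -> K) x >].

Lemma is_integral_subring : subring_closed is_integral.
Proof.
split=> [|x y /asboolP hx /asboolP hy|x y /asboolP hx /asboolP hy];
  apply/asboolP.
- exact: integral1.
- exact: integral_sub.
- exact: integral_mul.
Qed.
HB.instance Definition _ :=
  GRing.isSubringClosed.Build K is_integral is_integral_subring.

Record ring_of_integers := RingOfIntegers {
  int_val :> K;
  _ : int_val \in is_integral
}.
HB.instance Definition _ := [isSub for int_val].
HB.instance Definition _ := [Choice of ring_of_integers by <:].
HB.instance Definition _ :=
  [SubChoice_isSubComNzRing of ring_of_integers by <:].

End RingOfIntegers.

(* Main.v *)
From HB Require Import structures.
Require Import Defs.
From mathcomp Require Import all_boot all_order all_algebra all_field.
From mathcomp Require Import finmap.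
From mathcomp Require Import all_classical all_reals all_analysis.
From mathcomp Require Import ring lra zify.
Import Order.TTheory GRing.Theory Num.Theory numFieldNormedType.Exports.

Set Implicit Arguments.
Unset Strict Implicit.
Unset Printing Implicit Defensive.

Local Open Scope classical_set_scope.
Local Open Scope ring_scope.

(** Write O for the ring of integers and N(J) = [O : J]. For a non-zero ideal J,
the sum of ln N(I + J) over the |X| ideals I making up nu_X is the logarithm of
the index of J^X in the group of vectors of O^X sent to J^X by a. Shearer's
inequality along a Foelner set bounds this index from above by its local
contributions and, by rank plus nullity of the local convolution, from below:
divided by |X|, its logarithm converges as the action of the free group on X
approaches that of G.

Comparing two ideals J < D with nothing in between yields the limiting mass of
{I | I n D <= J}. The ideals making up nu_X form a chain, so the mass of an
intersection of downward closed sets is the least of their masses, whence the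
limiting mass of every {I | I <= J}. Finally, the non-zero ideals I of nu_X have
a product of norms at most C^|X|, so little mass sits on large norms: the mass
of {0} and of every single ideal converges, the convergence is uniform over all
sets of ideals, and the limit is sigma-additive. *)

(** * Indices of subgroups *)

(** Shearer's inequality yields upper bounds only. It is therefore applied to the kernel and to the
    image of [a]: on X the two indices multiply to exactly N(J)^|X|, while on a Foelner set the
    local ones multiply to at most N(J) to the size of the set plus that of its boundary. An upper
    bound for one is thus a lower bound for the other. Averaging over all translates plays the role
    of a tiling of X by Foelner sets.

    Counting requires O/J to be finite, so no single J sees the mass at 0. That mass is a limit of
    masses below ideals of growing norm, and the danger is torsion of ever larger norm, which looks
    like rank modulo every fixed J. The bound C^|X|, with C depending on [a] alone, excludes this.

    As O need not be principal, the summands J_j of the module need not be free. By invertibility of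
    ideals, B/JB still has N(J) elements for every non-zero B, so modulo J they count as free ones.

    Limits are taken over all finite sets with an action close enough to that of G, not along a
    sequence; this yields one limit for all sofic approximations. *)

Definition subgroup (V : zmodType) (P : set V) :=
  P 0 /\ forall x y, P x -> P y -> P (x - y).

(** A colouring by [n] colours stands for the quotient: two points of [P] get the same colour
    exactly when they are congruent modulo [Q], and [P] meets every colour. *)
Definition is_index (V : zmodType) (P Q : set V) (n : nat) :=
  exists (T : finType) (f : V -> T),
    [/\ #|T| = n, forall t, exists2 x, P x & f x = t &
        forall x y, P x -> P y -> (f x = f y <-> Q (x - y))].

Definition finite_index (V : zmodType) (P Q : set V) := exists n, is_index P Q n.

(* The index [P : Q], with junk value 0 when it is infinite. *)
Definition idx (V : zmodType) (P Q : set V) : nat := xget 0%N (is_index P Q).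

Section SubgroupTheory.
Variables (V : zmodType) (P : set V).
Hypothesis sP : subgroup P.

Lemma subgroup0 : P 0. Proof. by case: sP. Qed.

Lemma subgroupB x y : P x -> P y -> P (x - y).
Proof. by case: sP => _; exact. Qed.

Lemma subgroupN x : P x -> P (- x).
Proof. by move=> Px; rewrite -sub0r; apply: subgroupB => //; exact: subgroup0. Qed.

Lemma subgroupD x y : P x -> P y -> P (x + y).
Proof. by move=> Px Py; rewrite -[y]opprK; apply: subgroupB => //; exact: subgroupN. Qed.

Lemma subgroup_sym x y : P (x - y) -> P (y - x).
Proof. by move=> Pxy; rewrite -opprB; exact: subgroupN. Qed.

Lemma subgroup_trans y x z : P (x - y) -> P (y - z) -> P (x - z).
Proof. by move=> ? ?; rewrite -[x](subrK y) -addrA; exact: subgroupD. Qed.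

End SubgroupTheory.

Lemma subgroupT (V : zmodType) : subgroup [set: V].
Proof. by []. Qed.

Lemma subgroupI (V : zmodType) (P Q : set V) :
  subgroup P -> subgroup Q -> subgroup (P `&` Q).
Proof.
move=> [P0 PB] [Q0 QB]; split=> // x y [Px Qx] [Py Qy].
by split; [exact: PB | exact: QB].
Qed.

Section Index.
Variables (V : zmodType).
Implicit Types (P Q : set V).

Lemma is_index_uniq P Q m n : is_index P Q m -> is_index P Q n -> m = n.
Proof.
suff le m' n' : is_index P Q m' -> is_index P Q n' -> (m' <= n')%N.
  by move=> hm hn; apply/eqP; rewrite eqn_leq !le.
move=> [T [f [<- fs fP]]] [T' [g [<- gs gP]]].
have /choice[s sP] : forall t, exists x, P x /\ f x = t.
  by move=> t; have [x] := fs t; exists x.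
apply: (@leq_card _ _ (g \o s)) => t t' /= gst.
have [[Ps <-] [Ps' <-]] := (sP t, sP t').
by apply/fP => //; apply/gP.
Qed.

Lemma idxP P Q : finite_index P Q -> is_index P Q (idx P Q).
Proof. by move=> h; exact: xgetPex. Qed.

Lemma is_indexE P Q n : is_index P Q n -> idx P Q = n.
Proof. by move=> h; have := idxP (ex_intro _ n h); move/is_index_uniq; exact. Qed.

Lemma idx_gt0 P Q : P !=set0 -> finite_index P Q -> (0 < idx P Q)%N.
Proof.
by move=> [x Px] /idxP[T [f [<- _ _]]]; apply/card_gt0P; exists (f x).
Qed.

(* Separating points suffices: a coset is recoloured by some colour occurring in it. *)
Lemma index_sep P Q (T : finType) (f : V -> T) : P 0 -> subgroup Q ->
  (forall x y, P x -> P y -> f x = f y -> Q (x - y)) ->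
  exists2 n, is_index P Q n & (n <= #|T|)%N.
Proof.
move=> P0 sQ fP.
pose col (x : V) (t : T) := `[< exists y, [/\ P y, Q (x - y) & f y = t] >].
pose c (x : V) : T := odflt (f x) [pick t | col x t].
pose im : pred T := fun t => `[< exists2 x, P x & c x = t >].
have colx x : P x -> col x (f x).
  by move=> Px; apply/asboolP; exists x; rewrite subrr; split=> //; exact: subgroup0.
have cE x y : P x -> P y -> c x = c y <-> Q (x - y).
  move=> Px Py; split; rewrite /c.
    case: pickP => [t /asboolP[x' [Px' Qxx' fx']]|/(_ (f x))]; last by rewrite colx.
    case: pickP => [t' /asboolP[y' [Py' Qyy' fy']]|/(_ (f y))]; last by rewrite colx.
    move=> /= tt'; apply: (subgroup_trans sQ Qxx'); apply: (subgroup_trans sQ (y := y')).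
      by apply: fP => //; rewrite fx' fy'.
    exact: subgroup_sym.
  move=> Qxy; have -> : col x = col y.
    apply/funext => t; apply: asbool_equiv_eq; split=> -[z [Pz Qz fz]]; exists z; split=> //.
      by apply: (subgroup_trans sQ _ Qz); exact: subgroup_sym.
    exact: (subgroup_trans sQ Qxy).
  by case: pickP => [//|/(_ (f y))]; rewrite colx.
have cim x : P x -> im (c x) by move=> Px; apply/asboolP; exists x.
exists #|im|; last exact: max_card.
pose d x : {t | im t} := insubd (exist (fun t => im t) _ (cim _ P0)) (c x).
have dE x : P x -> val (d x) = c x.
  by move=> Px; apply: insubdK; exact (cim x Px).
exists {t | im t}, d; split; first exact: card_sig.
  move=> [t tim]; have /asboolP[x Px cx] := tim.
  by exists x => //; apply: val_inj; rewrite dE.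
by move=> x y Px Py; rewrite -cE// -!dE//; split=> [->//|/val_inj].
Qed.

Lemma index_refl P : P 0 -> subgroup P -> is_index P P 1.
Proof.
move=> P0 sP; exists unit, (fun=> tt); split; first by rewrite card_unit.
  by case; exists 0.
by move=> x y Px Py; split=> // _; exact: subgroupB.
Qed.

(** With a representative [s t] of each class modulo [Q], the class of [x] modulo [R] is recorded by
    its class modulo [Q] and the class of [x - s (f x)] modulo [R]. *)
Lemma index_mul P Q R m n : subgroup P -> subgroup Q -> subgroup R -> Q `<=` P -> R `<=` Q ->
  is_index P Q m -> is_index Q R n -> is_index P R (m * n).
Proof.
move=> sP sQ sR QP RQ [T [f [<- fs fP]]] [T' [g [<- gs gP]]].
have /choice[s sE] : forall t, exists x, P x /\ f x = t.
  by move=> t; have [x] := fs t; exists x.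
have Qs x : P x -> Q (x - s (f x)).
  by move=> Px; have [? ?] := sE (f x); apply/fP.
exists (T * T')%type, (fun x => (f x, g (x - s (f x)))); split; first by rewrite card_prod.
  move=> [t t']; have [x Qx gx] := gs t'; have [Pst fst] := sE t.
  have Px : P (x + s t) by apply: subgroupD => //; exact: QP.
  have fx : f (x + s t) = t by rewrite -[RHS]fst; apply/fP => //; rewrite addrK.
  by exists (x + s t) => //; rewrite fx addrK gx.
move=> x y Px Py; split=> [[fxy gxy]|Rxy].
  have := Qs y Py; rewrite -fxy => Qy; move: gxy; rewrite -fxy => /gP.
  by move=> /(_ (Qs x Px) Qy); rewrite opprB addrA subrK.
have fxy : f x = f y by apply/fP => //; exact: RQ.
congr (_, _) => //; apply/gP; [exact: Qs | exact: Qs|].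
by rewrite fxy opprB addrA subrK.
Qed.

Lemma idx_mul P Q R : subgroup P -> subgroup Q -> subgroup R -> Q `<=` P -> R `<=` Q ->
  finite_index P Q -> finite_index Q R ->
  finite_index P R /\ idx P R = (idx P Q * idx Q R)%N.
Proof.
move=> sP sQ sR QP RQ /idxP iPQ /idxP iQR.
have h := index_mul sP sQ sR QP RQ iPQ iQR.
by split; [eexists; exact: h | exact: is_indexE].
Qed.

End Index.

Section IndexTransfer.
Variables (V W : zmodType).

(** Pulling a separating colouring back along [phi] separates again. [phi] may be any map, even a
    mere choice of preimages. *)
Lemma index_le (P Q : set V) (P' Q' : set W) (phi : V -> W) : P 0 -> subgroup Q ->
  finite_index P' Q' -> (forall x, P x -> P' (phi x)) ->
  (forall x y, P x -> P y -> Q' (phi x - phi y) -> Q (x - y)) ->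
  finite_index P Q /\ (idx P Q <= idx P' Q')%N.
Proof.
move=> P0 sQ /idxP[T [f [<- fs fP]]] PP' QQ'.
have [x y Px Py fxy|n hn le] := @index_sep V P Q T (f \o phi) P0 sQ.
- by apply: QQ' => //; apply/fP => //; exact: PP'.
- by split; [exists n | rewrite (is_indexE hn)].
Qed.

End IndexTransfer.

Section IndexTransfer2.
Variables (V W : zmodType).

(** A choice of preimages under [phi], up to [Q'], is a map in the other direction to which
    [index_le] applies. *)
Lemma index_ge (P Q : set V) (P' Q' : set W) (phi : V -> W) : P' 0 -> subgroup Q' ->
  finite_index P Q -> (forall y, P' y -> exists2 x, P x & Q' (y - phi x)) ->
  (forall x y, P x -> P y -> Q (x - y) -> Q' (phi x - phi y)) ->
  finite_index P' Q' /\ (idx P' Q' <= idx P Q)%N.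
Proof.
move=> P'0 sQ' fPQ surj QQ'.
have /choice[psi psiE] : forall y, exists x, P' y -> P x /\ Q' (y - phi x).
  move=> y; have [P'y|] := pselect (P' y); last by exists 0.
  by have [x] := surj y P'y; exists x.
apply: (index_le (phi := psi)) => // [y /psiE[]//|y z /psiE[Py Q'y] /psiE[Pz Q'z] Qyz].
apply: (subgroup_trans sQ' Q'y); apply: (subgroup_trans sQ' (y := phi (psi z))).
  exact: QQ'.
exact: subgroup_sym.
Qed.

Lemma index_transfer (P Q : set V) (P' Q' : set W) (phi : V -> W) :
  P 0 -> P' 0 -> subgroup Q -> subgroup Q' ->
  finite_index P Q \/ finite_index P' Q' -> (forall x, P x -> P' (phi x)) ->
  (forall y, P' y -> exists2 x, P x & Q' (y - phi x)) ->
  (forall x y, P x -> P y -> Q (x - y) <-> Q' (phi x - phi y)) ->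
  [/\ finite_index P Q, finite_index P' Q' & idx P Q = idx P' Q'].
Proof.
move=> P0 P'0 sQ sQ' fin PP' surj QQ'.
have ge f := @index_ge P Q P' Q' phi P'0 sQ' f surj (fun x y Px Py => (QQ' x y Px Py).1).
have le f := @index_le V W P Q P' Q' phi P0 sQ f PP' (fun x y Px Py => (QQ' x y Px Py).2).
have f : finite_index P Q by case: fin => // /le[].
have [f' leP] := ge f; have [_ geP] := le f'.
by split=> //; apply/eqP; rewrite eqn_leq geP leP.
Qed.

Lemma index_prod (P Q : set V) (P' Q' : set W) m n :
  is_index P Q m -> is_index P' Q' n -> is_index (P `*` P') (Q `*` Q') (m * n).
Proof.
move=> [T [f [<- fs fP]]] [T' [g [<- gs gP]]].
exists (T * T')%type, (fun x => (f x.1, g x.2)); split; first by rewrite card_prod.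
  by move=> [t t']; have [[x ? <-] [y ? <-]] := (fs t, gs t'); exists (x, y).
move=> [x y] [x' y'] [/= Px P'y] [/= Px' P'y']; split=> [[/fP Q1 /gP Q2]|[/= Q1 Q2]].
  by split; [exact: Q1 | exact: Q2].
by congr (_, _); [apply/fP | apply/gP].
Qed.

End IndexTransfer2.

Lemma idx_le_sub (V : zmodType) (P Q P' Q' : set V) : P 0 -> subgroup Q ->
  finite_index P' Q' -> P `<=` P' -> (forall x, P x -> Q' x -> Q x) -> subgroup P ->
  finite_index P Q /\ (idx P Q <= idx P' Q')%N.
Proof.
move=> P0 sQ fin PP' QQ' sP; apply: (index_le (phi := id)) => // x y Px Py.
by apply: QQ'; exact: subgroupB.
Qed.

(** * Vectors modulo a subgroup, and Shearer's inequality *)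

Definition pointwise (X : finType) (V : zmodType) (J : set V) (C : pred X) :
    set {ffun X -> V} := fun h => forall x, C x -> J (h x).

Section Pointwise.
Variables (X : finType) (V : zmodType) (J : set V).
Hypothesis sJ : subgroup J.

Lemma subgroup_pointwise (C : pred X) : subgroup (pointwise J C).
Proof.
split=> [x _|g h Jg Jh x Cx]; first by rewrite ffunE; exact: subgroup0.
by rewrite !ffunE; apply: subgroupB => //; [exact: Jg | exact: Jh].
Qed.

Lemma index_ffun n : is_index setT J n ->
  is_index [set: {ffun X -> V}] (pointwise J predT) (n ^ #|X|).
Proof.
move=> [T [f [<- fs fP]]].
exists {ffun X -> T}, (fun h : {ffun X -> V} => [ffun x => f (h x)]); split; first by rewrite card_ffun.
  move=> t; have /choice[s sE] : forall t, exists x, f x = t by move=> u; have [x _ <-] := fs u; exists x.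
  by exists [ffun x => s (t x)] => //; apply/ffunP => x; rewrite !ffunE.
move=> g h _ _; split=> [gh x _|Jgh].
  by have /ffunP/(_ x) := gh; rewrite !ffunE => /fP; exact.
by apply/ffunP => x; rewrite !ffunE; apply/fP => //; have := Jgh x isT; rewrite !ffunE.
Qed.

End Pointwise.

(* Shearer's inequality, in the form of a base of a polymatroid: the index
   [H : H(T)] of functions of [H] vanishing on [T] modulo [J] dominates a
   product of weights, with equality for the whole set of points. *)
Lemma shearer_weights (X : finType) (V : zmodType) (J : set V) (s : seq X) :
  subgroup J -> finite_index setT J -> uniq s ->
  forall H : set {ffun X -> V}, subgroup H ->
  finite_index H (H `&` pointwise J (mem s)) /\
  exists d : X -> nat,
  [/\ forall x, (0 < d x <= idx setT J)%N,
      idx H (H `&` pointwise J (mem s)) = (\prod_(x <- s) d x)%N &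
      forall C : pred X,
        finite_index H (H `&` pointwise J [predI C & mem s]) /\
        (\prod_(x <- s | C x) d x <= idx H (H `&` pointwise J [predI C & mem s]))%N].
Proof.
move=> sJ fJ; have sp C := @subgroup_pointwise X V J sJ C.
have J1 : (0 < idx setT J)%N by apply: idx_gt0 => //; exists 0.
elim: s => [|x s IHs] /=.
  move=> _ H sH; have E (C : pred X) : (forall x, ~~ C x) -> H `&` pointwise J C = H.
    by move=> C0; apply/seteqP; split=> [h []//|h Hh]; split=> // x; rewrite (negbTE (C0 x)).
  have ind := index_refl (subgroup0 sH) sH.
  rewrite E//; split; first by exists 1%N.
  exists (fun=> 1%N); split=> [//||C]; first by rewrite big_nil (is_indexE ind).
  rewrite E => [|x]; last by rewrite /= andbF.
  by rewrite big_nil (is_indexE ind); split=> //; exists 1%N.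
move=> /andP[xs us] H sH.
(* The weight of [x] is the index of [H'] in [H] and the other weights are those of [H']: each point
   is weighed among the vectors that already vanish modulo [J] at the points before it. *)
pose H' := H `&` pointwise J (pred1 x).
have sH' : subgroup H' by exact: subgroupI.
have [fin' [d' [d'J d'E d'C]]] := IHs us H' sH'.
have H'E (C : pred X) : C x -> H `&` pointwise J C = H' `&` pointwise J [predD1 C & x].
  move=> Cx; apply/seteqP; split=> [h [Hh hC]|h [[Hh hx] hC]].
    by do 2?split=> //; [move=> y /= /eqP->; exact: hC | move=> y /= /andP[_]; exact: hC].
  split=> // y Cy; have [->|yx] := eqVneq y x; first by apply: hx => /=.
  by apply: hC; rewrite /= yx.
have [f1 le1] : finite_index H H' /\ (idx H H' <= idx setT J)%N.
  apply: (index_le (phi := fun h : {ffun X -> V} => h x)) => // [|g h Hg Hh Jgh]; first exact: subgroup0.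
  by split; [exact: subgroupB | move=> y /= /eqP->; rewrite !ffunE].
have ge1 : (0 < idx H H')%N by apply: idx_gt0 => //; exists 0; exact: subgroup0.
have mulE (C : pred X) : C x -> finite_index H' (H' `&` pointwise J [predD1 C & x]) ->
    finite_index H (H `&` pointwise J C) /\
    idx H (H `&` pointwise J C) = (idx H H' * idx H' (H' `&` pointwise J [predD1 C & x]))%N.
  move=> Cx fC; rewrite H'E//.
  exact: (idx_mul sH sH' (subgroupI sH' (sp _)) (@subIsetl _ _ _) (@subIsetl _ _ _) f1 fC).
have E1 : [predD1 (mem (x :: s)) & x] =1 mem s.
  by move=> y; rewrite /= ?inE /=; case: eqVneq => // ->; rewrite (negbTE xs).
have eqp (C D : pred X) : C =1 D -> pointwise J C = pointwise J D.
  by move=> /funext->.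
have [|f2 E2] := mulE (mem (x :: s)) (mem_head x s); first by rewrite (eqp _ _ E1).
split=> //; pose d y := if y == x then idx H H' else d' y.
have dE (C : pred X) : (\prod_(y <- s | C y) d y = \prod_(y <- s | C y) d' y)%N.
  rewrite big_seq_cond [RHS]big_seq_cond; apply: eq_bigr => y /andP[ys _].
  by rewrite /d; case: eqP => // yx; rewrite -yx ys in xs.
exists d; split=> [y||C]; first by rewrite /d; case: ifP => // _; rewrite ge1.
  by rewrite E2 (eqp _ _ E1) d'E big_cons {1}/d eqxx dE.
rewrite big_cons; case: ifP => Cx.
  have E3 : [predD1 [predI C & mem (x :: s)] & x] =1 [predI C & mem s].
    by move=> y; rewrite /= ?inE /=; case: eqVneq => // ->; rewrite (negbTE xs) andbF.
  have [fC leC] := d'C C.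
  have [||f3 ->] := mulE [predI C & mem (x :: s)]; first by apply/andP; split=> //; exact: mem_head.
    by rewrite (eqp _ _ E3).
  by split=> //; rewrite (eqp _ _ E3) {1}/d eqxx dE leq_mul2l leC orbT.
(* When [C] misses [x], the bound known for [H'] carries over to [H]: the quotient of [H'] by its
   vectors vanishing on [C] embeds in the corresponding quotient of [H]. *)
have E3 : [predI C & mem (x :: s)] =1 [predI C & mem s].
  by move=> y; rewrite /= ?inE /=; case: eqVneq => // ->; rewrite [x \in C]Cx.
rewrite (eqp _ _ E3); have [fC leC] := d'C C.
have sI (C' : pred X) : subgroup (H `&` pointwise J C') by exact: subgroupI.
pose HC := H `&` pointwise J [predI C & mem s].
have [fC2 _] : finite_index H HC /\ (idx H HC <= idx H H' * idx H' (H' `&` HC))%N.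
  have <- : H' `&` pointwise J [predI C & mem s] = H' `&` HC.
    apply/seteqP; split=> h; [case=> [[Hh hx] hC] | case=> hH' [_ hC]]; first by split=> //; split.
    by split.
  have fm : finite_index H (H' `&` pointwise J [predI C & mem s]).
    by have [] := idx_mul sH sH' (subgroupI sH' (sp [predI C & mem s])) (@subIsetl _ _ _) (@subIsetl _ _ _) f1 fC.
  have [_ <-] := idx_mul sH sH' (subgroupI sH' (sp [predI C & mem s])) (@subIsetl _ _ _) (@subIsetl _ _ _) f1 fC.
  apply: idx_le_sub => //; [exact: subgroup0 | exact: sI|].
  by move=> h Hh [_ hC]; split.
have [_ le2] : finite_index H' (H' `&` pointwise J [predI C & mem s]) /\
    (idx H' (H' `&` pointwise J [predI C & mem s]) <= idx H HC)%N.
  apply: idx_le_sub => //; [exact: subgroup0 | exact: subgroupI | by move=> h []|].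
  by move=> h H'h [_ hC]; split.
by split=> //; rewrite dE; exact: leq_trans leC le2.
Qed.

(** * Rings of integers *)

HB.instance Definition _ (K : fieldExtType rat) :=
  GRing.RMorphism.copy (@int_val K) (\val : ring_of_integers K -> K).

Section Integers.
Variable K : fieldExtType rat.
Notation O := (ring_of_integers K).
Implicit Types (x y z : K) (c : O).

Lemma int_val_inj : injective (@int_val K).
Proof. exact: val_inj. Qed.

Lemma int_val_eq0 c : (int_val c == 0) = (c == 0).
Proof. by rewrite -(inj_eq int_val_inj) rmorph0. Qed.

Definition to_int x : O := insubd 0 x.

Lemma to_intK x : x \in @is_integral K -> int_val (to_int x) = x.
Proof. exact: insubdK. Qed.

Lemma int_valP c : int_val c \in @is_integral K.
Proof. exact: valP. Qed.

Lemma mem_integral x : x \in @is_integral K <-> exists c : O, int_val c = x.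
Proof. by split=> [/to_intK xE|[c <-]]; [exists (to_int x) | exact: int_valP]. Qed.

(** The vector [g] exhibits [x] as an eigenvalue of a matrix over O, hence as a root of its monic
    characteristic polynomial, and integrality is transitive. *)
Lemma integral_eigen n (A : 'M[O]_n) (g : 'I_n -> K) x :
  (exists i, g i != 0) -> (forall i, x * g i = \sum_j int_val (A i j) * g j) ->
  x \in @is_integral K.
Proof.
move=> [i0 gi0] gE; pose B := map_mx (@int_val K) (A^T).
have : eigenvalue B x.
  apply/eigenvalueP; exists (\row_i g i); last first.
    by apply/eqP => /rowP/(_ i0)/eqP; rewrite !mxE (negbTE gi0).
  apply/rowP => i; rewrite !mxE gE; apply: eq_bigr => j _.
  by rewrite !mxE mulrC.
rewrite eigenvalue_root_char -map_char_poly => rx.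
apply/asboolP; apply: integral_root_monic rx _.
  exact/monic_map/char_poly_monic.
by move=> _ /(nthP 0)[j lt <-]; rewrite coef_map; have /asboolP := int_valP (char_poly A^T)`_j.
Qed.

Notation d := (\dim {:K}).
Notation e := (vbasis {:K}).

Definition crd (i : 'I_d) : K -> rat := coord e i.

Lemma crd_sum x : x = \sum_i crd i x *: e`_i.
Proof. exact: coord_vbasis (memvf x). Qed.

Lemma crdD i : {morph crd i : x y / x + y}. Proof. exact: linearD. Qed.
Lemma crdN i : {morph crd i : x / - x}. Proof. exact: linearN. Qed.
Lemma crdB i : {morph crd i : x y / x - y}. Proof. exact: linearB. Qed.
Lemma crdZ i (q : rat) x : crd i (q *: x) = q * crd i x. Proof. exact: linearZ. Qed.

Lemma crd_sumE i I (r : seq I) (P : pred I) (F : I -> K) :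
  crd i (\sum_(j <- r | P j) F j) = \sum_(j <- r | P j) crd i (F j).
Proof. exact: linear_sum. Qed.

Lemma crd_comb i (q : 'I_d -> rat) : crd i (\sum_j q j *: e`_j) = q i.
Proof. exact: coord_sum_free (basis_free (vbasisP _)). Qed.

Lemma common_denominator (I : finType) (q : I -> rat) :
  exists2 D : nat, (0 < D)%N & forall i, D%:R * q i \is a Num.int.
Proof.
exists (\prod_i `|denq (q i)|)%N => [|i]; first by rewrite prodn_gt0// => i; rewrite absz_gt0 denq_neq0.
rewrite (bigD1 i)//= natrM mulrAC rpredM ?natr_int// natr_absz.
rewrite ger0_norm ?denq_ge0// mulrC -numqE; exact: intr_int.
Qed.

Lemma vbasis_neq0 : exists i : 'I_d, e`_i != 0.
Proof.
have d0 : (0 < d)%N by rewrite adim_gt0.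
exists (Ordinal d0); have := basis_free (vbasisP {:K}); move/free_not0; apply.
by rewrite mem_nth// size_tuple.
Qed.

(** In a rational basis of K, multiplication by [D * x] has an integer matrix once [D] clears the
    denominators, so [integral_eigen] applies to the basis itself. *)
Lemma integral_multiple x : exists2 D : nat, (0 < D)%N & D%:R * x \in @is_integral K.
Proof.
have [D D0 Dint] := common_denominator (fun ij : 'I_d * 'I_d => crd ij.2 (x * e`_ij.1)).
exists D => //.
pose A : 'M[O]_d := \matrix_(i, j) (Num.floor (D%:R * crd j (x * e`_i)))%:~R.
apply: (@integral_eigen _ A (fun i => e`_i) _ vbasis_neq0) => i.
rewrite -mulrA {1}(crd_sum (x * e`_i)) mulr_sumr; apply: eq_bigr => j _.
rewrite mxE rmorph_int mulr_natl -scaler_nat scalerA.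
have /floorK E := Dint (i, j); rewrite /= in E; rewrite -{1}E.
by rewrite scaler_int mulrzl.
Qed.

Lemma integral_multiples (I : finType) (x : I -> K) :
  exists2 D : nat, (0 < D)%N & forall i, D%:R * x i \in @is_integral K.
Proof.
have /choice[D DE] : forall i, exists D : nat, (0 < D)%N /\ D%:R * x i \in @is_integral K.
  by move=> i; have [D] := integral_multiple (x i); exists D.
exists (\prod_i D i)%N => [|i]; first by rewrite prodn_gt0// => i; case: (DE i).
by rewrite (bigD1 i)//= natrM mulrAC rpredM ?rpred_nat//; case: (DE i).
Qed.

(** This l1 norm in rational coordinates stands in for the archimedean absolute values of K; it is
    submultiplicative up to the factor [nrm_const]. *)
Definition nrm x : rat := \sum_i `|crd i x|.

Lemma nrm_ge0 x : 0 <= nrm x. Proof. exact: sumr_ge0. Qed.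

Lemma nrmD x y : nrm (x + y) <= nrm x + nrm y.
Proof. by rewrite -big_split ler_sum// => i _; rewrite crdD ler_normD. Qed.

Lemma nrmN x : nrm (- x) = nrm x.
Proof. by apply: eq_bigr => i _; rewrite crdN normrN. Qed.

Lemma nrmB x y : nrm (x - y) <= nrm x + nrm y.
Proof. by rewrite -[nrm y]nrmN nrmD. Qed.

Lemma nrmZ (q : rat) x : nrm (q *: x) = `|q| * nrm x.
Proof. by rewrite mulr_sumr; apply: eq_bigr => i _; rewrite crdZ normrM. Qed.

Lemma nrm0 : nrm 0 = 0.
Proof. by rewrite -[0](scale0r 0) nrmZ normr0 mul0r. Qed.

Lemma nrm_sum I (r : seq I) (P : pred I) (F : I -> K) :
  nrm (\sum_(i <- r | P i) F i) <= \sum_(i <- r | P i) nrm (F i).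
Proof.
elim/big_rec2: _ => [|i u v _ le]; first by rewrite nrm0.
by apply: le_trans (nrmD _ _) _; rewrite lerD2l.
Qed.

Lemma crd_le i x : `|crd i x| <= nrm x.
Proof. by rewrite /nrm (bigD1 i)//= lerDl sumr_ge0. Qed.

Definition nrm_const : rat := 1 + \sum_(i < d) \sum_(j < d) nrm (e`_i * e`_j).

Lemma nrm_const_ge1 : 1 <= nrm_const.
Proof. by rewrite lerDl; do 2!(apply: sumr_ge0 => ? _); exact: nrm_ge0. Qed.

Lemma nrmM x y : nrm (x * y) <= nrm_const * (nrm x * nrm y).
Proof.
rewrite {1}[x]crd_sum {1}[y]crd_sum mulr_suml.
apply: le_trans (nrm_sum _ _ _) _.
have -> : nrm_const = 1 + \sum_(i < d) \sum_(j < d) nrm (e`_i * e`_j) by [].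
rewrite mulrDl mul1r; apply: ler_wpDl; first by rewrite mulr_ge0 ?nrm_ge0.
rewrite mulr_suml; apply: ler_sum => i _.
rewrite mulr_sumr mulr_suml; apply: le_trans (nrm_sum _ _ _) _; apply: ler_sum => j _.
rewrite -scalerAl -scalerAr !nrmZ mulrA mulrC ler_wpM2l ?nrm_ge0//.
by rewrite ler_pM// crd_le.
Qed.

(** By the monic equation of [x], all its powers are integer combinations of the first [n], so a
    common denominator of those serves for all. *)
Lemma integral_powers_bounded x : x \in @is_integral K ->
  exists2 D : nat, (0 < D)%N & forall k i, D%:R * crd i (x ^+ k) \is a Num.int.
Proof.
move=> /asboolP[p mp rp].
pose n := (size p).-1.
have [D D0 DE] := common_denominator (fun ij : 'I_n * 'I_d => crd ij.2 (x ^+ ij.1)).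
exists D => // k; elim/ltn_ind: k => k IHk i.
have [kn|nk] := ltnP k n; first exact: (DE (Ordinal kn, i)).
have szp : size p = n.+1 by rewrite prednK// size_poly_gt0 monic_neq0.
have xn : x ^+ n = - \sum_(j < n) (p`_j)%:~R * x ^+ j.
  move/rootP: rp; rewrite horner_coef size_map_poly_id0; last first.
    by rewrite (monicP mp) rmorph1 oner_eq0.
  rewrite szp big_ord_recr /= coef_map /=.
  have -> : p`_n = 1 by move/monicP: mp; rewrite lead_coefE.
  rewrite mul1r addrC => /eqP; rewrite addr_eq0 => /eqP ->.
  by congr (- _); apply: eq_bigr => j _; rewrite coef_map.
rewrite -(subnK nk) exprD xn mulrN mulr_sumr crdN mulrN rpredN.
rewrite crd_sumE mulr_sumr rpred_sum// => j _.
rewrite mulrCA -exprD mulrzl -scaler_int crdZ mulrCA rpredM ?intr_int//.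
apply: IHk; rewrite -ltn_subRL subKn//; exact: ltn_ord.
Qed.

(* The powers of a small [x] tend to 0 but have bounded denominators. *)
Lemma integral_discrete x : x \in @is_integral K -> 2 * nrm_const * nrm x < 1 -> x = 0.
Proof.
move=> /integral_powers_bounded[D D0 DE] x_small.
have c0 : 0 < nrm_const by apply: lt_le_trans nrm_const_ge1.
have pow k : nrm (x ^+ k.+1) <= 2^-1 ^+ k * nrm x.
  elim: k => [|k IHk]; first by rewrite expr0 mul1r expr1.
  rewrite exprS; apply: le_trans (nrmM _ _) _.
  rewrite mulrA; apply: (@le_trans _ _ (2^-1 * nrm (x ^+ k.+1))).
    rewrite ler_wpM2r ?nrm_ge0//; lra.
  by rewrite [in leRHS]exprS -mulrA ler_wpM2l.
have [k kE] : exists k : nat, D%:R * (2^-1 ^+ k * nrm x) < 1.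
  have [k kE] : exists k : nat, D%:R * nrm x < k%:R.
    exists (Num.bound (D%:R * nrm x)); apply: archi_boundP.
    by rewrite mulr_ge0 ?nrm_ge0.
  exists k; rewrite mulrCA exprVn mulrC ltr_pdivrMr ?exprn_gt0// mul1r.
  apply: lt_trans kE _; rewrite -natrX ltr_nat; exact: ltn_expl.
apply/eqP; have : x ^+ k.+1 == 0; last by rewrite expf_eq0 => /andP[].
apply/eqP; rewrite [LHS]crd_sum big1// => i _.
suff -> : crd i (x ^+ k.+1) = 0 by rewrite scale0r.
have /intrP[m mE] := DE k.+1 i.
have D0' : (D%:R : rat) != 0 by rewrite pnatr_eq0 -lt0n.
suff m0 : m = 0.
  by apply/eqP; move/eqP: mE; rewrite m0 mulf_eq0 (negbTE D0').
have : `|m%:~R : rat| < 1.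
  rewrite -mE normrM normr_nat; apply: le_lt_trans kE.
  rewrite ler_wpM2l//; apply: le_trans (pow k); exact: crd_le.
rewrite -intr_norm -[1]/(1%:~R) ltr_int; lia.
Qed.

End Integers.

(** * Ideals *)

Definition lin_closed (A : comNzRingType) (V : lmodType A) (P : V -> Prop) :=
  P 0 /\ forall c x y, P x -> P y -> P (c *: x + y).

Section MakeSubmodule.
Variables (A : comNzRingType) (V : lmodType A) (P : V -> Prop).
Hypothesis P_closed : lin_closed P.

Lemma mk_submodule_closed : submod_closed (fun x => `[< P x >]).
Proof.
split=> [|c x y /asboolP Px /asboolP Py]; apply/asboolP; first by case: P_closed.
by case: P_closed => _; exact.
Qed.

Definition mk_submodule : submodule V := Submodule mk_submodule_closed.

Lemma mk_submoduleP x : x \in mk_submodule <-> P x.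
Proof. by split=> [/asboolP|Px]; last exact/asboolP. Qed.

End MakeSubmodule.

Definition ideal_closed (A : comNzRingType) (P : A -> Prop) :=
  P 0 /\ forall c x y, P x -> P y -> P (c * x + y).

Definition mk_ideal (A : comNzRingType) (P : A -> Prop) (h : ideal_closed P) : ideal A :=
  @mk_submodule A A^o P h.

Lemma mk_idealP (A : comNzRingType) (P : A -> Prop) (h : ideal_closed P) x :
  x \in mk_ideal h <-> P x.
Proof. exact: (@mk_submoduleP A A^o P h x). Qed.

Definition iset (A : comNzRingType) (J : ideal A) : set A := fun x => x \in J.

Section Ideals.
Variable A : comNzRingType.
Implicit Types (I J a p : ideal A) (x y z c : A).

Lemma ideal_0 J : (0 : A) \in J. Proof. exact: rpred0. Qed.
Lemma idealD J x y : x \in J -> y \in J -> (x + y : A) \in J. Proof. exact: rpredD. Qed.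
Lemma idealB J x y : x \in J -> y \in J -> (x - y : A) \in J. Proof. exact: rpredB. Qed.
Lemma idealN J x : x \in J -> (- x : A) \in J. Proof. by move=> h; rewrite -sub0r; apply: idealB => //; exact: ideal_0. Qed.
Lemma idealZl J c x : x \in J -> (c * x : A) \in J.
Proof. exact: (@rpredZ A A^o J). Qed.
Lemma idealZr J c x : x \in J -> (x * c : A) \in J.
Proof. by rewrite mulrC; exact: idealZl. Qed.
Lemma ideal_sum J T (r : seq T) (P : pred T) (F : T -> A) :
  (forall i, P i -> F i \in J) -> (\sum_(i <- r | P i) F i : A) \in J.
Proof. exact: (@rpred_sum _ J). Qed.

Lemma subgroup_iset J : subgroup (iset J).
Proof. by split=> [|x y]; [exact: ideal_0 | exact: idealB]. Qed.
Hint Resolve subgroup_iset : core.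

Lemma ideal_ext I J : (forall x, x \in I <-> x \in J) -> I = J.
Proof. by move=> h; apply: submodule_ext => x; apply/idP/idP => /h. Qed.

Lemma mem_ideal0 x : (x \in ideal0 A) = (x == 0). Proof. by []. Qed.

Lemma ideal1P J : (1 : A) \in J -> J = ideal1 A.
Proof. by move=> J1; apply: ideal_ext => x; split=> // _; rewrite -[x]mulr1; exact: idealZl. Qed.

Lemma ideal1N J : J != ideal1 A -> (1 : A) \notin J.
Proof. by apply: contraNN => /ideal1P->. Qed.

Lemma ideal0P J : J != ideal0 A -> exists2 x : A, x \in J & x != 0.
Proof.
move=> J0; apply: contrapT => h; case/eqP: J0; apply: ideal_ext => x.
rewrite mem_ideal0; split=> [Jx|/eqP->]; last exact: ideal_0.
by apply/eqP; apply: contrapT => x0; apply: h; exists x => //; exact/eqP.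
Qed.

Lemma ideal_neq0 J x : x \in J -> x != 0 -> J != ideal0 A.
Proof. by move=> Jx x0; apply: contra_neq x0 => J0; apply/eqP; rewrite -mem_ideal0 -J0. Qed.

Fact principal_closed x : ideal_closed (fun y : A => exists c : A, y = c * x).
Proof.
split=> [|c _ _ [u ->] [v ->]]; first by exists 0; rewrite mul0r.
by exists (c * u + v); rewrite mulrDl mulrA.
Qed.
Definition principal x : ideal A := mk_ideal (principal_closed x).

Lemma principalP x y : y \in principal x <-> exists c, y = c * x.
Proof. exact: mk_idealP. Qed.

Lemma mem_principal x : x \in principal x.
Proof. by apply/principalP; exists 1; rewrite mul1r. Qed.

Fact ideal_add_closed I J :
  ideal_closed (fun z : A => exists x y : A, [/\ x \in I, y \in J & z = x + y]).
Proof.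
split=> [|c _ _ [x [y [Ix Jy ->]]] [x' [y' [Ix' Jy' ->]]]].
  by exists 0, 0; rewrite addr0; split=> //; exact: ideal_0.
exists (c * x + x'), (c * y + y'); split.
- by apply: idealD => //; exact: idealZl.
- by apply: idealD => //; exact: idealZl.
by rewrite mulrDr addrACA.
Qed.
Definition ideal_add I J : ideal A := mk_ideal (ideal_add_closed I J).

Lemma ideal_addP I J z : z \in ideal_add I J <-> exists x y, [/\ x \in I, y \in J & z = x + y].
Proof. exact: mk_idealP. Qed.

Lemma ideal_addl I J x : x \in I -> x \in ideal_add I J.
Proof. by move=> Ix; apply/ideal_addP; exists x, 0; rewrite addr0; split=> //; exact: ideal_0. Qed.

Lemma ideal_addr I J x : x \in J -> x \in ideal_add I J.
Proof. by move=> Ix; apply/ideal_addP; exists 0, x; rewrite add0r; split=> //; exact: ideal_0. Qed.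

Fact colon_closed a (B : set A) :
  ideal_closed (fun z : A => forall x, B x -> (z * x : A) \in a).
Proof.
split=> [x _|c y z Py Pz x Bx]; first by rewrite mul0r; exact: ideal_0.
rewrite mulrDl; apply: idealD; last exact: Pz.
by rewrite -mulrA; apply: idealZl; exact: Py.
Qed.
Definition colon a (B : set A) : ideal A := mk_ideal (colon_closed a B).

Lemma colonP a (B : set A) z : z \in colon a B <-> forall x : A, B x -> (z * x : A) \in a.
Proof. exact: mk_idealP. Qed.

Lemma colon_sub a (B : set A) z : z \in a -> z \in colon a B.
Proof. by move=> az; apply/colonP => x _; exact: idealZr. Qed.

(** Phrased elementwise as: the quotient by [p] is a field. *)
Definition maximal_ideal p := p != ideal1 A /\
  forall b : A, b \notin p -> exists c : A, (1 - c * b : A) \in p.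

Lemma maximal_prime p x y : maximal_ideal p -> (x * y : A) \in p -> x \notin p -> y \in p.
Proof.
move=> [_ mp] pxy /mp[c pc]; rewrite -[y]mul1r -(subrK (c * x) 1) mulrDl.
by apply: idealD; [exact: idealZr | rewrite -mulrA; exact: idealZl].
Qed.

Definition N J := idx setT (iset J).

End Ideals.
#[export] Hint Resolve subgroup_iset : core.

Lemma index1_sub (V : zmodType) (P Q : set V) : P 0 -> is_index P Q 1 -> P `<=` Q.
Proof.
move=> P0 [T [f [T1 _ fP]]] x Px; rewrite -[x]subr0; apply/(fP x 0) => //.
by have /card_le1_eqP := eq_leq T1; exact.
Qed.

(** * Finiteness of the quotients of O, and norms of ideals *)

Section FiniteQuotients.
Variable K : fieldExtType rat.
Notation O := (ring_of_integers K).
Implicit Types (I J a p : ideal O) (x y z c : O).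

Lemma int_valD x y : int_val (x + y) = int_val x + int_val y. Proof. exact: rmorphD. Qed.
Lemma int_valM x y : int_val (x * y) = int_val x * int_val y. Proof. exact: rmorphM. Qed.

Lemma int_valB x y : int_val (x - y) = int_val x - int_val y. Proof. exact: rmorphB. Qed.
Lemma int_val1 : int_val (1 : O) = 1. Proof. exact: rmorph1. Qed.

Lemma int_val_sum T (r : seq T) (P : pred T) (F : T -> O) :
  int_val (\sum_(i <- r | P i) F i) = \sum_(i <- r | P i) int_val (F i).
Proof. exact: (rmorph_sum (@int_val K)). Qed.

Lemma integers_mulI x y z : x != 0 -> x * y = x * z -> y = z.
Proof.
rewrite -int_val_eq0 => x0 /(congr1 (@int_val K)); rewrite !int_valM.
by move/(mulfI x0)/int_val_inj.
Qed.

Lemma integers_mul_neq0 x y : x != 0 -> y != 0 -> x * y != 0.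
Proof. by rewrite -!int_val_eq0 int_valM => ? ?; rewrite mulf_neq0. Qed.

Lemma nat_eq0 n : (n%:R == 0 :> K) = (n == 0%N).
Proof. by rewrite -(rmorph_nat (in_alg K)) fmorph_eq0 pnatr_eq0. Qed.

(** The box of width [1/L] that contains the fractional part of [q]. The type ['I_L.+1] has one box
    to spare, so that [inord] makes sense for every [L]. *)
Definition bucket (L : nat) (q : rat) : 'I_L.+1 :=
  inord `|Num.floor (L%:R * (q - (Num.floor q)%:~R))|.

Lemma bucketP (L : nat) (q r : rat) : (0 < L)%N -> bucket L q = bucket L r ->
  exists k : int, L%:R * `|q - r - k%:~R| < 1.
Proof.
move=> L0 /(congr1 val) /=.
have L0' : 0 < L%:R :> rat by rewrite ltr0n.
have frac (s : rat) : 0 <= s - (Num.floor s)%:~R < 1.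
  have /andP[le lt] := floor_itv s; rewrite subr_ge0 le/= ltrBlDl.
  by rewrite intrD in lt.
pose F (s : rat) : int := Num.floor (L%:R * (s - (Num.floor s)%:~R)).
have F0 s : 0 <= F s by rewrite floor_ge0 mulr_ge0//; case/andP: (frac s).
have FL s : (`|F s| < L.+1)%N.
  rewrite ltnS -lez_nat gez0_abs// ltW// floor_lt_int gtr_pMr//.
  by case/andP: (frac s).
rewrite /bucket (inordK (FL q)) (inordK (FL r)) => absE; have FE : F q = F r by rewrite -[LHS]gez0_abs// -[RHS]gez0_abs// -/(F q) absE.
exists (Num.floor q - Num.floor r).
have /andP[q1 q2] := floor_itv (L%:R * (q - (Num.floor q)%:~R) : rat).
have /andP[r1 r2] := floor_itv (L%:R * (r - (Num.floor r)%:~R) : rat).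
rewrite -/(F q) in q1 q2; rewrite -/(F r) -FE in r1 r2.
rewrite -[L%:R]ger0_norm// -normrM ltr_norml.
rewrite intrD in q2 r2; rewrite rmorphB/=; apply/andP; split; lra.
Qed.

(** Box principle: sort the [y] by the coordinates of [y / x] modulo the lattice spanned by the
    integral elements [D e_i]. If [y] and [z] share a box, then [(y - z) / x] is a lattice element
    [c] plus a small remainder [t]. Now [x t = (y - z) - x c] is integral, and [L] is chosen so
    large that [integral_discrete] forces it to vanish. *)
Lemma finite_principal x : x != 0 -> finite_index setT (iset (principal x)).
Proof.
move=> x0; have x0' : int_val x != 0 by rewrite int_val_eq0.
have [D D0 De] := integral_multiples (fun i : 'I_(\dim {:K}) => (vbasis {:K})`_i).
have D0' : (D%:R : rat) != 0 by rewrite pnatr_eq0 -lt0n.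
have [L L0 LE] : exists2 L : nat, (0 < L)%N &
    2 * nrm_const K * (nrm_const K * (nrm (int_val x) * ((\dim {:K})%:R * D%:R))) < L%:R.
  exists (Num.bound (2 * nrm_const K * (nrm_const K * (nrm (int_val x) * ((\dim {:K})%:R * D%:R))))).+1 => //.
  apply: (lt_le_trans (archi_boundP _)); last by rewrite ler_nat.
  have c0 : 0 <= nrm_const K by apply: le_trans (nrm_const_ge1 K).
  by rewrite !mulr_ge0// nrm_ge0.
pose f (y : O) := [ffun i => bucket L (crd i (int_val y / int_val x) / D%:R)].
have [y z _ _ /ffunP fyz|n hn _] := index_sep (Q := iset (principal x)) (f := f) (P := setT) I (subgroup_iset _); last by exists n.
have /choice[k kE] i : exists k : int, L%:R * `|crd i (int_val y / int_val x) / D%:R - crd i (int_val z / int_val x) / D%:R - k%:~R| < 1.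
  by apply: bucketP => //; have := fyz i; rewrite !ffunE.
pose c : O := \sum_i (k i)%:~R * to_int (D%:R * (vbasis {:K})`_i).
pose t := int_val (y - z) / int_val x - int_val c.
have tE i : crd i t = D%:R * (crd i (int_val y / int_val x) / D%:R - crd i (int_val z / int_val x) / D%:R - (k i)%:~R).
  have cE : int_val c = \sum_j ((k j)%:~R * D%:R) *: (vbasis {:K})`_j.
    rewrite int_val_sum; apply: eq_bigr => j _; rewrite int_valM rmorph_int to_intK//.
    by rewrite -scalerA scaler_int scaler_nat mulrzl mulr_natl.
  rewrite /t crdB cE crd_comb rmorphB/= mulrBl crdB.
  by rewrite !mulrBr ![D%:R * (_ / _)]mulrCA !divff// !mulr1 [D%:R * _]mulrC.
have nt : L%:R * nrm t <= (\dim {:K})%:R * D%:R.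
  rewrite /nrm mulr_sumr -[X in X%:R * _]card_ord -sum1_card natr_sum mulr_suml ler_sum// => i _.
  by rewrite tE normrM normr_nat mulrCA mul1r ler_piMr// ltW.
suff : int_val (y - z) - int_val x * int_val c = 0.
  move/eqP; rewrite subr_eq0 => /eqP yzE; apply/principalP; exists c.
  by apply: int_val_inj; rewrite int_valM mulrC.
have xtE : int_val (y - z) - int_val x * int_val c = int_val x * t by rewrite mulrBr mulrCA divff// mulr1.
apply: integral_discrete; first by apply: rpredB; [exact: int_valP | rewrite rpredM// int_valP].
have L0' : 0 < (L%:R : rat) by rewrite ltr0n.
have c0 : 0 <= nrm_const K by apply: le_trans (nrm_const_ge1 K).
rewrite xtE -(ltr_pM2l L0') mulr1; apply: le_lt_trans LE.
rewrite mulrCA -!mulrA !ler_wpM2l//.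
apply: (@le_trans _ _ (L%:R * (nrm_const K * (nrm (int_val x) * nrm t)))).
  by rewrite ler_wpM2l// nrmM.
by rewrite mulrCA ler_wpM2l// mulrCA ler_wpM2l ?nrm_ge0.
Qed.

Lemma finite_ideal J : J != ideal0 O -> finite_index setT (iset J).
Proof.
move=> /ideal0P[x Jx x0]; have fx := finite_principal x0.
have [] := @idx_le_sub _ setT (iset J) _ _ I (subgroup_iset J) fx (@subsetT _ _) _ (subgroupT _) => //.
by move=> y _ /principalP[c ->]; exact: idealZl.
Qed.

Lemma finite_sub I J : (forall x, x \in J -> x \in I) -> J != ideal0 O -> finite_index (iset I) (iset J).
Proof.
move=> JI /finite_ideal fJ.
have [] := @idx_le_sub _ (iset I) (iset J) _ _ (ideal_0 I) (subgroup_iset J) fJ (@subsetT _ _) _ (subgroup_iset I) => //.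
Qed.

Lemma N_gt0 J : J != ideal0 O -> (0 < N J)%N.
Proof. by move=> /finite_ideal; apply: idx_gt0; exists 0. Qed.

Lemma N_mul I J : (forall x, x \in J -> x \in I) -> J != ideal0 O ->
  N J = (N I * idx (iset I) (iset J))%N.
Proof.
move=> JI J0; have [x Jx x0] := ideal0P J0.
have I0 : I != ideal0 O by apply: ideal_neq0 x0; exact: JI.
by have [] := idx_mul (subgroupT _) (subgroup_iset I) (subgroup_iset J) (@subsetT _ _) JI (finite_ideal I0) (finite_sub JI J0).
Qed.

Lemma N_lt I J : (forall x, x \in J -> x \in I) -> J != ideal0 O -> J != I -> (N I < N J)%N.
Proof.
move=> JI J0 JneI; rewrite (N_mul JI J0) -[ltnLHS]muln1 ltn_pmul2l; last first.
  by have [x Jx x0] := ideal0P J0; apply: N_gt0; apply: ideal_neq0 x0; exact: JI.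
have fin := finite_sub JI J0.
rewrite ltn_neqAle eq_sym idx_gt0//; last by exists 0; exact: ideal_0.
rewrite andbT; apply: contraNN JneI => /eqP i1; apply/eqP/ideal_ext => x; split=> [/JI//|].
by apply: (@index1_sub _ (iset I) (iset J)); [exact: ideal_0 | rewrite -i1; exact: idxP].
Qed.

Lemma N_le I J : (forall x, x \in J -> x \in I) -> J != ideal0 O -> (N I <= N J)%N.
Proof. by move=> JI J0; have [->//|/(N_lt JI J0)/ltnW] := eqVneq J I. Qed.

Lemma N_ideal1 : N (ideal1 O) = 1%N.
Proof.
apply: is_indexE; have -> : iset (ideal1 O) = setT by apply/seteqP.
exact: index_refl.
Qed.

Lemma N_gt1 J : J != ideal0 O -> J != ideal1 O -> (1 < N J)%N.
Proof. by move=> J0 J1; rewrite -N_ideal1 N_lt. Qed.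

(** Otherwise all powers of 1/2 would be integral, although they become arbitrarily small. *)
Lemma half_not_integral : (2^-1 : K) \notin @is_integral K.
Proof.
apply/negP => h; have c0 : 0 <= nrm_const K by apply: le_trans (nrm_const_ge1 K).
pose k := Num.bound (2 * nrm_const K * nrm (1 : K)).
have : (2^-1 : K) ^+ k = 0.
  apply: integral_discrete; first exact: rpredX.
  have -> : (2^-1 : K) ^+ k = (2^-1 ^+ k : rat) *: 1.
    have -> : (2^-1 : K) = in_alg K 2^-1 by rewrite fmorphV rmorph_nat.
    by rewrite -rmorphXn.
  rewrite nrmZ mulrCA ger0_norm// exprVn mulrC ltr_pdivrMr ?exprn_gt0// mul1r.
  apply: lt_trans (archi_boundP _) _; first by rewrite !mulr_ge0 ?nrm_ge0.
  by rewrite -natrX ltr_nat; exact: ltn_expl.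
by apply/eqP; rewrite expf_neq0// invr_eq0 nat_eq0.
Qed.

(** The ideals generated by the powers of 2 decrease strictly, because 1/2 is not integral; so the
    norm grows at each step. *)
Lemma N_unbounded n : exists2 J : ideal O, J != ideal0 O & (n < N J)%N.
Proof.
exists (principal (2 ^+ n)); first by apply: ideal_neq0 (mem_principal _) _; rewrite -int_val_eq0 rmorphXn rmorph_nat expf_neq0// nat_eq0.
elim: n => [|n IHn]; first by rewrite N_gt0//; apply: ideal_neq0 (mem_principal _) _; rewrite expr0 oner_eq0.
apply: leq_ltn_trans IHn _; apply: N_lt.
- by move=> _ /principalP[c ->]; apply/principalP; exists (c * 2); rewrite exprS mulrA.
- by apply: ideal_neq0 (mem_principal _) _; rewrite -int_val_eq0 rmorphXn rmorph_nat expf_neq0// nat_eq0.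
apply/negP => /eqP E; have : 2 ^+ n \in principal (2 ^+ n.+1 : O) by rewrite E mem_principal.
move=> /principalP[c]; rewrite exprS mulrA => cE.
have c2 : 1 = c * 2.
  apply: (@integers_mulI (2 ^+ n)); last by rewrite mulr1 mulrC.
  by rewrite -int_val_eq0 rmorphXn rmorph_nat expf_neq0// nat_eq0.
have /negP := half_not_integral; apply; apply/mem_integral; exists c.
have two0 : (2 : K) != 0 by rewrite nat_eq0.
apply: (mulIf two0); rewrite mulVf// -[2 in LHS](rmorph_nat (@int_val K)) -int_valM -c2.
exact: rmorph1.
Qed.

(** Adjoining to [J] an element that is not invertible modulo [J] keeps the ideal proper and lowers
    the norm, so this stops at a maximal ideal. *)
Lemma proper_in_maximal J : J != ideal0 O -> J != ideal1 O ->
  exists2 p, maximal_ideal p & forall x, x \in J -> x \in p.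
Proof.
have [n] := ubnP (N J); elim: n J => // n IHn J JN J0 J1.
have [mJ|] := pselect (forall b, b \notin J -> exists c, 1 - c * b \in J); first by exists J.
move=> /existsNP[b /not_implyP[bJ h]].
pose I := ideal_add J (principal b).
have JI x : x \in J -> x \in I by exact: ideal_addl.
have bI : b \in I by apply: ideal_addr; exact: mem_principal.
have [|||p mp Ip] := IHn I; last by exists p => // x /JI/Ip.
- rewrite ltnS in JN; apply: leq_trans JN; apply: N_lt => //; apply: contraNneq bJ => ->//.
- by have [x Jx x0] := ideal0P J0; apply: ideal_neq0 x0; exact: JI.
apply/negP => /eqP I1; apply: h; have : 1 \in I by rewrite I1.
move=> /ideal_addP[x [_ [Jx /principalP[c ->] E]]]; exists c.
by rewrite E addrK.
Qed.

(* The ideals containing a non-zero ideal correspond to sets of cosets. *)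
Lemma finite_over a : a != ideal0 O ->
  exists s : seq (ideal O), forall I, (forall x, x \in a -> x \in I) -> I \in s.
Proof.
move=> /finite_ideal/idxP[T [f [_ _ fP]]].
pose img I : {ffun T -> bool} := [ffun t => `[< exists2 x, x \in I & f x = t >]].
pose inv (A : {ffun T -> bool}) : ideal O :=
  xget (ideal0 O) [set I : ideal O | (forall x, x \in a -> x \in I) /\ img I = A].
exists [seq inv A | A : {ffun T -> bool}] => I aI.
have [aI' imgE] : [set J : ideal O | (forall x, x \in a -> x \in J) /\ img J = img I] (inv (img I)).
  by apply: xgetPex; exists I.
apply/mapP; exists (img I); first by rewrite mem_enum.
have sub J J' : (forall x, x \in a -> x \in J') -> img J = img J' -> forall x, x \in J -> x \in J'.
  move=> aJ' /ffunP/(_ _) E x Jx; have := E (f x); rewrite !ffunE => /esym E'.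
  have /asboolP[y Jy fyx] : `[< exists2 y, y \in J' & f y = f x >].
    by rewrite E'; apply/asboolP; exists x.
  rewrite -(subrK y x); apply: idealD => //; apply: aJ'.
  by have /fP := esym fyx; apply.
by apply: ideal_ext => x; split; apply: sub.
Qed.

End FiniteQuotients.

(** * Rings of integers are Dedekind *)

Section Dedekind.
Variable K : fieldExtType rat.
Notation O := (ring_of_integers K).
Implicit Types (I J B C a p : ideal O) (x z c : O) (y : K).

(** A non-zero element [m] of [J], together with one element of [J] from each class modulo [m] that
    [J] meets, generates [J]; there are finitely many classes. *)
Lemma ideal_generators J : J != ideal0 O ->
  exists (n : nat) (g : 'I_n -> O), [/\ exists i, g i != 0, forall i, g i \in J &
    forall x, x \in J -> exists c : 'I_n -> O, x = \sum_i c i * g i].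
Proof.
move=> /ideal0P[m Jm m0]; have /idxP[T [f [_ fs fP]]] := finite_principal m0.
pose s (t : T) : O := xget 0 [set x | x \in J /\ f x = t].
have sJ t : s t \in J by rewrite /s; case: xgetP => [x -> []//|_]; exact: ideal_0.
have sE x : x \in J -> f (s (f x)) = f x.
  move=> Jx; suff [] : [set z | z \in J /\ f z = f x] (s (f x)) by [].
  by apply: xgetPex; exists x.
exists #|T|.+1, (fun i => if unlift ord0 i is Some j then s (enum_val j) else m); split.
- by exists ord0; rewrite unlift_none.
- by move=> i; case: unlift => [j|].
move=> x Jx; have /principalP[c cE] : x - s (f x) \in principal m.
  by apply/fP => //; rewrite sE.
exists (fun i => if unlift ord0 i is Some j then (enum_val j == f x)%:R else c).
rewrite big_ord_recl unlift_none -cE; under eq_bigr do rewrite liftK.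
rewrite (bigD1 (enum_rank (f x)))//= enum_rankK eqxx mul1r big1 ?addr0 ?subrK// => j ne.
by case: eqP => [E|_]; [rewrite -E enum_valK eqxx in ne | rewrite mul0r].
Qed.

(** The determinant trick for a finitely generated ideal stable under [y]. It is through this lemma
    that O is used as an integrally closed ring. *)
Lemma stable_integral J y : J != ideal0 O ->
  (forall x, x \in J -> exists2 z : O, z \in J & int_val z = y * int_val x) ->
  y \in @is_integral K.
Proof.
move=> /ideal_generators[n [g [[i0 gi0] gJ gE]]] yJ.
have /choice[c cE] : forall i, exists c : 'I_n -> O, y * int_val (g i) = \sum_j int_val (c j) * int_val (g j).
  move=> i; have [z /gE[c ->] <-] := yJ _ (gJ i); exists c.
  by rewrite int_val_sum; apply: eq_bigr => j _; rewrite int_valM.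
apply: (@integral_eigen _ n (\matrix_(i, j) c i j) (fun i => int_val (g i))).
  by exists i0; rewrite int_val_eq0.
by move=> i; rewrite cE; apply: eq_bigr => j _; rewrite mxE.
Qed.

(** The maximal ideal [p] is an associated prime of [O/a]. By induction on the norm, it suffices to
    find a zero divisor [s] modulo [a] whose colon ideal [a : s] stays inside [p]: that ideal is
    larger than [a], and a solution [x] for it gives the solution [x * s] for [a]. *)
Lemma colon_maximal a p : maximal_ideal p -> a != ideal0 O -> (forall x, x \in a -> x \in p) ->
  exists2 x : O, x \notin a & forall z, z \in p -> z * x \in a.
Proof.
move=> mp; have [n] := ubnP (N a); elim: n a => // n IHn a aN a0 ap.
have p1 : (1 : O) \notin p by case: mp => /ideal1N.
have step (s : O) : (exists2 b : O, b \notin a & b * s \in a) ->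
    (forall t : O, t * s \in a -> t \in p) ->
    exists2 x : O, x \notin a & forall z, z \in p -> z * x \in a.
  move=> [b ba bs] tp; pose a' := colon a [set s].
  have a'P t : t \in a' <-> t * s \in a by rewrite colonP; split=> [/(_ s erefl)//|h _ ->].
  have aa' t : t \in a -> t \in a' by exact: colon_sub.
  have ne : a != a' by apply: contraNneq ba => ->; exact/a'P.
  have [|||x xa' px] := IHn a'.
  - by rewrite ltnS in aN; apply: leq_trans aN; exact: N_lt.
  - by have [x ax x0] := ideal0P a0; apply: ideal_neq0 x0; exact: aa'.
  - by move=> t /a'P/tp.
  exists (x * s); first by apply: contraNN xa' => /a'P.
  by move=> z /px/a'P; rewrite mulrA.
have [E|ne] := eqVneq a p; first by exists 1; rewrite E// => z; rewrite mulr1.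
have [b bp ba] : exists2 b : O, b \in p & b \notin a.
  apply: contrapT => h; case/eqP: ne; apply: ideal_ext => x; split=> [/ap//|px].
  by apply: contrapT => ax; apply: h; exists x => //; exact/negP.
have stepN (s t : O) : s \notin p -> t \notin a -> s * t \in a ->
    exists2 x : O, x \notin a & forall z, z \in p -> z * x \in a.
  move=> sp ta st; apply: (step s); first by exists t => //; rewrite mulrC.
  by move=> u /ap; rewrite mulrC => /(maximal_prime mp); exact.
have /idxP[T [f [_ _ fP]]] := finite_ideal a0.
(* As [O/a] is finite, two powers of [b] agree modulo [a], so [1 - b ^ (j - i)], which is outside
   [p], multiplies [b ^ i] into [a]. *)
have [i [j [ij bij]]] : exists i j : nat, (i < j)%N /\ (b ^+ i - b ^+ j : O) \in a.
  have /injectivePn[i [j ij fij]] : ~~ injectiveb (fun i : 'I_(#|T|.+1) => f (b ^+ i)).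
    apply/negP => /injectiveP/leq_card; rewrite card_ord; by rewrite ltnn.
  move/fP: fij => /(_ I I) bij.
  have [lt|gt|/val_inj E] := ltngtP i j; last by rewrite E eqxx in ij.
    by exists i, j.
  by exists j, i; split=> //; rewrite -opprB; exact: idealN.
have bij' : (b ^+ (j - i) : O) \in p.
  by move: ij; rewrite -subn_gt0; case: (j - i)%N => // k _; rewrite exprS; exact: idealZr.
have sp : (1 - b ^+ (j - i) : O) \notin p.
  by apply: contraNN p1 => sp; rewrite -(subrK (b ^+ (j - i)) 1); exact: idealD.
have sb : (1 - b ^+ (j - i)) * b ^+ i \in a.
  by rewrite mulrBl mul1r -exprD subnK// ltnW.
have [bia|/(stepN _ _ sp)] := boolP (b ^+ i \in a); last by apply.
have exk : exists k, b ^+ k \in a by exists i.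
have [[|[|k]] kE kmin] := ex_minnP exk.
- by case/negP: p1; exact: ap.
- by rewrite expr1 (negbTE ba) in kE.
have bka : b ^+ k.+1 \notin a by apply/negP => /kmin; rewrite ltnn.
(* Now [b] is nilpotent modulo [a], hence a zero divisor. Either [a : b] lies in [p], or some [t]
   outside [p] has [t * b] in [a] and serves as the zero divisor itself. *)
have [h|] := pselect (forall t : O, t * b \in a -> t \in p).
  by apply: (step b) => //; exists (b ^+ k.+1) => //; rewrite -exprSr.
move=> /existsNP[t /not_implyP[tb /negP tp]].
exact: (stepN t b).
Qed.

(** The [v i] are elements of the inverse fractional ideal; the equation says that 1 lies in the
    product of [J] with its inverse. *)
Definition invertible_ideal J := exists (T : finType) (u : T -> O) (v : T -> K),
  [/\ forall i, u i \in J, forall i x, x \in J -> v i * int_val x \in @is_integral K &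
      \sum_i v i * int_val (u i) = 1].

(** Take [x] with [p x] inside [(a)] but [x] outside it, and [y = x / a]. Then [y p] lies in O. It
    does not lie in [p], for [y] would be integral and [x] a multiple of [a]. So some [c = y u] with
    [u] in [p] is invertible modulo [p]: writing [1 = d y u + (1 - d c)] gives the two terms of the
    equation. *)
Lemma maximal_invertible p : maximal_ideal p -> p != ideal0 O -> invertible_ideal p.
Proof.
move=> mp p0; have [a pa a0] := ideal0P p0.
have sub x : x \in principal a -> x \in p by move=> /principalP[c ->]; exact: idealZl.
have [x xa px] := colon_maximal mp (ideal_neq0 (mem_principal a) a0) sub.
have a0' : int_val a != 0 by rewrite int_val_eq0.
pose y := int_val x / int_val a.
have yp z : z \in p -> exists c, int_val c = y * int_val z.
  move=> /px/principalP[c cE]; exists c; apply: (mulIf a0').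
  by rewrite -int_valM -cE int_valM mulrAC divfK// mulrC.
have [h|] := pselect (forall z, z \in p -> exists2 c : O, c \in p & int_val c = y * int_val z).
  have /mem_integral[c cE] := stable_integral p0 h.
  case/negP: xa; apply/principalP; exists c; apply: int_val_inj.
  by rewrite int_valM cE divfK.
move=> /existsNP[u /not_implyP[pu h]].
have [c cE] := yp _ pu.
have cp : c \notin p by apply/negP => cp; apply: h; exists c.
have [d pd] := mp.2 _ cp.
exists bool, (fun b => if b then u else 1 - d * c), (fun b => if b then y * int_val d else 1); split.
- by case.
- case=> z pz; last by rewrite mul1r; exact: int_valP.
  by have [e eE] := yp _ pz; rewrite mulrAC -eE -int_valM; exact: int_valP.
by rewrite big_bool /= ?int_valB ?int_val1 ?int_valM cE; ring.
Qed.

Lemma invertible_comb J (T : finType) (u : T -> O) (v : T -> K) z :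
  (forall i x, x \in J -> v i * int_val x \in @is_integral K) ->
  \sum_i v i * int_val (u i) = 1 -> z \in J ->
  z = \sum_i to_int (v i * int_val z) * u i.
Proof.
move=> vJ uv Jz; apply: int_val_inj; rewrite int_val_sum -[LHS]mulr1 -uv mulr_sumr.
by apply: eq_bigr => i _; rewrite int_valM to_intK ?vJ// mulrCA mulrA.
Qed.

(** For a maximal [p] containing [J], the ideal [J' = J : p] is invertible by induction, and
    products of inverses of [p] and [J'] invert [J]. Progress holds because [J' = J] would make the
    inverse of [p] map [J] to itself, hence consist of integers, and 1 would lie in [p]. *)
Lemma ideal_invertible J : J != ideal0 O -> invertible_ideal J.
Proof.
have [n] := ubnP (N J); elim: n J => // n IHn J JN J0.
have [->|J1] := eqVneq J (ideal1 O).
  exists unit, (fun=> 1), (fun=> 1); split=> // [_ x _|]; first by rewrite mul1r; exact: int_valP.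
  by rewrite (big_pred1 tt) ?mul1r ?int_val1//; case.
have [p mp Jp] := proper_in_maximal J0 J1.
have [x0 Jx0 x00] := ideal0P J0.
have p0 : p != ideal0 O by apply: ideal_neq0 x00; exact: Jp.
have [T [u [v [up vp uv]]]] := maximal_invertible mp p0.
pose J' := colon J (iset p).
have JJ' x : x \in J -> x \in J' by exact: colon_sub.
have vJ i x : x \in J -> exists2 z : O, z \in J' & int_val z = v i * int_val x.
  move=> Jx; exists (to_int (v i * int_val x)); last by rewrite to_intK// vp//; exact: Jp.
  apply/colonP => z pz; suff -> : to_int (v i * int_val x) * z = to_int (v i * int_val z) * x.
    exact: idealZl.
  by apply: int_val_inj; rewrite !int_valM (to_intK (vp _ _ (Jp _ Jx))) (to_intK (vp _ _ pz)) mulrAC.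
have [E|ne] := eqVneq J J'.
  suff: 1 \in p by rewrite (negbTE (ideal1N mp.1)).
  have vint i : v i \in @is_integral K.
    by apply: (stable_integral J0) => x /(vJ i); rewrite -E.
  suff -> : 1 = \sum_i to_int (v i) * u i :> O by apply: ideal_sum => i _; exact: idealZl.
  apply: int_val_inj; rewrite rmorph1 -uv int_val_sum.
  by apply: eq_bigr => i _; rewrite int_valM to_intK.
have [||T' [u' [v' [up' vp' uv']]]] := IHn J'.
- by rewrite ltnS in JN; apply: leq_trans JN; exact: N_lt.
- by apply: ideal_neq0 x00; exact: JJ'.
exists (T * T')%type, (fun ij => u ij.1 * u' ij.2), (fun ij => v ij.1 * v' ij.2); split.
- by move=> [i j] /=; have /colonP/(_ _ (up i)) := up' j; rewrite mulrC.
- move=> [i j] x Jx /=; have [z J'z zE] := vJ i x Jx.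
  by rewrite mulrAC -zE mulrC; exact: vp'.
transitivity ((\sum_i v i * int_val (u i)) * \sum_j v' j * int_val (u' j)); last first.
  by rewrite uv uv' mulr1.
rewrite big_distrlr /= pair_bigA; apply: eq_bigr => -[i j] _ /=.
by rewrite ?int_valM mulrACA.
Qed.

(** Double annihilators in [O/a]. If the [v i] invert [J], then [v i * a] lies in [a : J], so
    [v i * z] maps [a] into itself and is integral; expanding [z] along [u] and [v] puts it in
    [J]. *)
Lemma colon_colon a J z : a != ideal0 O -> (forall x, x \in a -> x \in J) ->
  (forall x, x \in colon a (iset J) -> x * z \in a) -> z \in J.
Proof.
move=> a0 aJ zP.
have [x0 ax0 x00] := ideal0P a0.
have J0 : J != ideal0 O by apply: ideal_neq0 x00; exact: aJ.
have [T [u [v [uJ vJ uv]]]] := ideal_invertible J0.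
have vz i : v i * int_val z \in @is_integral K.
  apply: (stable_integral a0) => x ax.
  exists (to_int (v i * int_val x) * z); last first.
    by rewrite int_valM (to_intK (vJ _ _ (aJ _ ax))) mulrAC.
  apply: zP; apply/colonP => w Jw; have {}Jw : w \in J := Jw.
  suff -> : to_int (v i * int_val x) * w = to_int (v i * int_val w) * x by exact: idealZl.
  by apply: int_val_inj; rewrite !int_valM (to_intK (vJ _ _ (aJ _ ax))) (to_intK (vJ _ _ Jw)) mulrAC.
suff -> : z = \sum_i to_int (v i * int_val z) * u i by apply: ideal_sum => i _; exact: idealZl.
apply: int_val_inj; rewrite int_val_sum -[LHS]mulr1 -uv mulr_sumr.
by apply: eq_bigr => i _; rewrite int_valM (to_intK (vz i)) mulrCA mulrA.
Qed.

(** The product ideal is taken as the intersection of all ideals containing the products, so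
    inclusions are proved on products alone. *)
Fact ideal_mul_closed J B : ideal_closed (fun z : O =>
  forall C : ideal O, (forall u b : O, u \in J -> b \in B -> u * b \in C) -> z \in C).
Proof.
split=> [C _|c x z Px Pz C h]; first exact: ideal_0.
by apply: idealD; [apply/idealZl/Px | exact: Pz].
Qed.
Definition ideal_mul J B : ideal O := mk_ideal (ideal_mul_closed J B).

Lemma mem_ideal_mul J B x z : x \in J -> z \in B -> x * z \in ideal_mul J B.
Proof. by move=> Jx Bz; apply/mk_idealP => C; exact. Qed.

Lemma ideal_mul_le J B C : (forall u b : O, u \in J -> b \in B -> u * b \in C) ->
  forall x, x \in ideal_mul J B -> x \in C.
Proof. by move=> h x /mk_idealP; exact. Qed.

Lemma ideal_mul_sub J B x : x \in ideal_mul J B -> x \in B.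
Proof. by apply: ideal_mul_le => u b _; exact: idealZl. Qed.

Lemma ideal_mul_neq0 J B : J != ideal0 O -> B != ideal0 O -> ideal_mul J B != ideal0 O.
Proof.
move=> /ideal0P[x Jx x0] /ideal0P[z Bz z0].
by apply: ideal_neq0 (mem_ideal_mul Jx Bz) _; exact: integers_mul_neq0.
Qed.

Lemma ideal_mulA I J B : ideal_mul I (ideal_mul J B) = ideal_mul (ideal_mul I J) B.
Proof.
apply: ideal_ext => x; split; apply: ideal_mul_le.
  move=> u w Iu JBw.
  suff /colonP/(_ u erefl) : w \in colon (ideal_mul (ideal_mul I J) B) [set u] by rewrite mulrC.
  move: w JBw; apply: ideal_mul_le => s b Js Bb; apply/colonP => _ ->.
  by rewrite mulrC mulrA; do 2?apply: mem_ideal_mul.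
move=> w b IJw Bb; suff /colonP/(_ b erefl) : w \in colon (ideal_mul I (ideal_mul J B)) [set b] by [].
move: w IJw; apply: ideal_mul_le => u s Iu Js; apply/colonP => _ ->.
by rewrite -mulrA; do 2?apply: mem_ideal_mul.
Qed.

Lemma ideal_mul1 B : ideal_mul (ideal1 O) B = B.
Proof.
apply: ideal_ext => x; split=> [|Bx]; first by apply: ideal_mul_le => u b _; exact: idealZl.
by rewrite -[x]mul1r; exact: mem_ideal_mul.
Qed.

Lemma maximal_mul_colon J p : maximal_ideal p -> J != ideal0 O -> (forall x, x \in J -> x \in p) ->
  ideal_mul p (colon J (iset p)) = J.
Proof.
move=> mp J0 Jp; have [x0 Jx0 x00] := ideal0P J0.
have p0 : p != ideal0 O by apply: ideal_neq0 x00; exact: Jp.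
have [T [u [v [up vp uv]]]] := maximal_invertible mp p0.
apply: ideal_ext => x; split.
  by apply: ideal_mul_le => s b ps /colonP/(_ _ ps); rewrite mulrC.
move=> Jx; rewrite (invertible_comb vp uv (Jp _ Jx)); apply: ideal_sum => i _.
rewrite mulrC; apply: mem_ideal_mul => //; apply/colonP => z pz.
suff -> : to_int (v i * int_val x) * z = to_int (v i * int_val z) * x by exact: idealZl.
by apply: int_val_inj; rewrite !int_valM (to_intK (vp _ _ (Jp _ Jx))) (to_intK (vp _ _ pz)) mulrAC.
Qed.

(** [B/pB] is a line over the field [O/p]: any [x] in [B] outside [pB] generates it, and [c] goes to
    [c x]. *)
Lemma idx_mul_maximal p B : maximal_ideal p -> p != ideal0 O -> B != ideal0 O ->
  idx (iset B) (iset (ideal_mul p B)) = N p.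
Proof.
move=> mp p0 B0; have [T [u [v [uB vB uv]]]] := ideal_invertible B0.
have p1 := ideal1N mp.1.
have [x Bx xpB] : exists2 x : O, x \in B & x \notin ideal_mul p B.
  apply: contrapT => h.
  have BpB x : x \in B -> x \in ideal_mul p B.
    by move=> Bx; apply: contrapT => xpB; apply: h; exists x => //; exact/negP.
  case/negP: p1.
  suff -> : 1 = \sum_i to_int (v i * int_val (u i)) :> O.
    apply: ideal_sum => i _; move: (uB i) => /BpB/mk_idealP.
    have cl : ideal_closed (fun z : O => exists2 c : O, c \in p & int_val c = v i * int_val z).
      split=> [|c s t [s' ps' sE] [t' pt' tE]].
        by exists 0; [exact: ideal_0 | rewrite !rmorph0 mulr0].
      exists (c * s' + t'); first by apply: idealD => //; exact: idealZl.
      by rewrite !int_valD !int_valM sE tE; ring.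
    have : u i \in mk_ideal cl.
      move: (uB i) => /BpB; apply: ideal_mul_le => s b ps Bb; apply/mk_idealP.
      exists (s * to_int (v i * int_val b)); first exact: idealZr.
      by rewrite !int_valM to_intK ?vB//; ring.
    by move=> /mk_idealP[c pc <-]; rewrite /to_int valKd.
  apply: int_val_inj; rewrite rmorph1 -uv int_val_sum.
  by apply: eq_bigr => i _; rewrite to_intK// vB.
have x0 : x != 0 by apply: contraNneq xpB => ->; exact: ideal_0.
pose C := ideal_add (principal x) (ideal_mul p B).
(* That is, [B] is contained in [x O + p B]. If not, the colon ideal lies in [p]. As [v i * x] maps
   [B] into the multiples of [x], it lies in [p], and expanding [x] along [u] puts [x] in [p B], a
   contradiction. *)
have CB : 1 \in colon C (iset B).
  apply: contrapT => /negP C1.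
  have sub z : z \in colon C (iset B) -> z \in p.
    move=> Cz; apply: contraNT C1 => zp; have [c pc] := mp.2 _ zp.
    rewrite -(subrK (c * z) 1); apply: idealD; last exact: idealZl.
    by apply/colonP => b Bb; apply: ideal_addr; exact: mem_ideal_mul.
  case/negP: xpB; rewrite (invertible_comb vB uv Bx); apply: ideal_sum => i _.
  apply: mem_ideal_mul => //; apply: sub; apply/colonP => b Bb; have {}Bb : b \in B := Bb.
  apply: ideal_addl; apply/principalP; exists (to_int (v i * int_val b)).
  by apply: int_val_inj; rewrite !int_valM !to_intK ?vB//; ring.
have px c : c * x \in ideal_mul p B <-> c \in p.
  split=> [cx|pc]; last exact: mem_ideal_mul.
  apply: contraTT (cx) => cp; apply: contraNN xpB => _; have [d pd] := mp.2 _ cp.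
  rewrite -[x]mul1r -(subrK (d * c) 1) mulrDl; apply: idealD; first exact: mem_ideal_mul.
  by rewrite -mulrA; exact: idealZl.
have [] := @index_transfer _ _ setT (iset p) (iset B) (iset (ideal_mul p B)) (fun c => c * x) I (ideal_0 B) (subgroup_iset _) (subgroup_iset _) (or_introl (finite_ideal p0)).
- by move=> c _; exact: idealZl.
- move=> b Bb; have /colonP/(_ _ Bb) := CB; rewrite mul1r.
  move=> /ideal_addP[_ [w [/principalP[c ->] pw ->]]].
  by exists c => //; rewrite /iset addrAC subrr add0r.
- by move=> c d _ _; rewrite -mulrBl; apply: iff_sym; exact: px.
by move=> _ _ <-.
Qed.

(** Induction on the norm of [J], splitting off a maximal factor [p] with [J = p (J : p)]; each
    factor contributes the same index inside [B] as inside O. *)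
Lemma idx_ideal_mul J B : J != ideal0 O -> B != ideal0 O ->
  idx (iset B) (iset (ideal_mul J B)) = N J.
Proof.
have [n] := ubnP (N J); elim: n J => // n IHn J JN J0 B0.
have [->|J1] := eqVneq J (ideal1 O).
  rewrite ideal_mul1 N_ideal1; apply: is_indexE; apply: index_refl => //; exact: ideal_0.
have [p mp Jp] := proper_in_maximal J0 J1.
have [x0 Jx0 x00] := ideal0P J0.
have p0 : p != ideal0 O by apply: ideal_neq0 x00; exact: Jp.
pose J' := colon J (iset p).
have JE : J = ideal_mul p J' by rewrite maximal_mul_colon.
have JJ' x : x \in J -> x \in J' by exact: colon_sub.
have J'0 : J' != ideal0 O by apply: ideal_neq0 x00; exact: JJ'.
have NJ : N J = (N J' * N p)%N by rewrite (N_mul JJ' J0) [in iset J]JE idx_mul_maximal.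
have J'B0 := ideal_mul_neq0 J'0 B0.
have NJ' : (N J' < N J)%N.
  rewrite NJ -[ltnLHS]muln1 ltn_pmul2l ?N_gt0// N_gt1//; exact: mp.1.
have sJB : iset (ideal_mul J B) `<=` iset (ideal_mul J' B).
  by rewrite JE -ideal_mulA => x; exact: ideal_mul_sub.
have JB0 := ideal_mul_neq0 J0 B0.
have sJ'B : iset (ideal_mul J' B) `<=` iset B by move=> x; exact: ideal_mul_sub.
have [_ ->] := idx_mul (subgroup_iset B) (subgroup_iset (ideal_mul J' B)) (subgroup_iset (ideal_mul J B)) sJ'B sJB (finite_sub sJ'B J'B0) (finite_sub sJB JB0).
rewrite IHn//; last by rewrite ltnS in JN; exact: leq_trans NJ' JN.
by rewrite {1}JE -ideal_mulA idx_mul_maximal.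
Qed.

End Dedekind.

(** * Structure of finitely generated modules *)

Section LinearIso.
Variable A : comNzRingType.
Implicit Types M N P Q : lmodType A.

Definition mk_linear M N (f : M -> N) (lf : linear f) : {linear M -> N} :=
  HB.pack f (GRing.isLinear.Build A M N *:%R f lf).

Lemma inj_surj_bij (T U : Type) (f : T -> U) :
  injective f -> (forall y, exists x, f x = y) -> bijective f.
Proof.
move=> fI /choice[g gK]; exists g => // x; exact: fI.
Qed.

Lemma isomorphicI M N (f : M -> N) : linear f -> injective f ->
  (forall y, exists x, f x = y) -> lmod_isomorphic M N.
Proof. by move=> lf fI fS; exists (mk_linear lf); exact: inj_surj_bij. Qed.

Lemma isomorphic_refl M : lmod_isomorphic M M.
Proof. by apply: (@isomorphicI M M id) => // y; exists y. Qed.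

Lemma isomorphic_sym M N : lmod_isomorphic M N -> lmod_isomorphic N M.
Proof.
move=> [f [g fK gK]]; apply: (@isomorphicI N M g); last by move=> x; exists (f x).
  by move=> c x y; apply: (can_inj fK); rewrite linearP !gK.
exact: can_inj gK.
Qed.

Lemma isomorphic_trans N M P :
  lmod_isomorphic M N -> lmod_isomorphic N P -> lmod_isomorphic M P.
Proof.
move=> [f bf] [g bg]; apply: (@isomorphicI M P (g \o f)).
- by move=> c x y /=; rewrite !linearP.
- by apply: inj_comp; exact: bij_inj.
move=> z; have [f' _ fK] := bf; have [g' _ gK] := bg.
by exists (f' (g' z)); rewrite /= fK gK.
Qed.

Lemma isomorphic_prod M N P Q : lmod_isomorphic M N -> lmod_isomorphic P Q ->
  lmod_isomorphic (M * P)%type (N * Q)%type.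
Proof.
move=> [f bf] [g bg]; apply: (@isomorphicI (M * P)%type (N * Q)%type (fun x => (f x.1, g x.2))).
- by move=> c x y /=; rewrite !linearP.
- by move=> [x y] [x' y'] [/(bij_inj bf) -> /(bij_inj bg) ->].
move=> [x y]; have [f' _ fK] := bf; have [g' _ gK] := bg.
by exists (f' x, g' y); rewrite /= fK gK.
Qed.

Lemma isomorphic_prodC M N : lmod_isomorphic (M * N)%type (N * M)%type.
Proof.
apply: (@isomorphicI (M * N)%type (N * M)%type (fun x => (x.2, x.1))) => //.
  by move=> [x y] [x' y'] [-> ->].
by move=> [x y]; exists (y, x).
Qed.

Lemma isomorphic_prodA M N P : lmod_isomorphic (M * (N * P))%type ((M * N) * P)%type.
Proof.
apply: (@isomorphicI (M * (N * P))%type ((M * N) * P)%type (fun x => ((x.1, x.2.1), x.2.2))) => //.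
  by move=> [x [y z]] [x' [y' z']] [-> -> ->].
by move=> [[x y] z]; exists (x, (y, z)).
Qed.

Lemma isomorphic_prod0 M : lmod_isomorphic M (M * 'rV[A]_0)%type.
Proof.
apply: (@isomorphicI M (M * 'rV[A]_0)%type (fun x => (x, 0))) => //.
- by move=> c x y; rewrite [RHS]surjective_pairing /= scaler0 addr0.
- by move=> x y [].
by move=> [x y]; exists x; rewrite [y]thinmx0.
Qed.

Lemma direct_sum_cat (s t : seq (lmodType A)) :
  lmod_isomorphic (direct_sum (s ++ t)) (direct_sum s * direct_sum t)%type.
Proof.
elim: s => [|M s IHs] /=.
  exact: isomorphic_trans (isomorphic_prod0 _) (isomorphic_prodC _ _).
apply: isomorphic_trans (isomorphic_prodA _ _ _).
exact: isomorphic_prod (isomorphic_refl _) IHs.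
Qed.

Definition finitely_generated M := exists (X : finType) (e : X -> M),
  forall x, exists c : X -> A, x = \sum_i c i *: e i.

Lemma finitely_generated_image M N (f : {linear M -> N}) :
  (forall y, exists x, f x = y) -> finitely_generated M -> finitely_generated N.
Proof.
move=> fS [X [e eP]]; exists X, (f \o e) => y.
have [x <-] := fS y; have [c ->] := eP x; exists c.
by rewrite linear_sum; apply: eq_bigr => i _; rewrite linearZ.
Qed.

End LinearIso.

Section PiQuotient.
Variables (A : comNzRingType) (V : lmodType A) (N : submodule V).

Definition pi_quot (x : V) : quotient_module N := \pi_(Quotient.quot N)%qT x.

Lemma pi_quot_linear : linear pi_quot.
Proof.
move=> c x y; rewrite /pi_quot raddfD; congr (_ + _).
exact/esym/pi_quotient_scale.
Qed.

Lemma pi_quot_eq x y : pi_quot x = pi_quot y <-> x - y \in N.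
Proof. by rewrite Quotient.idealrBE; split=> [/eqP|/eqP]. Qed.

Lemma pi_quot_surj q : exists x, pi_quot x = q.
Proof. by exists (repr (q : Quotient.quot N)); exact: reprK. Qed.

End PiQuotient.

(** * Torsion modules as sums of cyclic ones *)

Section TorsionModules.
Variable K : fieldExtType rat.
Notation O := (ring_of_integers K).
Implicit Types (I J a p : ideal O) (c z : O).

Fact ann_closed (T : lmodType O) : ideal_closed (fun c : O => forall x : T, c *: x = 0).
Proof.
by split=> [x|c u v hu hv x]; rewrite ?scale0r// scalerDl -scalerA hu hv scaler0 addr0.
Qed.
Definition ann (T : lmodType O) : ideal O := mk_ideal (ann_closed T).

Lemma annP (T : lmodType O) c : c \in ann T <-> forall x : T, c *: x = 0.
Proof. exact: mk_idealP. Qed.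

Fact ann1_closed (T : lmodType O) (x : T) : ideal_closed (fun c : O => c *: x = 0).
Proof.
by split=> [|c u v hu hv]; rewrite ?scale0r// scalerDl -scalerA hu hv scaler0 addr0.
Qed.
Definition ann1 (T : lmodType O) (x : T) : ideal O := mk_ideal (ann1_closed x).

Lemma ann1P (T : lmodType O) (x : T) c : c \in ann1 x <-> c *: x = 0.
Proof. exact: mk_idealP. Qed.

Lemma maximal_sub_eq p q : maximal_ideal p -> maximal_ideal q ->
  (forall x, x \in q -> x \in p) -> p = q.
Proof.
move=> mp mq qp; apply: ideal_ext => x; split=> [px|/qp//].
apply: contrapT => /negP/mq.2[c /qp pc]; case/negP: (ideal1N mp.1).
by rewrite -(subrK (c * x) 1); apply: idealD => //; exact: idealZl.
Qed.

(** Distinct maximal ideals do not contain one another, and a product of elements outside the prime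
    ideal [p] is outside [p]. *)
Lemma avoid_maximal (ps : seq (ideal O)) p : maximal_ideal p ->
  (forall q, q \in ps -> maximal_ideal q) ->
  exists2 e : O, e \notin p & forall q, q \in ps -> q != p -> e \in q.
Proof.
move=> mp; elim: ps => [|q ps IHps] mps; first by exists 1 => //; exact: ideal1N mp.1.
have [e ep eq] := IHps (fun q' hq' => mps q' (mem_behead (s := q :: ps) hq')).
have mq := mps q (mem_head q ps).
have [E|ne] := eqVneq q p.
  exists e => // q'; rewrite in_cons => /orP[/eqP->|]; last exact: eq.
  by rewrite E eqxx.
have [w qw wp] : exists2 w : O, w \in q & w \notin p.
  apply: contrapT => h; case/eqP: ne; apply/esym/maximal_sub_eq => // x qx.
  by apply: contrapT => /negP px; apply: h; exists x.
exists (w * e); first by apply: contraNN ep => /(maximal_prime mp); exact.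
move=> q'; rewrite in_cons => /orP[/eqP-> _|/eq h /h]; first exact: idealZr.
exact: idealZl.
Qed.

(** Such an [x0] spans a copy of [O/a]. For every maximal [p] above [a], pick [z] outside [a] with
    [p z] inside [a], an element [t p] not killed by [z], and a coefficient [e p] that is invertible
    modulo [p] but lies in the other maximal ideals; [x0] is the sum of the [e p *: t p]. *)
Lemma exists_ann1 (T : lmodType O) : ann T != ideal0 O ->
  exists x0 : T, forall c, c *: x0 = 0 -> c \in ann T.
Proof.
set a := ann T => a0; have [s sP] := finite_over a0.
have [r ar r0] := ideal0P a0.
pose ps := undup [seq p <- s | `[< maximal_ideal p /\ forall x, x \in a -> x \in p >]].
have psP p : p \in ps <-> maximal_ideal p /\ forall x, x \in a -> x \in p.
  rewrite mem_undup mem_filter; split=> [/andP[/asboolP]//|h].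
  by apply/andP; split; [exact/asboolP | apply: sP; case: h].
have /choice[e eP] p : exists e : O, p \in ps ->
    e \notin p /\ forall q, q \in ps -> q != p -> e \in q.
  have [pps|] := boolP (p \in ps); last by exists 0.
  have [mp _] := (psP p).1 pps.
  by have [e ep eq] := avoid_maximal mp (fun q hq => ((psP q).1 hq).1); exists e.
have /choice[t tP] p : exists t : T, p \in ps ->
    exists2 z : O, (forall x : O, x \in p -> (x * z : O) \in a) & z *: t != 0.
  have [pps|] := boolP (p \in ps); last by exists 0.
  have [mp ap] := (psP p).1 pps.
  have [z za zp] := colon_maximal mp a0 ap.
  have [t zt] : exists t : T, z *: t != 0.
    apply: contrapT => h; case/negP: za; apply/annP => t.
    by apply: contrapT => /eqP zt; apply: h; exists t.
  by exists t => _; exists z.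
exists (\sum_(p <- ps) e p *: t p) => c; set x0 := \sum_(_ <- _) _ => cx0.
apply: contrapT => ca.
(* If [x0] had a larger annihilator, [C0] would be proper, hence inside some [p]. By the double
   annihilator property the [z] of that [p] kills [x0]; only the summand at [p] survives
   multiplication by [z], and this forces [z *: t p = 0]. *)
pose C0 := colon a (iset (ann1 x0)).
have aC0 x : x \in a -> x \in C0 by exact: colon_sub.
have C01 : C0 != ideal1 O.
  apply/eqP => C01; apply: ca; have : (1 : O) \in C0 by rewrite C01.
  by move=> /colonP/(_ c); rewrite mul1r; apply; exact/ann1P.
have [p mp C0p] := proper_in_maximal (ideal_neq0 (aC0 _ ar) r0) C01.
have pps : p \in ps by apply/psP; split=> // x /aC0/C0p.
have [z pz /eqP] := tP p pps; apply.
have zx0 : z *: x0 = 0.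
  apply/ann1P; apply: (@colon_colon _ a) => // [x /annP h|x Cx]; first exact/ann1P.
  by apply: pz; exact: C0p.
have [ep eq] := eP p pps.
have kill q : q \in ps -> q != p -> z *: (e q *: t q) = 0.
  move=> qps qp; rewrite scalerA; move: (t q); apply/annP; rewrite mulrC; apply: pz.
  by have [_] := eP q qps; apply => //; rewrite eq_sym.
have zep : z *: (e p *: t p) = 0.
  move: zx0; rewrite scaler_sumr (bigD1_seq p) ?undup_uniq//= big_seq_cond big1 ?addr0//.
  by move=> q /andP[qps qp]; exact: kill.
have [d pd] := mp.2 _ ep.
have /annP/(_ (t p)) := pz _ pd.
by rewrite mulrC mulrBr mulr1 scalerBl mulrCA -scalerA -scalerA zep scaler0 subr0.
Qed.

Section Retraction.
Variable T : lmodType O.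
Notation a := (ann T).
Hypothesis a0 : a != ideal0 O.

(** The graph of a linear map from a submodule of [T] to [O/a], with values given by
    representatives; the last condition makes the value well defined modulo [a]. *)
Definition partial_map (G : T -> O -> Prop) :=
  [/\ G 0 0, forall c x y z w, G x z -> G y w -> G (c *: x + y) (c * z + w) &
      forall z, G 0 z -> z \in a].

Lemma partial_map_sum (G : T -> O -> Prop) (X : finType) (c : X -> O) (x : X -> T) (z : X -> O) :
  partial_map G -> (forall i, G (x i) (z i)) -> G (\sum_i c i *: x i) (\sum_i c i * z i).
Proof.
by move=> [G0 GD _] Gx; elim/big_ind2: _ => // [y w y' w' Gy Gy'|i _];
  [have := GD 1 _ _ _ _ Gy Gy'; rewrite scale1r mul1r | have := GD (c i) _ _ _ _ (Gx i) G0; rewrite !addr0].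
Qed.

(* The ideal [J] of all [c] with [c t] in the domain is invertible, so the map
   [J -> O/a] is multiplication by some [z] in [K]; as [z a <= a], [z] is integral. *)
Lemma partial_map_extend G t : partial_map G ->
  exists G' : T -> O -> Prop, [/\ partial_map G', forall x z, G x z -> G' x z & exists z, G' t z].
Proof.
move=> pG; have [G0 GD Ga] := pG.
have GB x z w : G x z -> G x w -> z - w \in a.
  move=> Gz Gw; apply: Ga; have := GD (-1) _ _ _ _ Gw Gz.
  by rewrite scaleN1r addNr mulN1r addrC.
have Jcl : ideal_closed (fun c : O => exists g, G (c *: t) g).
  split=> [|c x y [g Gg] [h Gh]]; first by exists 0; rewrite scale0r.
  by exists (c * g + h); rewrite scalerDl -scalerA; exact: GD.
pose J := mk_ideal Jcl.
have aJ c : c \in a -> c \in J by move=> /annP ct; apply/mk_idealP; exists 0; rewrite ct.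
have J0 : J != ideal0 O by have [x ax x0] := ideal0P a0; apply: ideal_neq0 x0; exact: aJ.
have [X [u [v [uJ vJ uv]]]] := ideal_invertible J0.
have /choice[gam gamE] : forall i, exists g, G (u i *: t) g by move=> i; have /mk_idealP := uJ i.
pose zK := \sum_i v i * int_val (gam i).
have zE c : c \in J -> int_val c * zK = int_val (\sum_i to_int (v i * int_val c) * gam i).
  move=> Jc; rewrite mulr_sumr int_val_sum; apply: eq_bigr => i _.
  by rewrite int_valM (to_intK (vJ _ _ Jc)); ring.
have Gz c : c \in J -> G (c *: t) (\sum_i to_int (v i * int_val c) * gam i).
  move=> Jc; rewrite {1}(invertible_comb vJ uv Jc) scaler_suml.
  under eq_bigr do rewrite -scalerA.
  exact: partial_map_sum.
have zint : zK \in @is_integral K.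
  apply: (stable_integral a0) => c ac; have Jc := aJ _ ac.
  exists (\sum_i to_int (v i * int_val c) * gam i); last by rewrite -zE// mulrC.
  by apply: Ga; have := Gz c Jc; have /annP -> := ac.
pose z := to_int zK.
have zP c g : G (c *: t) g -> g - c * z \in a.
  move=> Gg; have Jc : c \in J by apply/mk_idealP; exists g.
  have -> : c * z = \sum_i to_int (v i * int_val c) * gam i.
    by apply: int_val_inj; rewrite int_valM to_intK// zE.
  by apply: GB Gg _; exact: Gz.
exists (fun x w => exists c w0 x0, [/\ G x0 w0, x = x0 + c *: t & w = w0 + c * z]); split.
- split=> [|c x y r s [d [w0 [x0 [G1 -> ->]]]] [d' [w1 [x1 [G2 -> ->]]]]|w [c [w0 [x0 [G1 E ->]]]]].
  + by exists 0, 0, 0; rewrite scale0r mul0r !addr0.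
  + exists (c * d + d'), (c * w0 + w1), (c *: x0 + x1); split; first exact: GD.
      by rewrite scalerDr scalerDl scalerA addrACA.
    by ring.
  + have x0E : x0 = (- c) *: t by apply/eqP; rewrite scaleNr -addr_eq0 -E.
    by have := zP (- c) w0; rewrite mulNr opprK; apply; rewrite -x0E.
- by move=> x w Gx; exists 0, w, x; rewrite scale0r mul0r !addr0.
by exists z, 1, 0, 0; rewrite scale1r mul1r !add0r.
Qed.

Lemma partial_map_total G (s : seq T) : partial_map G ->
  exists G' : T -> O -> Prop, [/\ partial_map G', forall x z, G x z -> G' x z &
    forall x, x \in s -> exists z, G' x z].
Proof.
elim: s G => [|t s IHs] G pG; first by exists G.
have [G1 [pG1 sub1 [z0 G1t]]] := partial_map_extend t pG.
have [G2 [pG2 sub2 G2s]] := IHs G1 pG1.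
exists G2; split=> // [x z /sub1/sub2//|x]; rewrite in_cons => /orP[/eqP->|/G2s//].
by exists z0; exact: sub2.
Qed.

(** [O/a] is injective as a module over itself: the isomorphism from the span of [x0] to [O/a]
    extends to all of [T]. *)
Lemma cyclic_retraction (s : seq T) (x0 : T) : (forall x, x \in s) ->
  (forall c, c *: x0 = 0 -> c \in a) ->
  exists r : T -> O, (forall c x y, r (c *: x + y) - (c * r x + r y) \in a) /\
    (forall c, r (c *: x0) - c \in a).
Proof.
move=> sP x0P.
have pG0 : partial_map (fun x z => exists2 c, x = c *: x0 & z - c \in a).
  split=> [|c x y z w [d -> dz] [d' -> dw]|z [c /esym/x0P ca zc]].
  - by exists 0; rewrite ?scale0r// subrr; exact: ideal_0.
  - exists (c * d + d'); first by rewrite scalerDl scalerA.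
    have -> : c * z + w - (c * d + d') = c * (z - d) + (w - d') by ring.
    by apply: idealD => //; exact: idealZl.
  - by rewrite -(subrK c z); exact: idealD.
have [G [[G0 GD Ga] sub Gs]] := partial_map_total s pG0.
have /choice[r rP] : forall x, exists z, G x z by move=> x; apply: Gs.
have GB x z w : G x z -> G x w -> z - w \in a.
  move=> Gz Gw; apply: Ga; have := GD (-1) _ _ _ _ Gw Gz.
  by rewrite scaleN1r addNr mulN1r addrC.
exists r; split=> [c x y|c]; first by apply: GB; [exact: rP | exact: GD].
apply: GB; first exact: rP.
by apply: sub; exists c => //; rewrite subrr; exact: ideal_0.
Qed.

(** The complement is the kernel of the retraction onto the span of [x0]. An element outside it is
    supplied so that an induction on the size of [T] can proceed. *)
Lemma cyclic_summand (s : seq T) : (forall x, x \in s) -> a != ideal1 O ->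
  exists T' : submodule T, (exists x, x \notin T') /\
    lmod_isomorphic T (quotient_module a * submod_type T')%type.
Proof.
move=> sP a1; have [x0 x0P] := exists_ann1 a0.
have [r [rl rx0]] := cyclic_retraction sP x0P.
have kill c : c \in a -> forall x : T, c *: x = 0 by move/annP.
have cl : lin_closed (fun x : T => r x \in a).
  split=> [|c x y rx ry].
    by have := rx0 0; rewrite scale0r subr0.
  rewrite -(subrK (c * r x + r y) (r _)); apply: idealD; first exact: rl.
  by apply: idealD => //; exact: idealZl.
pose T' := mk_submodule cl.
have T'P x : r (x - r x *: x0) \in a.
  have -> : x - r x *: x0 = (- r x) *: x0 + x by rewrite scaleNr addrC.
  rewrite -(subrK (- r x * r x0 + r x) (r _)); apply: idealD; first exact: rl.
  have := rx0 1; rewrite scale1r => h1.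
  have -> : - r x * r x0 + r x = - r x * (r x0 - 1) by ring.
  exact: idealZl.
have T'P' x : x - r x *: x0 \in T' by apply/mk_submoduleP.
exists T'; split.
  exists x0; apply/negP => /mk_submoduleP ar; case/negP: (ideal1N a1).
  by rewrite -(subKr (r x0) 1); apply: idealB => //; have := rx0 1; rewrite scale1r.
apply: (@isomorphicI _ T (quotient_module a * submod_type T')%type
  (fun x => (pi_quot a (r x), SubmodElt (T'P' x)))).
- move=> c x y; congr (_, _).
    rewrite -[RHS]pi_quot_linear; apply/pi_quot_eq; exact: rl.
  apply: val_inj; rewrite /= scalerBr scalerA.
  have -> : r (c *: x + y) *: x0 = (c * r x + r y) *: x0.
    by apply/eqP; rewrite -subr_eq0 -scalerBl kill.
  by rewrite scalerDl opprD addrACA.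
- move=> x y [/pi_quot_eq rxy E].
  have rE : r x *: x0 = r y *: x0 by apply/eqP; rewrite -subr_eq0 -scalerBl kill.
  by move: E; rewrite rE => /addIr.
move=> [q [t t']]; have [z <-] := pi_quot_surj q; have rt := (mk_submoduleP cl t).1 t'.
have rzt : r (z *: x0 + t) - z \in a.
  have h1 := rl z x0 t; have h2 := rx0 1; rewrite scale1r in h2.
  have -> : r (z *: x0 + t) - z = r (z *: x0 + t) - (z * r x0 + r t) + (z * (r x0 - 1) + r t) by ring.
  by apply: idealD => //; apply: idealD => //; exact: idealZl.
exists (z *: x0 + t); congr (_, _); first exact/pi_quot_eq.
apply: val_inj => /=; have -> : r (z *: x0 + t) *: x0 = z *: x0.
  by apply/eqP; rewrite -subr_eq0 -scalerBl kill.
by rewrite addrAC subrr add0r.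
Qed.

End Retraction.

(** Split off [O/ann T] and recurse on the complement. The annihilator only grows, so the ideal
    split off first is the smallest and goes to the end of the chain; the third clause carries this
    through the induction. *)
Lemma torsion_structure (T : lmodType O) (s : seq T) : ann T != ideal0 O ->
  (forall x, x \in s) -> uniq s ->
  exists Is : seq (ideal O),
  [/\ {in Is, forall I : ideal O, I != ideal0 O /\ I != ideal1 O},
      sorted (fun I I' : ideal O => `[< {subset I' <= I} >]) Is,
      {in Is, forall I x, x \in ann T -> x \in I} &
      lmod_isomorphic T (direct_sum [seq (quotient_module J : lmodType O) | J <- Is])].
Proof.
have [n] := ubnP (size s); elim: n T s => // n IHn T s sn a0 sP us.
have [a1|a1] := eqVneq (ann T) (ideal1 O).
  exists [::]; split=> //=.
  have T0 (x : T) : x = 0 by rewrite -[x]scale1r; move: x; apply/annP; rewrite a1.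
  apply: (@isomorphicI _ T 'rV[O]_0 (fun=> 0)) => [c x y|x y _|y].
  - by rewrite scaler0 addr0.
  - by rewrite (T0 x) (T0 y).
  - by exists 0; rewrite [y]thinmx0.
have [T' [[x1 x1T'] iso]] := cyclic_summand a0 sP a1.
pose s' : seq (submod_type T') := pmap insub s.
have annT' c : c \in ann T -> c \in ann (submod_type T').
  by move=> /annP ct; apply/annP => x; apply: val_inj; exact: ct.
have [||||Is [Is01 Iss Isa isoI]] := IHn (submod_type T') s'.
- rewrite ltnS in sn; apply: leq_trans sn; rewrite size_pmap ltn_neqAle count_size andbT -all_count.
  by apply/negP => /allP/(_ x1 (sP x1)); rewrite /= insubN.
- by have [x ax x0] := ideal0P a0; apply: ideal_neq0 x0; exact: annT'.
- by move=> x; rewrite mem_pmap_sub.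
- exact: pmap_sub_uniq.
exists (rcons Is (ann T)); split.
- by move=> I; rewrite mem_rcons in_cons => /orP[/eqP->//|/Is01].
- case: Is Iss Isa {Is01 isoI} => // I Is /= Iss Isa; rewrite rcons_path Iss /=.
  by apply/asboolP => x ax; apply: Isa; [exact: mem_last | exact: annT'].
- by move=> I; rewrite mem_rcons in_cons => /orP[/eqP->//|/Isa h x /annT'/h].
rewrite map_rcons -cats1; apply: isomorphic_trans (isomorphic_sym (direct_sum_cat _ _)).
apply: isomorphic_trans iso _; apply: isomorphic_trans (isomorphic_prodC _ _) _.
exact: isomorphic_prod isoI (isomorphic_prod0 _).
Qed.

End TorsionModules.

(** * Splitting off ideals, and the rank *)

Section Structure.
Variable K : fieldExtType rat.
Notation O := (ring_of_integers K).
Implicit Types (I J : ideal O) (c z : O).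

Lemma integers_neq0 : (1 : O) != 0.
Proof. by rewrite -int_val_eq0 int_val1 oner_neq0. Qed.

Lemma prod_integers_neq0 (X : finType) (c : X -> O) :
  (forall i, c i != 0) -> \prod_i c i != 0.
Proof.
by move=> c0; elim/big_ind: _ => //; [exact: integers_neq0 | exact: integers_mul_neq0].
Qed.

Lemma torsion_finite (T : lmodType O) : finitely_generated T ->
  (forall x : T, exists2 c : O, c != 0 & c *: x = 0) ->
  ann T != ideal0 O /\ exists s : seq T, uniq s /\ forall x, x \in s.
Proof.
move=> [X [e eP]] tors.
have /choice[d dP] : forall i, exists d : O, d != 0 /\ d *: e i = 0.
  by move=> i; have [d] := tors (e i); exists d.
pose c0 := \prod_i d i.
have c00 : c0 != 0 by apply: prod_integers_neq0 => i; case: (dP i).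
have c0e i : c0 *: e i = 0.
  by rewrite /c0 (bigD1 i)//= mulrC -scalerA (dP i).2 scaler0.
have c0a (x : T) : c0 *: x = 0.
  have [c ->] := eP x; rewrite scaler_sumr big1// => i _.
  by rewrite scalerA mulrC -scalerA c0e scaler0.
split; first by apply: (ideal_neq0 (x := c0)) => //; apply/annP.
have /idxP[Q [f [_ fs fP]]] := finite_principal c00.
have /choice[r rP] : forall t, exists x, f x = t by move=> t; have [x _ <-] := fs t; exists x.
exists (undup [seq \sum_i r (g i) *: e i | g : {ffun X -> Q}]); split; first exact: undup_uniq.
move=> x; rewrite mem_undup; have [c ->] := eP x.
apply/mapP; exists [ffun i => f (c i)]; first by rewrite mem_enum.
apply: eq_bigr => i _; rewrite ffunE.
have /principalP[d' E] : c i - r (f (c i)) \in principal c0 by apply/fP => //; rewrite rP.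
by apply/eqP; rewrite -subr_eq0 -scalerBl E -scalerA c0e scaler0.
Qed.

(** The image [J] of [g] is invertible, hence projective: expanding along [u] and [v] gives the
    section [sec]. The surjection onto the kernel is returned so that the kernel is again finitely
    generated. *)
Lemma functional_split (M : lmodType O) (g : M -> O^o) : linear g -> (exists x, g x != 0) ->
  exists (J : ideal O) (N : submodule M) (p : M -> submod_type N),
  [/\ J != ideal0 O, linear p, forall y, exists x, p x = y,
      forall x : submod_type N, g (submod_val x) = 0 &
      lmod_isomorphic M (submod_type N * submod_type J)%type].
Proof.
move=> gl [x0 gx0]; pose gL : {linear M -> O^o} := mk_linear gl.
have gE x : g x = gL x by [].
have Jcl : ideal_closed (fun z : O => exists x, g x = z).
  split=> [|c _ _ [x <-] [y <-]]; first by exists 0; rewrite gE linear0.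
  by exists (c *: x + y); rewrite gl.
pose J := mk_ideal Jcl.
have gJ x : g x \in J by apply/mk_idealP; exists x.
have J0 : J != ideal0 O by exact: ideal_neq0 (gJ x0) gx0.
have [X [u [v [uJ vJ uv]]]] := ideal_invertible J0.
have /choice[m mE] : forall i, exists x, g x = u i by move=> i; have /mk_idealP := uJ i.
pose sec (z : O) := \sum_i to_int (v i * int_val z) *: m i.
have gsec z : z \in J -> g (sec z) = z.
  move=> Jz; rewrite gE linear_sum [RHS](invertible_comb vJ uv Jz).
  by apply: eq_bigr => i _; rewrite linearZ -gE mE.
have secl c x y : x \in J -> y \in J -> sec (c * x + y) = c *: sec x + sec y.
  move=> Jx Jy; rewrite scaler_sumr -big_split; apply: eq_bigr => i _ /=.
  rewrite scalerA -scalerDl; congr (_ *: _); apply: int_val_inj.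
  rewrite !(int_valD, int_valM) !to_intK ?vJ//.
    by ring.
  by rewrite -int_valM -int_valD vJ//; apply: idealD => //; exact: idealZl.
have Ncl : lin_closed (fun x => g x = 0).
  by split=> [|c x y gx gy]; [rewrite gE linear0 | rewrite gl gx gy scaler0 addr0].
pose N := mk_submodule Ncl.
have pN x : x - sec (g x) \in N.
  by apply/mk_submoduleP; rewrite gE linearB /= gsec// subrr.
pose p x : submod_type N := SubmodElt (pN x).
have pl : linear p.
  move=> c x y; apply: val_inj => /=.
  by rewrite gl secl// scalerBr opprD addrACA.
have Ng (x : submod_type N) : g (submod_val x) = 0 by apply/(mk_submoduleP Ncl); exact: valP.
have sec0 : sec 0 = 0.
  by have := secl (-1) 0 0 (ideal_0 J) (ideal_0 J); rewrite mulr0 addr0 scaleN1r addNr.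
exists J, N, p; split=> //.
  by move=> y; exists (submod_val y); apply: val_inj; rewrite /= Ng sec0 subr0.
apply: (@isomorphicI _ M (submod_type N * submod_type J)%type (fun x => (p x, SubmodElt (gJ x)))).
- move=> c x y; congr (_, _); first exact: pl.
  by apply: val_inj; rewrite /= gl.
- by move=> x y [+ E]; rewrite E => /addIr.
move=> [y [z Jz]]; exists (submod_val y + sec z).
have gz : g (submod_val y + sec z) = z by rewrite gE linearD -!gE Ng gsec// add0r.
congr (_, _); apply: val_inj => //=.
by rewrite gz addrK.
Qed.

(** The functionals [f 0], ..., [f (k - 1)] detect everything but torsion. Each non-zero one splits
    off an ideal, and on its kernel one functional fewer is required. *)
Lemma structure_theorem (M : lmodType O) (k : nat) (f : nat -> M -> O^o) :
  finitely_generated M -> (forall i, linear (f i)) ->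
  (forall x, (forall i, (i < k)%N -> f i x = 0) -> exists2 c : O, c != 0 & c *: x = 0) ->
  exists d, has_invariants M d.
Proof.
move=> fgM fl sep; suff [Is [Js [Is01 Iss Js0 iso]]] : exists Is Js : seq (ideal O),
  [/\ {in Is, forall I : ideal O, I != ideal0 O /\ I != ideal1 O},
      sorted (fun I I' : ideal O => `[< {subset I' <= I} >]) Is,
      {in Js, forall J : ideal O, J != ideal0 O} &
      lmod_isomorphic M (direct_sum ([seq (quotient_module J : lmodType O) | J <- Is] ++
                           [seq (submod_type J : lmodType O) | J <- Js]))].
  by exists (Is, size Js); split=> //; exists Js.
elim: k M f fgM fl sep => [|k IHk] M f fgM fl sep.
  have [a0 [s [us sP]]] := torsion_finite fgM (fun x => sep x (fun i => ltac:(by []))).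
  have [Is [Is01 Iss _ iso]] := torsion_structure a0 sP us.
  by exists Is, [::]; split=> //; rewrite cats0.
have [fk0|] := pselect (forall x, f k x = 0).
  by apply: (IHk M f) => // x fx; apply: sep => i; rewrite ltnS leq_eqVlt => /orP[/eqP->//|/fx].
move=> /existsNP[x0 /eqP fx0].
have [J [N [p [J0 pl pS Ng iso]]]] := functional_split (fl k) (ex_intro _ x0 fx0).
have [||| Is [Js [Is01 Iss Js0 isoN]]] := IHk (submod_type N) (fun i x => f i (submod_val x)).
- exact: (@finitely_generated_image _ _ _ (mk_linear pl)).
- by move=> i c x y; rewrite -fl.
- move=> x fx; have [|c c0 cx] := sep (submod_val x).
    by move=> i; rewrite ltnS leq_eqVlt => /orP[/eqP->|/fx].
  by exists c => //; apply: val_inj.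
exists Is, (rcons Js J); split=> //.
  by move=> I; rewrite mem_rcons in_cons => /orP[/eqP->//|/Js0].
rewrite map_rcons -cats1 catA; apply: isomorphic_trans (isomorphic_sym (direct_sum_cat _ _)).
apply: isomorphic_trans iso _.
exact: isomorphic_prod isoN (isomorphic_prod0 _).
Qed.

(** [r] elements span [M] up to torsion. Only this upper bound on the rank is formed;
    [torsion_bound] draws on it through [kernel_rank_le]. *)
Definition rank_le (M : lmodType O) (r : nat) := exists (X : finType) (e : X -> M), #|X| = r /\
  forall x, exists2 c : O, c != 0 & exists cs : X -> O, c *: x = \sum_i cs i *: e i.

Lemma rank_le_iso (M N : lmodType O) r : lmod_isomorphic M N -> rank_le N r -> rank_le M r.
Proof.
move=> /isomorphic_sym[f [g fK gK]] [X [e [Xr eP]]]; exists X, (f \o e); split=> // x.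
have [c c0 [cs E]] := eP (g x); exists c => //; exists cs.
have := congr1 f E; rewrite linearZ gK linear_sum => ->.
by apply: eq_bigr => i _; rewrite linearZ.
Qed.

Lemma rank_le_prod (M N : lmodType O) r s : rank_le M r -> rank_le N s ->
  rank_le (M * N)%type (r + s).
Proof.
move=> [X [e [<- eP]]] [Y [e' [<- eP']]].
exists (X + Y)%type, (fun i => match i with inl i => (e i, 0) | inr j => (0, e' j) end).
split=> [|[x y]]; first by rewrite card_sum.
have [c c0 [cs E]] := eP x; have [c' c'0 [cs' E']] := eP' y.
exists (c * c'); first exact: integers_mul_neq0.
exists (fun i => match i with inl i => c' * cs i | inr j => c * cs' j end).
have fstE (Z : finType) (F : Z -> (M * N)%type) : (\sum_i F i).1 = \sum_i (F i).1.
  exact: (big_morph fst (fun _ _ => erefl) erefl).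
have sndE (Z : finType) (F : Z -> (M * N)%type) : (\sum_i F i).2 = \sum_i (F i).2.
  exact: (big_morph snd (fun _ _ => erefl) erefl).
apply: injective_projections; rewrite ?fstE ?sndE big_sumType /=.
  rewrite [X in _ + X]big1 ?addr0 => [|i _]; last by rewrite scaler0.
  by rewrite mulrC -scalerA E scaler_sumr; apply: eq_bigr => i _; rewrite scalerA.
rewrite [X in X + _]big1 ?add0r => [|i _]; last by rewrite scaler0.
by rewrite -scalerA E' scaler_sumr; apply: eq_bigr => i _; rewrite scalerA.
Qed.

Lemma rank_le_quotient I : I != ideal0 O -> rank_le (quotient_module I) 0.
Proof.
move=> /ideal0P[m Im m0]; exists void, (@of_void _); split=> [|x].
  by rewrite card_void.
exists m => //; exists (fun=> 0); rewrite big1//.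
have [y <-] := pi_quot_surj x; have := pi_quot_linear I m y 0.
rewrite addr0 => h.
have p0 : pi_quot I 0 = 0 by rewrite /pi_quot raddf0.
rewrite p0 addr0 in h; rewrite -h -p0; apply/pi_quot_eq; rewrite subr0.
exact: idealZr.
Qed.

Lemma rank_le_ideal J : J != ideal0 O -> rank_le (submod_type J) 1.
Proof.
move=> /ideal0P[m Jm m0]; exists unit, (fun=> SubmodElt Jm); split=> [|x].
  by rewrite card_unit.
exists m => //; exists (fun=> submod_val x); rewrite (big_pred1 tt); last by case.
by apply: val_inj; rewrite /= [LHS]mulrC.
Qed.

Lemma rank_le_invariants (M : lmodType O) d : has_invariants M d -> rank_le M d.2.
Proof.
case: d => Is r [Is01 _ [Js [<- Js0 iso]]]; apply: rank_le_iso iso _ => /=.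
apply: rank_le_iso (direct_sum_cat _ _) _; rewrite -[size Js]add0n.
have r0 : rank_le 'rV[O]_0 0.
  exists void, (@of_void _); split=> [|x]; first by rewrite card_void.
  exists 1; first exact: integers_neq0.
  by exists (fun=> 0); rewrite [LHS]thinmx0 [RHS]thinmx0.
apply: rank_le_prod.
  elim: Is Is01 => [//|I Is IHs] Is01 /=; rewrite -[0%N]add0n.
  apply: rank_le_prod; first by apply: rank_le_quotient; have [] := Is01 I (mem_head _ _).
  by apply: IHs => J JIs; apply: Is01; rewrite in_cons JIs orbT.
elim: Js Js0 => [//|J Js IHs] Js0 /=; rewrite -[(size Js).+1]add1n.
apply: rank_le_prod; first by apply: rank_le_ideal; apply: Js0; exact: mem_head.
by apply: IHs => I IJs; apply: Js0; rewrite in_cons IJs orbT.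
Qed.

End Structure.

(** * Counting modulo an ideal *)

Lemma is_index_transfer (V W : zmodType) (P Q : set V) (P' Q' : set W) (phi : V -> W) n :
  P 0 -> P' 0 -> subgroup Q -> subgroup Q' -> is_index P Q n ->
  (forall x, P x -> P' (phi x)) ->
  (forall y, P' y -> exists2 x, P x & Q' (y - phi x)) ->
  (forall x y, P x -> P y -> Q (x - y) <-> Q' (phi x - phi y)) -> is_index P' Q' n.
Proof.
move=> P0 P'0 sQ sQ' ind PP' surj QQ'.
have fin : finite_index P Q by exists n.
have [_ f' E] := index_transfer P0 P'0 sQ sQ' (or_introl fin) PP' surj QQ'.
by have := idxP f'; rewrite -E (is_indexE ind).
Qed.

Definition sset (A : comNzRingType) (V : lmodType A) (N : submodule V) : set V := fun x => x \in N.

Section ModuleCount.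
Variable A : comNzRingType.
Implicit Types (M N : lmodType A) (I J : ideal A).

Lemma subgroup_sset M (N : submodule M) : subgroup (sset N).
Proof. by split=> [|x y]; [exact: rpred0 | exact: rpredB]. Qed.
Hint Resolve subgroup_sset : core.

Fact smul_closed J M : lin_closed (fun x : M =>
  forall C : submodule M, (forall (j : A) y, j \in J -> j *: y \in C) -> x \in C).
Proof.
split=> [C _|c x y Px Py C h]; first exact: rpred0.
by apply: rpredD; [apply/rpredZ/Px | exact: Py].
Qed.
Definition smul J M : submodule M := mk_submodule (smul_closed J M).

Lemma mem_smul J M j (y : M) : j \in J -> j *: y \in smul J M.
Proof. by move=> Jj; apply/(mk_submoduleP (smul_closed J M)) => C h; exact: h. Qed.

Lemma smul_le J M (C : submodule M) : (forall (j : A) (y : M), j \in J -> j *: y \in C) ->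
  forall x, x \in smul J M -> x \in C.
Proof. by move=> h x /(mk_submoduleP (smul_closed J M)); exact. Qed.

Lemma smul_linear J M N (f : M -> N) x : linear f -> x \in smul J M -> f x \in smul J N.
Proof.
move=> fl; pose fL : {linear M -> N} := mk_linear fl.
have cl : lin_closed (fun x => fL x \in smul J N).
  by split=> [|c y z hy hz]; rewrite ?linear0 ?rpred0// linearP rpredD// rpredZ.
suff sub : forall y, y \in smul J M -> y \in mk_submodule cl by move/sub/mk_submoduleP.
by apply: smul_le => j y Jj; apply/mk_submoduleP; rewrite linearZ; exact: mem_smul.
Qed.

(** The order of M/JM, an isomorphism invariant that is multiplicative on direct sums. *)
Definition mcard J M n := is_index setT (sset (smul J M)) n.

Lemma mcard_iso J M N n : lmod_isomorphic M N -> mcard J M n -> mcard J N n.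
Proof.
move=> [f [g fK gK]]; have gl : linear g.
  by move=> c x y; apply: (can_inj fK); rewrite linearP !gK.
move=> h; apply: (is_index_transfer (phi := f) _ _ (subgroup_sset _) (subgroup_sset _) h) => //.
  by move=> y _; exists (g y) => //; rewrite gK subrr; exact: subgroup0.
move=> x y _ _; rewrite -linearB /sset; split=> [|h'].
  by apply: smul_linear => c u v; rewrite linearP.
by rewrite -(fK (x - y)); exact: smul_linear.
Qed.

Lemma mcard_prod J M N m n : mcard J M m -> mcard J N n -> mcard J (M * N)%type (m * n).
Proof.
rewrite /mcard => hm hn; have := index_prod hm hn.
have -> : [set: M] `*` [set: N] = [set: (M * N)%type] by apply/seteqP; split.
suff -> : sset (smul J M) `*` sset (smul J N) = sset (smul J (M * N)%type) by [].
apply/seteqP; split=> [[x y] [/= hx hy]|x hx]; last first.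
  by split; [apply: (@smul_linear J (M * N)%type M fst) | apply: (@smul_linear J (M * N)%type N snd)].
have -> : (x, y) = (x, 0) + (0, y) :> (M * N)%type by apply: injective_projections; rewrite /= ?addr0 ?add0r.
apply: (@rpredD _ (smul J (M * N)%type)).
  apply: (@smul_linear J M (M * N)%type (fun x => (x, 0))) => // c u v.
  by apply: injective_projections; rewrite /= ?scaler0 ?addr0.
apply: (@smul_linear J N (M * N)%type (fun x => (0, x))) => // c u v.
by apply: injective_projections; rewrite /= ?scaler0 ?addr0.
Qed.

Lemma mcard0 J : mcard J 'rV[A]_0 1.
Proof.
rewrite /mcard; have -> : sset (smul J 'rV[A]_0) = setT; last exact: index_refl.
apply/seteqP; split=> // x _; rewrite [x]thinmx0; exact: rpred0.
Qed.

Lemma pi_quot0 M (N : submodule M) : pi_quot N 0 = 0.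
Proof. by rewrite /pi_quot raddf0. Qed.

Lemma mem_pi_smul_ideal I J z : pi_quot I z \in smul J (quotient_module I) <-> z \in ideal_add I J.
Proof.
split=> [|/ideal_addP[x [y [Ix Jy ->]]]].
  have cl : lin_closed (fun q : quotient_module I => exists2 y : A, y \in J & q = pi_quot I y).
    split=> [|c _ _ [x Jx ->] [y Jy ->]]; first by exists 0; rewrite ?pi_quot0//; exact: ideal_0.
    by exists (c * x + y); [apply: idealD => //; exact: idealZl | rewrite pi_quot_linear].
  suff h : forall q, q \in smul J (quotient_module I) -> q \in mk_submodule cl.
    move=> /h/mk_submoduleP[y Jy /pi_quot_eq Iz]; apply/ideal_addP; exists (z - y), y.
    by rewrite subrK.
  apply: smul_le => j q Jj; apply/mk_submoduleP; have [x <-] := pi_quot_surj q.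
  exists (j * x); first exact: idealZr.
  by have := pi_quot_linear I j x 0; rewrite !pi_quot0 !addr0.
have -> : pi_quot I (x + y) = y *: pi_quot I 1.
  have := pi_quot_linear I y 1 0; rewrite !pi_quot0 !addr0 => <-.
  by apply/pi_quot_eq; rewrite -[_ *: _]/(y * 1) mulr1 addrK.
exact: mem_smul.
Qed.

Lemma mcard_quotient I J n : is_index setT (iset (ideal_add I J)) n -> mcard J (quotient_module I) n.
Proof.
move=> h.
apply: (@is_index_transfer A^o (quotient_module I) setT (iset (ideal_add I J)) setT
  (sset (smul J _)) (pi_quot I) n Logic.I Logic.I (subgroup_iset _) (subgroup_sset _) h) => //.
  by move=> q _; have [z <-] := pi_quot_surj q; exists z => //; rewrite subrr; exact: (subgroup0 (subgroup_sset _)).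
move=> x y _ _; rewrite /sset /iset -mem_pi_smul_ideal.
by rewrite /pi_quot raddfB.
Qed.

End ModuleCount.

Section RingOfIntegersCount.
Variable K : fieldExtType rat.
Notation O := (ring_of_integers K).
Implicit Types (I J : ideal O).

Lemma mcard_ideal J B : J != ideal0 O -> B != ideal0 O -> mcard J (submod_type B) (N J).
Proof.
move=> J0 B0; have BJ0 := ideal_mul_neq0 J0 B0.
have sub : iset (ideal_mul J B) `<=` iset B by move=> x; exact: ideal_mul_sub.
have := idxP (finite_sub sub BJ0); rewrite idx_ideal_mul// => h.
pose phi (x : O) : submod_type B := insubd (0 : submod_type B) x.
have phiK x : x \in B -> submod_val (phi x) = x by move=> Bx; exact: insubdK.
apply: (is_index_transfer (phi := phi) (ideal_0 B) I (subgroup_iset _) (subgroup_sset _) h) => //.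
- move=> y _; exists (submod_val y); first exact: (valP y).
  have -> : phi (submod_val y) = y by apply: val_inj; rewrite /= phiK//; exact: (valP y).
  by rewrite subrr; exact: (subgroup0 (subgroup_sset _)).
move=> x y Bx By; rewrite /iset /sset.
have -> : x - y = submod_val (phi x - phi y) by rewrite /= !phiK.
move: (phi x - phi y) => {x y Bx By} x; split.
  have cl : ideal_closed (fun z : O => exists2 x, x \in smul J (submod_type B) & submod_val x = z).
    split=> [|c _ _ [y hy <-] [w hw <-]]; first by exists 0; rewrite ?rpred0.
    by exists (c *: y + w); rewrite ?rpredD// rpredZ.
  suff h' z : z \in ideal_mul J B -> z \in mk_ideal cl.
    by move/h'/mk_idealP => [y hy /val_inj <-].
  apply: ideal_mul_le => u b Ju Bb; apply/mk_idealP; exists (u *: SubmodElt Bb) => //.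
  exact: mem_smul.
have cl : lin_closed (fun x : submod_type B => (submod_val x : O) \in ideal_mul J B).
  split=> [|c y w hy hw]; first exact: ideal_0.
  have -> : (submod_val (c *: y + w) : O) = c * (submod_val y : O) + (submod_val w : O) by [].
  by apply: idealD => //; exact: idealZl.
suff h' : forall z, z \in smul J (submod_type B) -> z \in mk_submodule cl by move/h'/mk_submoduleP.
by apply: smul_le => j y Jj; apply/mk_submoduleP; apply: mem_ideal_mul => //; exact: (valP y).
Qed.

(** Modulo [J], a summand [O/I] becomes [O/(I + J)], and a non-zero ideal contributes [N J] just as
    O itself does. *)
Lemma mcard_invariants (M : lmodType O) J d : J != ideal0 O -> has_invariants M d ->
  mcard J M ((\prod_(I <- d.1) N (ideal_add I J)) * N J ^ d.2).
Proof.
case: d => Is r J0 [_ _ [Js [<- Js0 iso]]] /=.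
apply: mcard_iso (isomorphic_sym iso) _.
apply: mcard_iso (isomorphic_sym (direct_sum_cat _ _)) _; apply: mcard_prod.
  elim: Is {iso} => [|I Is IHs]; first by rewrite big_nil; exact: mcard0.
  rewrite big_cons; apply: mcard_prod => //; apply: mcard_quotient; apply/idxP/finite_ideal.
  by have [x Jx x0] := ideal0P J0; apply: ideal_neq0 x0; exact: ideal_addr.
elim: Js Js0 {iso} => [|B Js IHs] Js0; first by rewrite expn0; exact: mcard0.
rewrite expnS; apply: mcard_prod; first by apply: mcard_ideal => //; apply: Js0; exact: mem_head.
by apply: IHs => C CJs; apply: Js0; rewrite in_cons CJs orbT.
Qed.

End RingOfIntegersCount.

Lemma linE (A : comNzRingType) (T : finType) (c : A) (u v : {ffun T -> A^o}) x :
  ((c *: u + v) x : A) = c * (u x : A) + (v x : A).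
Proof. by rewrite [LHS]ffunE [(c *: u) x]ffunE. Qed.

Lemma subE (A : comNzRingType) (T : finType) (u v : {ffun T -> A^o}) x :
  ((u - v) x : A) = (u x : A) - (v x : A).
Proof. by rewrite [LHS]ffunE [(- v) x]ffunE. Qed.

(** * Right multiplication by an element of the group ring *)

Section Convolution.
Variables (K : fieldExtType rat) (F : groupType) (X : finite_right_set F).
Notation O := (ring_of_integers K).
Variable a : group_ring O F.
Notation V := {ffun X -> O^o}.
Notation M := (quotient_module (rconv_image X a)).
Implicit Types (v u : V) (J : ideal O).

Definition dlt (x : X) : V := [ffun y => (y == x)%:R].

Lemma dlt_sum v : v = \sum_x v x *: dlt x.
Proof.
apply/ffunP => y.
have E x : (v x *: dlt x) y = (v x : O) * (y == x)%:R by rewrite [LHS]ffunE [dlt x y]ffunE.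
rewrite sum_ffunE (eq_bigr _ (fun x _ => E x)) (bigD1 y)//= eqxx mulr1 big1 ?addr0// => x ne.
by rewrite eq_sym (negbTE ne) mulr0.
Qed.

Lemma rconv_sum v y : (rconv a v y : O) = \sum_x (v x : O) * (rconv a (dlt x) y : O).
Proof.
rewrite {1}[v]dlt_sum linear_sum sum_ffunE; apply: eq_bigr => x _.
by rewrite linearZ ffunE.
Qed.

Lemma rconv_imageP v : v \in rconv_image X a <-> exists u, v = rconv a u.
Proof. by split=> [/asboolP//|h]; exact/asboolP. Qed.

Definition conv_mx : 'M[K]_#|X| :=
  \matrix_(i, j) int_val (rconv a (dlt (enum_val i)) (enum_val j) : O).

Definition rv v : 'rV[K]_#|X| := \row_j int_val (v (enum_val j) : O).

Lemma rv_rconv v : rv (rconv a v) = rv v *m conv_mx.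
Proof.
apply/rowP => j; rewrite !mxE rconv_sum int_val_sum (reindex _ (onW_bij _ (enum_val_bij X))) /=.
by apply: eq_bigr => i _; rewrite !mxE; exact: int_valM.
Qed.

Lemma rv_inj u v : rv u = rv v -> u = v.
Proof.
move=> /rowP uv; apply/ffunP => x; have := uv (enum_rank x).
by rewrite !mxE enum_rankK => /int_val_inj.
Qed.

Definition vec (w : 'rV[K]_#|X|) : V := [ffun x => to_int (w ord0 (enum_rank x))].

Lemma rv_vec (w : 'rV[K]_#|X|) : (forall j, w ord0 j \in @is_integral K) -> rv (vec w) = w.
Proof. by move=> wi; apply/rowP => j; rewrite mxE ffunE to_intK// enum_valK. Qed.

Lemma integral_multiple_row n (w : 'rV[K]_n) :
  exists2 c : O, c != 0 & forall j, int_val c * w ord0 j \in @is_integral K.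
Proof.
have [D D0 Dw] := integral_multiples (fun j => w ord0 j).
exists D%:R; first by rewrite -int_val_eq0 rmorph_nat nat_eq0 -lt0n.
by move=> j; rewrite rmorph_nat.
Qed.

Lemma rvZ (c : O) v : rv (c *: v) = int_val c *: rv v.
Proof. by apply/rowP => j; rewrite !mxE ffunE -int_valM. Qed.

Lemma mem_image_multiple v : (rv v <= conv_mx)%MS ->
  exists2 c : O, c != 0 & c *: v \in rconv_image X a.
Proof.
move=> /submxP[w wE]; have [c c0 cw] := integral_multiple_row w.
exists c => //; apply/rconv_imageP; exists (vec (int_val c *: w)).
apply: rv_inj; rewrite rvZ rv_rconv rv_vec ?wE ?scalemxAl// => j.
by rewrite mxE.
Qed.

(** The functionals for [structure_theorem] are the columns of the cokernel matrix of right
    multiplication, cleared of denominators. A vector killed by all of them lies in the image over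
    K, so a non-zero multiple lies in the image over O. *)
Lemma has_invariants_rconv : exists d, has_invariants M d.
Proof.
pose C := cokermx conv_mx.
have [D D0 DC] := integral_multiples (fun ij : 'I_#|X| * 'I_#|X| => C ij.1 ij.2).
pose f (j : 'I_#|X|) (v : V) : O := \sum_i (v (enum_val i) : O) * to_int (D%:R * C i j).
have fE j v : int_val (f j v) = D%:R * (rv v *m C) ord0 j.
  rewrite int_val_sum mxE mulr_sumr; apply: eq_bigr => i _.
  by rewrite int_valM (to_intK (DC (i, j))) [rv v _ _]mxE mulrCA.
have fl j c u v : f j (c *: u + v) = c * f j u + f j v.
  by rewrite mulr_sumr -big_split; apply: eq_bigr => i _; rewrite linE mulrDl mulrA.
have f_im j u : f j (rconv a u) = 0.
  by apply: int_val_inj; rewrite fE rv_rconv -mulmxA mulmx_coker mulmx0 mxE mulr0 rmorph0.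
have f_eq j u v : u - v \in rconv_image X a -> f j u = f j v.
  move=> /rconv_imageP[w wE]; have := fl j 1 (u - v) v.
  by rewrite scale1r subrK wE f_im mulr0 add0r.
pose g (i : nat) (q : M) : O^o :=
  if insub i is Some j then f j (repr (q : Quotient.quot (rconv_image X a))) else 0.
have gE j v : g (val j) (pi_quot (rconv_image X a) v) = f j v.
  rewrite /g valK; apply: f_eq; apply/pi_quot_eq; exact: reprK.
apply: (@structure_theorem K M #|X| g).
- exists X, (fun x => pi_quot (rconv_image X a) (dlt x)) => q.
  have [v <-] := pi_quot_surj q; exists v; rewrite {1}[v]dlt_sum.
  pose L : {linear V -> M} := mk_linear (@pi_quot_linear _ _ (rconv_image X a)).
  by rewrite -[LHS]/(L _) linear_sum; apply: eq_bigr => x _; rewrite linearZ.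
- move=> i c q r; have [u <-] := pi_quot_surj q; have [v <-] := pi_quot_surj r.
  rewrite -pi_quot_linear; have [lt|ge] := ltnP i #|X|; last first.
    by rewrite /g insubN ?scaler0 ?addr0// -leqNgt.
  by rewrite -[i]/(val (Ordinal lt)) !gE fl.
move=> q; have [v <-] := pi_quot_surj q => gv.
have [|c c0 cv] := @mem_image_multiple v.
  rewrite submxE; apply/eqP/rowP => j; rewrite [RHS]mxE.
  have := gv j (ltn_ord j); rewrite gE => /(congr1 (@int_val K)); rewrite fE rmorph0 => /eqP.
  by rewrite mulf_eq0 nat_eq0 (gtn_eqF D0) /= => /eqP.
exists c => //; have := pi_quot_linear (rconv_image X a) c v 0.
rewrite pi_quot0 !addr0 => <-; rewrite -(pi_quot0 (rconv_image X a)).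
by apply/pi_quot_eq; rewrite subr0.
Qed.

Definition kerJ J : set V := fun v => forall x, (rconv a v x : O) \in J.

Definition zeroJ J : set V := pointwise (iset J : set O^o) predT.

Lemma subgroup_kerJ J : subgroup (kerJ J).
Proof.
split=> [x|u v hu hv x]; first by rewrite linear0 ffunE; exact: ideal_0.
by rewrite linearB subE; exact: idealB.
Qed.

Lemma subgroup_zeroJ J : subgroup (zeroJ J).
Proof. by apply: subgroup_pointwise; exact: subgroup_iset. Qed.

Lemma zeroJ_sub_kerJ J : zeroJ J `<=` kerJ J.
Proof.
by move=> v vJ x; rewrite rconv_sum; apply: ideal_sum => y _; apply: idealZr; exact: vJ.
Qed.

Definition imJ J : set V := fun v => exists u h : V, zeroJ J h /\ v = rconv a u + h.

Lemma subgroup_imJ J : subgroup (imJ J).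
Proof.
have s0 := subgroup_zeroJ J.
split=> [|_ _ [u [h [hJ ->]]] [u' [h' [hJ' ->]]]].
  by exists 0, 0; rewrite linear0 addr0; split=> //; exact: subgroup0.
exists (u - u'), (h - h'); split; first exact: (subgroupB s0 hJ hJ').
by rewrite linearB /= opprD addrACA.
Qed.

Lemma index_zeroJ J : J != ideal0 O -> is_index setT (zeroJ J) (N J ^ #|X|).
Proof. by move=> J0; apply: (@index_ffun X O^o) => //; apply/idxP/finite_ideal. Qed.

Lemma mem_pi_smul J v :
  pi_quot (rconv_image X a) v \in smul J M <-> imJ J v.
Proof.
pose L : {linear V -> M} := mk_linear (@pi_quot_linear _ _ (rconv_image X a)).
split=> [|[u [h [hJ ->]]]].
  have cl : lin_closed (fun q : M => exists2 h : V, zeroJ J h & q = L h).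
    split=> [|c _ _ [x Jx ->] [y Jy ->]].
      by exists 0; rewrite ?linear0//; exact: subgroup0 (subgroup_zeroJ J).
    exists (c *: x + y); last by rewrite linearP.
    by move=> z _; rewrite /iset linE; apply: idealD; [apply/idealZl/Jx | exact: Jy].
  suff h : forall q, q \in smul J M -> q \in mk_submodule cl.
    move=> /h/mk_submoduleP[y Jy /pi_quot_eq/rconv_imageP[u uE]]; exists u, y; split=> //.
    by rewrite -uE subrK.
  apply: smul_le => j q Jj; apply/mk_submoduleP; have [x <-] := pi_quot_surj q.
  exists (j *: x); last by rewrite linearZ.
  by move=> y _; rewrite ffunE; exact: idealZr.
have -> : pi_quot (rconv_image X a) (rconv a u + h) = L h.
  by apply/pi_quot_eq; rewrite addrK; apply/rconv_imageP; exists u.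
rewrite [h]dlt_sum linear_sum rpred_sum// => x _; rewrite linearZ.
by apply: mem_smul; exact: hJ.
Qed.

(** Right multiplication by [a] is an endomorphism of the finite group (O/J)^X, so its kernel and
    cokernel have the same order. The cokernel is M/JM, whose order [mcard_invariants] gives. *)
Lemma index_kerJ d J : J != ideal0 O -> has_invariants M d ->
  is_index (kerJ J) (zeroJ J) ((\prod_(I <- d.1) N (ideal_add I J)) * N J ^ d.2).
Proof.
move=> J0 /(mcard_invariants J0); set n := muln _ _ => hn.
have sI := subgroup_imJ J; have s0 := subgroup_zeroJ J; have sK := subgroup_kerJ J.
have fT : finite_index setT (zeroJ J) by eexists; exact: index_zeroJ.
have ind : is_index setT (imJ J) n.
  have fI : finite_index setT (imJ J).
    have zI v : [set: V] v -> zeroJ J v -> imJ J v by move=> _ vJ; exists 0, v; rewrite linear0 add0r.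
    by have [] := @idx_le_sub _ setT (imJ J) setT (zeroJ J) I sI fT (@subsetT _ _) zI (subgroupT _).
  suff -> : n = idx setT (imJ J) by exact: idxP.
  apply: is_index_uniq hn _.
  apply: (is_index_transfer (phi := pi_quot (rconv_image X a)) _ _ sI (subgroup_sset _) (idxP fI)) => //.
    move=> q _; have [v <-] := pi_quot_surj q; exists v => //; rewrite subrr; exact: subgroup0 (subgroup_sset _).
  by move=> x y _ _; rewrite -mem_pi_smul /sset /pi_quot raddfB.
have im0 : imJ J 0 by exact: subgroup0.
have [fI0 _] := @idx_le_sub _ (imJ J) (zeroJ J) setT (zeroJ J) im0 s0 fT (@subsetT _ _) (fun _ _ h => h) sI.
have [fK0 _] := @idx_le_sub _ (kerJ J) (zeroJ J) setT (zeroJ J) (subgroup0 sK) s0 fT (@subsetT _ _) (fun _ _ h => h) sK.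
have zI : zeroJ J `<=` imJ J by move=> v vJ; exists 0, v; rewrite linear0 add0r.
have [fK _ EK] : [/\ finite_index setT (kerJ J), finite_index (imJ J) (zeroJ J) &
    idx setT (kerJ J) = idx (imJ J) (zeroJ J)].
  apply: (index_transfer (phi := rconv a)) => //; first by right.
  - by move=> v _; exists v, 0; rewrite addr0; split=> //; exact: subgroup0.
  - move=> _ [u [h [hJ ->]]]; exists u => //; rewrite addrAC subrr add0r; exact: hJ.
  - by move=> u v _ _; rewrite -linearB; split=> h x => [_|]; exact: h.
suff -> : n = idx (kerJ J) (zeroJ J) by exact: idxP.
have [_ E1] := idx_mul (subgroupT _) sI s0 (@subsetT _ _) zI (ex_intro _ _ ind) fI0.
have [_ E2] := idx_mul (subgroupT _) sK s0 (@subsetT _ _) (@zeroJ_sub_kerJ J) fK fK0.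
have gt0 : (0 < idx (imJ J) (zeroJ J))%N by apply: idx_gt0 => //; exists 0.
apply/eqP; rewrite -(eqn_pmul2r gt0) -(is_indexE ind) -E1 E2 EK mulnC//.
Qed.

End Convolution.

(** * Foelner sets and sofic approximations *)

(** Take the weights [d] of [shearer_weights]. Each [p f] permutes [X], so the product of all
    weights to the power [#|T|] is the product over [x] and [f] of [d (p f x)]. At a good [x] the
    points [p f x] are distinct and their weights multiply to at most [C]; at a bad one every weight
    is bounded by the index of [J]. *)
Lemma shearer_cover (X T : finType) (V : zmodType) (J : set V) (p : T -> X -> X)
    (good : pred X) (H : set {ffun X -> V}) (C : nat) :
  subgroup J -> finite_index setT J -> subgroup H -> (forall f, injective (p f)) ->
  (0 < C)%N ->
  (forall x, good x -> injective (p^~ x) /\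
     (idx H (H `&` pointwise J (mem (codom (p^~ x)))) <= C)%N) ->
  (idx H (H `&` pointwise J predT) ^ #|T| <=
   C ^ #|X| * (idx setT J) ^ (#|T| * #|[pred x | ~~ good x]|))%N.
Proof.
move=> sJ fJ sH p_inj C0 goodP.
have [_ [d [dJ dE dC]]] := shearer_weights sJ fJ (enum_uniq X) sH.
have eqp (D E : pred X) : D =1 E -> pointwise J D = pointwise J E by move=> /funext->.
have -> : idx H (H `&` pointwise J predT) = (\prod_x d x)%N.
  rewrite -big_enum -dE; congr (idx _ (_ `&` _)); apply: eqp => x.
  by rewrite -[RHS]/(x \in enum X) mem_enum.
have -> : ((\prod_x d x) ^ #|T| = \prod_x \prod_f d (p f x))%N.
  rewrite exchange_big -prod_nat_const; apply: eq_bigr => f _.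
  by rewrite (reindex_inj (p_inj f)).
rewrite (bigID good) /= leq_mul//.
  apply: (@leq_trans (\prod_(x | good x) C)); last first.
    by rewrite prod_nat_const leq_pexp2l// max_card.
  apply: leq_prod => x /goodP[inj le]; apply: leq_trans le.
  have [_] := dC (mem (codom (p^~ x))).
  rewrite [X in _ `&` X](eqp _ (mem (codom (p^~ x)))) => [|y]; last first.
    by rewrite /= [y \in enum _]mem_enum andbT.
  apply: leq_trans; rewrite big_enum_cond /=.
  have U : uniq (codom (p^~ x)) by rewrite map_inj_uniq ?enum_uniq.
  by rewrite -(big_uniq _ U) big_map big_enum.
apply: (@leq_trans (\prod_(x | ~~ good x) (idx setT J) ^ #|T|)); last by rewrite prod_nat_const expnM.
by apply: leq_prod => x _; rewrite -prod_nat_const; apply: leq_prod => f _; case/andP: (dJ (p f x)).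
Qed.

Section FreeGroupAction.
Variables (G : groupType) (S : {fset G}).
Notation F := (free_group S).
Implicit Types (u v w : F).

Definition letter_eval (l : S * bool) : G := (if l.2 then (fsval l.1)^-1 else fsval l.1)%g.

Lemma letter_eval_inv l : letter_eval (letter_inv l) = ((letter_eval l)^-1)%g.
Proof. by case: l => s []; rewrite /letter_eval /= ?invgK. Qed.

Lemma free_evalM u v : free_eval (u * v)%g = (free_eval u * free_eval v)%g.
Proof.
rewrite /free_eval /=; elim: (word u) => [|l w IHw] /=; first by rewrite big_nil mul1g.
rewrite big_cons -mulgA -IHw -/(letter_eval l).
case: (word_mul w v) => [|m t] /=; first by rewrite big_seq1 big_nil mulg1.
case: eqP => [->|_]; last by rewrite big_cons.
by rewrite big_cons -/(letter_eval (letter_inv l)) letter_eval_inv mulVKg.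
Qed.

Lemma free_evalV u : free_eval (u^-1)%g = ((free_eval u)^-1)%g.
Proof.
apply: (mulIg (free_eval u)); rewrite -free_evalM !mulVg.
by rewrite /free_eval big_nil.
Qed.

Lemma size_wordM u v : (size (word (u * v)%g) <= size (word u) + size (word v))%N.
Proof.
rewrite /=; elim: (word u) => //= l w IHw; apply: leq_trans (_ : (size (word_mul w v)).+1 <= _)%N => //.
by case: (word_mul w v) => [|m t] //=; case: ifP => //= _; rewrite ltnW// ltnW.
Qed.

Lemma size_wordV u : size (word (u^-1)%g) = size (word u).
Proof. by rewrite /= /word_inv size_rev size_map. Qed.

Lemma ractK (X : finite_right_set F) u : cancel (fun x : X => ract x u) (fun x => ract x (u^-1)%g).
Proof. by move=> x; rewrite -ractM mulgV ract1. Qed.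

Lemma ractKV (X : finite_right_set F) u : cancel (fun x : X => ract x (u^-1)%g) (fun x => ract x u).
Proof. by move=> x; rewrite -ractM mulVg ract1. Qed.

(** The defining property of a good point is applied to the word [u^-1 * v]. *)
Lemma good_points_eq (X : finite_right_set F) r (x : X) u v : good_points r X x ->
  (size (word u) + size (word v) <= r)%N ->
  (ract x (u^-1)%g = ract x (v^-1)%g <-> free_eval u = free_eval v).
Proof.
move=> /asboolP gx sz; have := gx (u^-1 * v)%g.
have szr : ball1 r (u^-1 * v)%g.
  by rewrite /ball1 /=; apply: leq_trans sz; rewrite -(size_wordV u); exact: size_wordM.
move=> /(_ szr); rewrite ractM free_evalM free_evalV => h; split=> E.
  have /h /(congr1 (fun z => free_eval u * z)%g) : ract (ract x (u^-1)%g) v = x by rewrite E ractKV.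
  by rewrite mulVKg mulg1.
have E' : ract (ract x (u^-1)%g) v = x by apply/h; rewrite E mulVg.
by rewrite -{2}E' ractK.
Qed.

End FreeGroupAction.

(** * Local kernels and images on a Foelner set *)

Section Foelner.
Variables (G : groupType) (S : {fset G}).
Notation F := (free_group S).
Hypothesis S_generates : forall g : G, exists w : F, free_eval w = g.
Variable K : fieldExtType rat.
Notation O := (ring_of_integers K).
Variable a : group_ring O F.
Notation W := (finsupp a).

Definition lift : G -> F := projT1 (choice S_generates).
Lemma liftK g : free_eval (lift g) = g.
Proof. exact: (projT2 (choice S_generates)). Qed.

Lemma rconvE (X : finite_right_set F) (v : {ffun X -> O^o}) y :
  (rconv a v y : O) = \sum_(w <- W) (v (ract y (w^-1)%g) : O) * a w.
Proof.
rewrite ffunE; apply: eq_bigr => w _; rewrite (big_pred1 (ract y (w^-1)%g))// => x /=.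
by apply/eqP/eqP => [<-|->]; rewrite ?ractK ?ractKV.
Qed.

Variable Fo : {fset G}.

(** The model on [G] of [rconv]: near a good point [x], the function [g] to [v (x g^-1)] on [G]
    represents [v], and right translation by [w^-1] on X becomes left multiplication by [w]. *)
Definition conv (u : G -> O) (g : G) : O := \sum_(w <- W) u (free_eval w * g)%g * a w.

Definition interior : pred Fo := fun f => all (fun w => (free_eval w * val f)%g \in Fo) W.

Definition ext (u : {ffun Fo -> O^o}) (g : G) : O := if insub g is Some f then u f else 0.

(** The condition is imposed at interior points only, where the extension by zero is not felt. So
    restrictions of global kernel vectors belong to it. *)
Definition locker (J : ideal O) : set {ffun Fo -> O^o} :=
  fun u => forall f, interior f -> conv (ext u) (val f) \in J.

(** The function [u] is arbitrary on all of [G], so restrictions of global image vectors belong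
    here. Both local groups err on the large side, as Shearer's inequality requires. *)
Definition locim : set {ffun Fo -> O^o} :=
  fun s => exists u : G -> O, forall f, (s f : O) = conv u (val f).

Lemma convB u v g : conv (fun h => u h - v h) g = conv u g - conv v g.
Proof. by rewrite -sumrB; apply: eq_bigr => w _; rewrite mulrBl. Qed.

Lemma extB u v g : ext (u - v) g = ext u g - ext v g.
Proof. by rewrite /ext; case: insub => [f|]; rewrite ?subr0//; exact: (subE u v). Qed.

Lemma subgroup_locker J : subgroup (locker J).
Proof.
split=> [f _|u v hu hv f intf].
  apply: ideal_sum => w _; rewrite /ext; case: insub => [g|]; rewrite ?mul0r; last exact: ideal_0.
  by rewrite ffunE mul0r; exact: ideal_0.
have -> : conv (ext (u - v)) (val f) = conv (ext u) (val f) - conv (ext v) (val f).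
  by rewrite -convB; apply: eq_bigr => w _; rewrite extB.
by apply: idealB; [exact: hu | exact: hv].
Qed.

Lemma subgroup_locim : subgroup locim.
Proof.
split=> [|s t [u uE] [v vE]].
  by exists (fun=> 0) => f; rewrite ffunE /conv big1// => w _; rewrite mul0r.
by exists (fun g => u g - v g) => f; rewrite convB -uE -vE; exact: (subE s t).
Qed.

Lemma conv_ext_restrict (u : G -> O) (f : Fo) : interior f ->
  conv (ext [ffun h : Fo => (u (val h) : O^o)]) (val f) = conv u (val f).
Proof.
move=> /allP intf; rewrite /conv big_seq [RHS]big_seq; apply: eq_bigr => w ws.
by rewrite /ext insubT ?intf// => h; rewrite ffunE.
Qed.

(* Rank plus nullity of the local convolution, up to the boundary of the Foelner set. *)
Lemma local_counts (J : ideal O) : J != ideal0 O ->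
  let zJ := pointwise (iset J : set O^o) (predT : pred Fo) in
  [/\ finite_index (locker J) zJ, finite_index locim (locim `&` zJ) &
    (idx (locker J) zJ * idx locim (locim `&` zJ) <=
     N J ^ (#|{: Fo}| + #|[pred f : Fo | ~~ interior f]|))%N].
Proof.
move=> J0 zJ; have sJ : subgroup (iset J : set O^o) by exact: subgroup_iset.
have sz : subgroup zJ by exact: subgroup_pointwise.
have iz : is_index setT zJ (N J ^ #|{: Fo}|).
  by apply: (@index_ffun Fo O^o) => //; apply/idxP/finite_ideal.
have fz : finite_index setT zJ by exists (N J ^ #|{: Fo}|)%N.
have sk := subgroup_locker J; have si := subgroup_locim.
have zk : zJ `<=` locker J.
  move=> u uJ f _; apply: ideal_sum => w _; apply: idealZr; rewrite /ext.
  by case: insub => [g|]; [exact: uJ | exact: ideal_0].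
have [fk _] := @idx_le_sub _ (locker J) zJ setT zJ (subgroup0 sk) sz fz (@subsetT _ _) (fun _ _ h => h) sk.
have [fTk _] := @idx_le_sub _ setT (locker J) setT zJ Logic.I sk fz (@subsetT _ _) (fun _ _ h => zk _ h) (subgroupT _).
have [_ EN] := idx_mul (subgroupT _) sk sz (@subsetT _ _) zk fTk fk.
pose zint := pointwise (iset J : set O^o) (interior : pred Fo).
have szint : subgroup zint by exact: subgroup_pointwise.
have sii : subgroup (locim `&` zint) by exact: subgroupI.
pose phi (u : {ffun Fo -> O^o}) : {ffun Fo -> O^o} := [ffun f : Fo => (conv (ext u) (val f) : O^o)].
have phiB (u v : {ffun Fo -> O^o}) : phi u - phi v = phi (u - v).
  apply/ffunP => f; rewrite [LHS](subE (phi u) (phi v)) [phi u f]ffunE [phi v f]ffunE [RHS]ffunE -convB.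
  by apply: eq_bigr => w _; rewrite extB.
(* On interior points the image depends only on [u] inside [Fo], so it is a quotient of the
   functions on [Fo] by the local kernel. *)
have [fi1 le1] : finite_index locim (locim `&` zint) /\
    (idx locim (locim `&` zint) <= idx setT (locker J))%N.
  apply: (index_ge (phi := phi)) => //; first exact: subgroup0.
    move=> s [u uE]; exists [ffun h : Fo => (u (val h) : O^o)] => //.
    split.
      apply: (subgroupB si); first by exists u.
      by exists (ext [ffun h : Fo => (u (val h) : O^o)]) => f; rewrite ffunE.
    move=> f intf; rewrite /iset (subE s (phi _)) uE ffunE conv_ext_restrict// subrr; exact: ideal_0.
  move=> u v _ _ kuv; rewrite phiB; split; first by exists (ext (u - v)) => f; rewrite ffunE.
  by move=> f intf; rewrite /iset ffunE; exact: kuv.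
(* The remaining coordinates are those of the boundary, each worth at most a factor [N J]. *)
have [fi2 le2] : finite_index (locim `&` zint) (locim `&` zJ) /\
    (idx (locim `&` zint) (locim `&` zJ) <= N J ^ #|[pred f : Fo | ~~ interior f]|)%N.
  have iz' : is_index setT (pointwise (iset J : set O^o) (predT : pred {f : Fo | ~~ interior f}))
      (N J ^ #|{: {f : Fo | ~~ interior f}}|).
    by apply: (@index_ffun _ O^o) => //; apply/idxP/finite_ideal.
  have E : #|{: {f : Fo | ~~ interior f}}| = #|[pred f : Fo | ~~ interior f]| by rewrite card_sig.
  rewrite -E -(is_indexE iz').
  apply: (index_le (phi := fun s : {ffun Fo -> O^o} => [ffun f : {f : Fo | ~~ interior f} => s (val f)])) => //.
  - exact: subgroup0.
  - exact: subgroupI.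
  - by eexists; exact: iz'.
  move=> s t [si1 sz1] [ti1 tz1] st; split; first exact: subgroupB.
  move=> f _; have [intf|nintf] := boolP (interior f).
    exact: (subgroupB szint sz1 tz1).
  have := st (Sub f nintf) isT.
  rewrite /iset [X in X \in _](subE [ffun g : {f : Fo | ~~ interior f} => s (val g)]) !ffunE.
  by rewrite SubK.
have zint' : locim `&` zJ `<=` locim `&` zint.
  by move=> s [? sJ']; split=> // f _; exact: sJ'.
have [fi Ei] := idx_mul si sii (subgroupI si sz) (@subIsetl _ _ _) zint' fi1 fi2.
split=> //; rewrite Ei expnD -(is_indexE iz) EN mulnA leq_mul//.
by rewrite mulnC leq_mul.
Qed.

Variables (X : finite_right_set F) (r : nat).
Hypothesis r_large : forall (f : Fo) (w : F), w \in W ->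
  (size (word w) + size (word (lift (val f))) + size (word (lift (free_eval w * val f)%g)) <= r)%N.
Hypothesis r_large2 : forall f f' : Fo,
  (size (word (lift (val f))) + size (word (lift (val f'))) <= r)%N.

Definition translate (f : Fo) (x : X) : X := ract x ((lift (val f))^-1)%g.

Lemma translate_inj f : injective (translate f).
Proof. by apply: (can_inj (g := fun x => ract x (lift (val f)))) => x; exact: ractKV. Qed.

Lemma translate_good x : good_points r X x -> injective (translate^~ x).
Proof.
move=> gx f f' E; apply: val_inj; have := good_points_eq gx (r_large2 f f').
by rewrite !liftK; case=> h _; exact: h.
Qed.

(** At a good point the words [lift f] preceded by [w] and [lift (w f)] act alike, since they have
    the same value in [G] and [r_large] bounds their lengths. *)
Lemma rconv_translate (v : {ffun X -> O^o}) x f : good_points r X x ->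
  (rconv a v (translate f x) : O) = conv (fun g => v (ract x ((lift g)^-1)%g)) (val f).
Proof.
move=> gx; rewrite rconvE /conv big_seq [RHS]big_seq; apply: eq_bigr => w ws.
congr ((v _ : O) * _); rewrite /translate -ractM -invgM.
apply/(good_points_eq gx); last by rewrite free_evalM !liftK.
apply: leq_trans (r_large f ws); rewrite leq_add2r; exact: size_wordM.
Qed.

Definition imset_conv : set {ffun X -> O^o} := fun v => exists u, v = rconv a u.

Lemma subgroup_imset_conv : subgroup imset_conv.
Proof.
split=> [|_ _ [u ->] [v ->]]; first by exists 0; rewrite linear0.
by exists (u - v); rewrite linearB.
Qed.

Lemma local_kerJ (J : ideal O) x : J != ideal0 O -> good_points r X x ->
  (idx (@kerJ K F X a J) (@kerJ K F X a J `&` pointwise (iset J : set O^o) (mem (codom (translate^~ x))))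
   <= idx (locker J) (pointwise (iset J : set O^o) (predT : pred Fo)))%N.
Proof.
move=> J0 gx; have [fk _ _] := local_counts J0.
have sK := @subgroup_kerJ K F X a J.
have sp (C : pred X) : subgroup (pointwise (iset J : set O^o) C).
  by apply: subgroup_pointwise; exact: subgroup_iset.
have [] // := @index_le _ _ (kerJ a J) (kerJ a J `&` pointwise (iset J : set O^o) (mem (codom (translate^~ x))))
  (locker J) (pointwise (iset J : set O^o) (predT : pred Fo))
  (fun v : {ffun X -> O^o} => [ffun f : Fo => v (translate f x)])
  (subgroup0 sK) (subgroupI sK (sp _)) fk.
- move=> v hv f intf; have := hv (translate f x); rewrite (rconv_translate _ _ gx).
  suff -> : conv (fun g => v (ract x ((lift g)^-1)%g)) (val f) =
    conv (ext [ffun f0 => v (translate f0 x)]) (val f) by [].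
  by rewrite -(conv_ext_restrict _ intf).
move=> u v hu hv uv; split; first exact: (subgroupB sK hu hv).
move=> _ /codomP[f ->]; have := uv f isT.
by rewrite /iset (subE u v) (subE [ffun f0 => u (translate f0 x)]) !ffunE.
Qed.

Lemma local_image (J : ideal O) x : J != ideal0 O -> good_points r X x ->
  (idx imset_conv (imset_conv `&` pointwise (iset J : set O^o) (mem (codom (translate^~ x))))
   <= idx locim (locim `&` pointwise (iset J : set O^o) (predT : pred Fo)))%N.
Proof.
move=> J0 gx; have [_ fi _] := local_counts J0.
have sK := subgroup_imset_conv.
have sp (C : pred X) : subgroup (pointwise (iset J : set O^o) C).
  by apply: subgroup_pointwise; exact: subgroup_iset.
have [] // := @index_le _ _ imset_conv (imset_conv `&` pointwise (iset J : set O^o) (mem (codom (translate^~ x))))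
  locim (locim `&` pointwise (iset J : set O^o) (predT : pred Fo))
  (fun v : {ffun X -> O^o} => [ffun f : Fo => v (translate f x)])
  (subgroup0 sK) (subgroupI sK (sp _)) fi.
- move=> _ [u ->]; exists (fun g => u (ract x ((lift g)^-1)%g)) => f.
  by rewrite ffunE rconv_translate.
move=> u v hu hv [_ uv]; split; first exact: (subgroupB sK hu hv).
move=> _ /codomP[f ->]; have := uv f isT.
by rewrite /iset (subE u v) (subE [ffun f0 => u (translate f0 x)]) !ffunE.
Qed.

(** Rank plus nullity, here exact, for the endomorphism of (O/J)^X induced by [a]. *)
Lemma ker_image_counts (J : ideal O) : J != ideal0 O ->
  [/\ finite_index (@kerJ K F X a J) (zeroJ J),
      finite_index imset_conv (imset_conv `&` zeroJ J) &
      (idx (@kerJ K F X a J) (zeroJ J) * idx imset_conv (imset_conv `&` zeroJ J) = N J ^ #|X|)%N].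
Proof.
move=> J0; have sK := @subgroup_kerJ K F X a J; have s0 := @subgroup_zeroJ K F X J.
have sI := subgroup_imset_conv.
have iz := @index_zeroJ K F X J J0.
have fT : finite_index setT (@zeroJ K F X J) by eexists; exact: iz.
have [fK0 _] := @idx_le_sub _ (kerJ a J) (zeroJ J) setT (zeroJ J) (subgroup0 sK) s0 fT (@subsetT _ _) (fun _ _ h => h) sK.
have [fTK _] := @idx_le_sub _ setT (kerJ a J) setT (zeroJ J) Logic.I sK fT (@subsetT _ _) (fun _ _ h => @zeroJ_sub_kerJ K F X a J _ h) (subgroupT _).
have [_ E] := idx_mul (subgroupT _) sK s0 (@subsetT _ _) (@zeroJ_sub_kerJ K F X a J) fTK fK0.
have [_ fi Ei] : [/\ finite_index setT (@kerJ K F X a J), finite_index imset_conv (imset_conv `&` zeroJ J) &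
    idx setT (@kerJ K F X a J) = idx imset_conv (imset_conv `&` zeroJ J)].
  apply: (index_transfer (phi := rconv a)) => //.
  - exact: subgroup0.
  - exact: subgroupI.
  - by left.
  - by move=> v _; exists v.
  - by move=> _ [u ->]; exists u => //; rewrite subrr; split; exact: subgroup0.
  move=> u v _ _; rewrite -linearB; split=> [h|[_ h] x]; last exact: h.
  by split=> [|x _]; [exists (u - v) | exact: h].
by split=> //; rewrite mulnC -Ei -E (is_indexE iz).
Qed.

Lemma shearer_kerJ (J : ideal O) : J != ideal0 O ->
  (idx (@kerJ K F X a J) (zeroJ J) ^ #|{: Fo}| <=
   idx (locker J) (pointwise (iset J : set O^o) (predT : pred Fo)) ^ #|X| *
   N J ^ (#|{: Fo}| * #|[pred x : X | ~~ good_points r X x]|))%N.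
Proof.
move=> J0; have [fk _ _] := local_counts J0.
have -> : zeroJ J = (@kerJ K F X a J) `&` zeroJ J.
  by apply/seteqP; split=> [v h|v []//]; split=> //; exact: zeroJ_sub_kerJ.
apply: (shearer_cover (p := translate)) => //.
- exact: subgroup_iset.
- exact: finite_ideal.
- exact: subgroup_kerJ.
- exact: translate_inj.
- by apply: idx_gt0 fk; exists 0; exact: subgroup0 (subgroup_locker J).
by move=> x gx; split; [exact: translate_good | exact: local_kerJ].
Qed.

Lemma shearer_image (J : ideal O) : J != ideal0 O ->
  (idx imset_conv (imset_conv `&` zeroJ J) ^ #|{: Fo}| <=
   idx locim (locim `&` pointwise (iset J : set O^o) (predT : pred Fo)) ^ #|X| *
   N J ^ (#|{: Fo}| * #|[pred x : X | ~~ good_points r X x]|))%N.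
Proof.
move=> J0; have [_ fi _] := local_counts J0.
apply: (shearer_cover (p := translate)) => //.
- exact: subgroup_iset.
- exact: finite_ideal.
- exact: subgroup_imset_conv.
- exact: translate_inj.
- by apply: idx_gt0 fi; exists 0; exact: subgroup0 subgroup_locim.
by move=> x gx; split; [exact: translate_good | exact: local_image].
Qed.

End Foelner.

(** [k] and [i] are the indices for kernel and image on X, [kF] and [iF] the local ones, [b] the
    boundary and [bad] the number of bad points. The bound on [k] is one half; the bound on [i]
    becomes a lower bound on [k] through the two product relations. *)
Lemma log_squeeze (R : realType) (k i kF iF N f b n bad : nat) :
  (0 < k)%N -> (0 < i)%N -> (0 < kF)%N -> (0 < iF)%N -> (0 < N)%N -> (0 < f)%N -> (0 < n)%N ->
  (k ^ f <= kF ^ n * N ^ (f * bad))%N -> (i ^ f <= iF ^ n * N ^ (f * bad))%N ->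
  (k * i = N ^ n)%N -> (kF * iF <= N ^ (f + b))%N ->
  `|ln k%:R / n%:R - ln kF%:R / f%:R| <= (b%:R / f%:R + bad%:R / n%:R) * ln N%:R :> R.
Proof.
move=> k0 i0 kF0 iF0 N0 f0 n0.
have lnMX (x y p q : nat) : (0 < x)%N -> (0 < y)%N ->
    ln ((x ^ p * y ^ q)%N%:R : R) = p%:R * ln x%:R + q%:R * ln y%:R.
  move=> x0 y0; rewrite natrM lnM ?posrE ?ltr0n ?expn_gt0 ?x0 ?y0// !natrX.
  by rewrite !lnXn ?ltr0n// ![_%:R * _]mulr_natl.
have le_ln (x y : nat) : (0 < x)%N -> (x <= y)%N -> ln (x%:R : R) <= ln y%:R.
  by move=> x0 xy; rewrite ler_ln ?posrE ?ltr0n ?(leq_trans x0 xy)// ler_nat.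
move=> /le_ln; rewrite expn_gt0 k0 => /(_ isT) h1.
move=> /le_ln; rewrite expn_gt0 i0 => /(_ isT) h2.
move=> /(congr1 (fun x => ln (x%:R : R))) h3.
move=> /le_ln; rewrite muln_gt0 kF0 iF0 => /(_ isT) h4.
have e1 (x p : nat) : (x ^ p = x ^ p * 1 ^ 0)%N by rewrite expn0 muln1.
have e2 (x y : nat) : (x * y = x ^ 1 * y ^ 1)%N by rewrite !expn1.
rewrite (e1 k f) !lnMX// in h1; rewrite (e1 i f) !lnMX// in h2.
rewrite (e2 k i) (e1 N n) !lnMX// in h3; rewrite (e2 kF iF) (e1 N (f + b)%N) !lnMX// in h4.
move: h1 h2 h3 h4; rewrite !mul0r !mul1r !addr0 natrM natrD.
set lk := ln k%:R; set li := ln i%:R; set lkF := ln kF%:R; set liF := ln iF%:R; set L := ln N%:R.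
move=> h1 h2 h3 h4.
have fp : 0 < f%:R :> R by rewrite ltr0n.
have np : 0 < n%:R :> R by rewrite ltr0n.
have fn0 : 0 < f%:R * n%:R :> R by rewrite mulr_gt0.
have -> : lk / n%:R - lkF / f%:R = (f%:R * lk - n%:R * lkF) / (f%:R * n%:R).
  by field; rewrite !gt_eqF.
have -> : (b%:R / f%:R + bad%:R / n%:R) * L = (n%:R * b%:R * L + f%:R * bad%:R * L) / (f%:R * n%:R).
  by field; rewrite !gt_eqF.
have h : 0 <= (f%:R * n%:R)^-1 :> R by rewrite invr_ge0 ltW.
rewrite normrM (ger0_norm h) ler_pM2r ?invr_gt0//.
have L0 : 0 <= L by rewrite ln_ge0// ler1n.
have bL : 0 <= n%:R * b%:R * L by rewrite !mulr_ge0.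
have h4' : n%:R * (lkF + liF) <= n%:R * ((f%:R + b%:R) * L) by rewrite ler_wpM2l.
have h3' : f%:R * (lk + li) = f%:R * (n%:R * L) by rewrite h3.
rewrite ler_norml; apply/andP; split; nra.
Qed.

Lemma card_has_le (T : finType) (U : eqType) (s : seq U) (P : U -> pred T) :
  (#|[pred x | has (fun u => P u x) s]| <= \sum_(u <- s) #|P u|)%N.
Proof.
elim: s => [|u s IHs]; first by rewrite big_nil /= eq_card0.
rewrite big_cons; apply: leq_trans (leq_add (leqnn _) IHs).
rewrite -cardUI; apply: leq_trans (leq_addr _ _).
by apply: subset_leq_card; apply/fintype.subsetP => x; rewrite !inE.
Qed.

Lemma seq_bounded (T : eqType) (s : seq T) (g : T -> nat) :
  exists r, forall x, x \in s -> (g x <= r)%N.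
Proof.
elim: s => [|x s [r IHs]]; first by exists 0%N.
exists (maxn (g x) r) => y; rewrite in_cons => /orP[/eqP->|/IHs h]; first exact: leq_maxl.
exact: leq_trans h (leq_maxr _ _).
Qed.

Section KernelLimit.
Variables (R : realType) (G : groupType) (S : {fset G}).
Notation F := (free_group S).
Hypothesis S_generates : forall g : G, exists w : F, free_eval w = g.
Hypothesis G_amenable : amenable G.
Variable K : fieldExtType rat.
Notation O := (ring_of_integers K).
Variable a : group_ring O F.

Definition bad_points r (X : finite_right_set F) : nat := #|[pred x : X | ~~ good_points r X x]|.

(** A point [f] outside the interior has some [w f] outside [Fo], that is, in the part of the
    symmetric difference that Foelner's condition makes small. *)
Lemma foelner_boundary (e : rat) : 0 < e ->
  exists2 Fo : {fset G}, (0 < #|{: Fo}|)%N &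
    (#|[pred f : Fo | ~~ interior a f]|)%:R <= (size (finsupp a))%:R * e * #|{: Fo}|%:R.
Proof.
move=> e0; have [Fo Fo0 FoE] := G_amenable [fset free_eval w | w in finsupp a]%fset e0.
exists Fo; first by rewrite -cardfE cardfs_gt0.
pose P (w : F) : pred Fo := fun f => (free_eval w * val f)%g \notin Fo.
have le1 : (#|[pred f : Fo | ~~ interior a f]| <= \sum_(w <- finsupp a) #|P w|)%N.
  apply: leq_trans (card_has_le _ P); apply: subset_leq_card.
  by apply/fintype.subsetP => f; rewrite !inE -has_predC.
apply: (@le_trans _ _ (\sum_(w <- finsupp a) #|P w|)%:R); first by rewrite ler_nat.
rewrite natr_sum -mulrA [leRHS]mulr_natl.
apply: (@le_trans _ _ (\sum_(w <- finsupp a) e * #|{: Fo}|%:R)); last first.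
  by rewrite big_const_seq count_predT iter_addr_0.
rewrite big_seq [leRHS]big_seq; apply: ler_sum => w ws.
have wE : free_eval w \in [fset free_eval w | w in finsupp a]%fset by apply/imfsetP; exists w.
have /= le := FoE _ wE.
rewrite -cardfE; apply: le_trans le; rewrite ler_nat cardE.
rewrite -(size_map (fun f : Fo => (free_eval w * val f)%g)); apply: uniq_leq_size.
  by rewrite map_inj_uniq ?enum_uniq// => f g /mulgI/val_inj.
move=> _ /mapP[f + ->]; rewrite mem_enum => fP.
rewrite in_fsetU !in_fsetD; apply/orP; right; apply/andP; split=> //.
by apply/imfsetP; exists (val f) => //; exact: fsvalP.
Qed.

Lemma kernel_limit (J : ideal O) (eps : R) : J != ideal0 O -> 0 < eps ->
  exists (r : nat) (eta c : R), 0 < eta /\ forall X : finite_right_set F,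
    (0 < #|{: X}|)%N -> (bad_points r X)%:R <= eta * #|{: X}|%:R ->
    `|ln (idx (@kerJ K F X a J) (zeroJ J))%:R / #|{: X}|%:R - c| <= eps.
Proof.
move=> J0 eps0; set L : R := ln (N J)%:R.
have L0 : 0 <= L by rewrite ln_ge0// ler1n N_gt0.
(* With Foelner tolerance [1 / k.+1] the boundary costs at most [eps / 2]. *)
pose k := Num.bound (2 * (size (finsupp a))%:R * L / eps).
have kE : 2 * (size (finsupp a))%:R * L / eps < k.+1%:R.
  apply: lt_trans (archi_boundP _) _; last by rewrite ltr_nat.
  by rewrite !mulr_ge0// invr_ge0 ltW.
have [|Fo Fo0 Fob] := @foelner_boundary (k.+1%:R^-1); first by rewrite invr_gt0 ltr0n.
have [r1 r1P] := seq_bounded [seq (f, w) | f <- enum {: Fo}, w <- finsupp a]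
  (fun fw => size (word fw.2) + size (word (lift S_generates (val fw.1))) +
             size (word (lift S_generates (free_eval fw.2 * val fw.1)%g)))%N.
have [r2 r2P] := seq_bounded (enum {: Fo}) (fun f => size (word (lift S_generates (val f)))).
pose r := (r1 + (r2 + r2))%N.
have rl (f : Fo) (w : F) : w \in finsupp a ->
  (size (word w) + size (word (lift S_generates (val f))) +
     size (word (lift S_generates (free_eval w * val f)%g)) <= r)%N.
  move=> ws; apply: leq_trans (leq_addr _ _); apply: (r1P (f, w)).
  by apply/allpairsP; exists (f, w); rewrite mem_enum.
have rl2 (f f' : Fo) : (size (word (lift S_generates (val f))) + size (word (lift S_generates (val f'))) <= r)%N.
  by apply: leq_trans (leq_addl _ _); apply: leq_add; apply: r2P; rewrite mem_enum.
have [fk fi lekF] := local_counts a Fo J0.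
(* This tolerance makes the bad points cost at most [eps / 2]; the summand 1 covers [L = 0], which
   occurs for [J = O]. The limit is approximated by the local density on [Fo]. *)
exists r, (eps / (2 * (L + 1))), (ln (idx (locker a (Fo := Fo) J) (pointwise (iset J : set O^o) (predT : pred Fo)))%:R / #|{: Fo}|%:R).
have L1 : 0 < 2 * (L + 1) by lra.
split=> [|X X0 badX]; first by rewrite divr_gt0.
have [fK fI EKI] := ker_image_counts a X J0.
apply: le_trans (log_squeeze R _ _ _ _ _ Fo0 X0 (shearer_kerJ X rl rl2 J0) (shearer_image X rl rl2 J0) EKI lekF) _.
- by apply: idx_gt0 fK; exists 0; exact: subgroup0 (subgroup_kerJ _ _ _).
- by apply: idx_gt0 fI; exists 0; exact: subgroup0 (subgroup_imset_conv _ _).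
- by apply: idx_gt0 fk; exists 0; exact: subgroup0 (subgroup_locker _ _ _).
- by apply: idx_gt0 fi; exists 0; exact: subgroup0 (subgroup_locim _ _).
- exact: N_gt0.
rewrite -/L mulrDl.
set b := #|[pred f : Fo | ~~ interior a f]| in Fob *.
set s := size (finsupp a) in Fob kE.
have Fob' : (k.+1 * b <= s * #|{: Fo}|)%N.
  rewrite -(ler_nat rat) !natrM mulrC -ler_pdivlMr ?ltr0n//.
  by apply: le_trans Fob _; rewrite mulrAC.
have f0 : 0 < #|{: Fo}|%:R :> R by rewrite ltr0n.
have x0 : 0 < #|{: X}|%:R :> R by rewrite ltr0n.
have h1 : b%:R / #|{: Fo}|%:R * L <= eps / 2.
  rewrite mulrAC ler_pdivrMr//.
  have k0 : 0 < k.+1%:R :> R by rewrite ltr0n.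
  rewrite -(ler_pM2l k0).
  have : k.+1%:R * b%:R * L <= s%:R * #|{: Fo}|%:R * L.
    by rewrite ler_wpM2r// -!natrM ler_nat.
  move: kE; rewrite ltr_pdivrMr// => kE'.
  have : #|{: Fo}|%:R * (2 * s%:R * L) <= #|{: Fo}|%:R * (k.+1%:R * eps) by rewrite ler_wpM2l// ltW.
  lra.
have h2 : (bad_points r X)%:R / #|{: X}|%:R * L <= eps / 2.
  apply: (@le_trans _ _ (eps / (2 * (L + 1)) * L)).
    by rewrite ler_wpM2r// ler_pdivrMr.
  rewrite mulrAC ler_pdivrMr//; nra.
rewrite /bad_points in h2; lra.
Qed.

End KernelLimit.

(** * Torsion grows at most exponentially *)

(** The columns of a matrix whose rows span the kernel have rank [n - \rank A]; a maximal
    independent set of columns gives coordinates that determine a kernel vector. *)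
Lemma kernel_coordinates (K : fieldType) n (A : 'M[K]_n) :
  exists h : 'I_(n - \rank A) -> 'I_n, forall z : 'rV[K]_n,
    z *m A = 0 -> (forall i, z ord0 (h i) = 0) -> z = 0.
Proof.
pose k := (kermx A)^T.
have rk : \rank k = (n - \rank A)%N by rewrite mxrank_tr mxrank_ker.
rewrite -rk; exists (maxrankfun k) => z /sub_kermxP/submxP[c zE] zh.
have /submxP[D kE] : (k <= rowsub (maxrankfun k) k)%MS by rewrite (eq_maxrowsub k).
apply: trmx_inj; rewrite zE trmx_mul -/k kE -mulmxA.
have -> : rowsub (maxrankfun k) k *m c^T = 0.
  apply/matrixP => i j; rewrite ord1 [RHS]mxE -(zh i) zE !mxE.
  by apply: eq_bigr => l _; rewrite !mxE mulrC.
by rewrite mulmx0 trmx0.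
Qed.

Section TorsionBound.
Variables (K : fieldExtType rat) (F : groupType).
Notation O := (ring_of_integers K).
Variable a : group_ring O F.

(** Lifts of elements spanning the quotient up to torsion, together with the image, span K^X, so the
    rank of the image and [d.2] add up to at least [#|X|]. *)
Lemma kernel_rank_le (X : finite_right_set F) d :
  has_invariants (quotient_module (rconv_image X a)) d -> (#|X| - \rank (conv_mx X a) <= d.2)%N.
Proof.
move=> /rank_le_invariants[Y [e [<- eP]]].
have /choice[t tE] : forall i, exists v, pi_quot (rconv_image X a) v = e i by move=> i; exact: pi_quot_surj.
pose E : 'M[K]_(#|Y|, #|X|) := \matrix_(i, j) rv (t (enum_val i)) ord0 j.
rewrite leq_subLR; apply: leq_trans (_ : \rank (conv_mx X a + E)%MS <= _)%N; last first.
  apply: leq_trans (leq_of_leqif (mxrank_adds_leqif _ _)) _.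
  by rewrite leq_add2l rank_leq_row.
rewrite -[leqLHS](mxrank1 K); apply: mxrankS; apply/row_subP => i.
pose x := enum_val i; have [c c0 [cs cE]] := eP (pi_quot (rconv_image X a) (dlt K x)).
have c0' : int_val c != 0 by rewrite int_val_eq0.
have -> : row i 1%:M = rv (dlt K x).
  apply/rowP => j; rewrite !mxE ffunE (inj_eq enum_val_inj) eq_sym.
  by rewrite -[RHS]/(int_val _) rmorph_nat.
rewrite -(eqmx_scale _ c0') -rvZ.
pose L := mk_linear (@pi_quot_linear _ _ (rconv_image X a)).
have LE v : L v = pi_quot (rconv_image X a) v by [].
have : L (c *: dlt K x) = L (\sum_i cs i *: t i).
  have -> : L (c *: dlt K x) = c *: pi_quot (rconv_image X a) (dlt K x) by exact: linearZ.
  rewrite cE linear_sum; apply: eq_bigr => j _.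
  by rewrite -[e j]tE; apply/esym; exact: linearZ.
move=> /pi_quot_eq/rconv_imageP[u uE].
have -> : c *: dlt K x = rconv a u + \sum_i cs i *: t i by rewrite -uE subrK.
have rvD v w : rv (v + w) = rv v + rv w :> 'rV[K]_#|X|.
  by apply/rowP => j; rewrite !mxE -int_valD; congr int_val; rewrite [LHS]ffunE.
have rvS (Z : finType) (f : Z -> {ffun X -> O^o}) : rv (\sum_i f i) = \sum_i rv (f i).
  apply: (big_morph _ rvD); apply/rowP => j; rewrite !mxE ffunE; exact: rmorph0.
rewrite rvD addmx_sub_adds//; first by rewrite rv_rconv submxMl.
rewrite rvS summx_sub// => y _; rewrite rvZ scalemx_sub//.
have -> : rv (t y) = row (enum_rank y) E; last exact: row_sub.
by apply/rowP => j; rewrite !mxE enum_rankK.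
Qed.

Lemma nat_in_ideal (J : ideal O) : J != ideal0 O -> exists2 m : nat, (0 < m)%N & (m%:R : O) \in J.
Proof.
move=> /ideal0P[x Jx x0]; have x0' : int_val x != 0 by rewrite int_val_eq0.
have [D D0 DE] := integral_multiple (int_val x)^-1; exists D => //.
suff -> : D%:R = to_int (D%:R * (int_val x)^-1) * x by exact: idealZl.
by apply: int_val_inj; rewrite int_valM to_intK// divfK// rmorph_nat.
Qed.

Lemma nat_principal_neq0 m : (0 < m)%N -> principal (m%:R : O) != ideal0 O.
Proof.
move=> m0; apply: ideal_neq0 (mem_principal _) _.
by rewrite -int_val_eq0 rmorph_nat nat_eq0 -lt0n.
Qed.

Lemma N_principalM s m : (0 < s)%N -> (0 < m)%N ->
  N (principal ((s * m)%:R : O)) = (N (principal (s%:R : O)) * N (principal (m%:R : O)))%N.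
Proof.
move=> s0 m0; have sub x : x \in principal ((s * m)%:R : O) -> x \in principal (m%:R : O).
  by move=> /principalP[c ->]; apply/principalP; exists (c * s%:R); rewrite natrM mulrA.
rewrite (N_mul sub); last by apply: nat_principal_neq0; rewrite muln_gt0 s0.
rewrite mulnC; congr muln; rewrite -(@idx_ideal_mul _ (principal (s%:R : O)) (principal (m%:R : O))) ?nat_principal_neq0//.
congr (idx _ (iset _)); apply: ideal_ext => x; split.
  move=> /principalP[c ->]; rewrite natrM mulrA; apply: mem_ideal_mul; first by apply/principalP; exists c.
  exact: mem_principal.
apply: ideal_mul_le => u b /principalP[c ->] /principalP[c' ->]; apply/principalP.
by exists (c * c'); rewrite natrM; ring.
Qed.

(* The representatives of [O/mO] can be chosen in a box of size [O(m)]. *)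
Lemma small_representatives : exists2 B : rat, 0 <= B & forall (m : nat) (x : O), (0 < m)%N ->
  exists2 y : O, x - y \in principal (m%:R : O) & nrm (int_val y) <= m%:R * B.
Proof.
have [D D0 De] := integral_multiples (fun i : 'I_(\dim {:K}) => (vbasis {:K})`_i).
exists ((\dim {:K})%:R * D%:R); first by rewrite mulr_ge0.
move=> m x m0; have mD0 : 0 < (m * D)%:R :> rat by rewrite ltr0n muln_gt0 m0.
pose k i : int := Num.floor (crd i (int_val x) / (m * D)%:R).
pose c : O := \sum_i (k i)%:~R * to_int (D%:R * (vbasis {:K})`_i).
exists (x - c * m%:R); first by rewrite opprB addrC subrK; apply/principalP; exists c.
have cE : int_val c = \sum_j ((k j)%:~R * D%:R) *: (vbasis {:K})`_j.
  rewrite int_val_sum; apply: eq_bigr => j _; rewrite int_valM rmorph_int to_intK//.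
  by rewrite -scalerA scaler_int scaler_nat mulrzl mulr_natl.
have E i : crd i (int_val (x - c * m%:R)) = crd i (int_val x) - (k i)%:~R * (m * D)%:R.
  rewrite int_valB int_valM rmorph_nat crdB mulr_natr -scaler_nat crdZ cE crd_comb.
  by rewrite natrM; ring.
have -> : m%:R * ((\dim {:K})%:R * D%:R) = \sum_(i < \dim {:K}) (m * D)%:R :> rat.
  by rewrite sumr_const card_ord -[RHS]mulr_natl natrM mulrCA.
apply: ler_sum => i _; rewrite E; have /andP[le lt] := floor_itv (crd i (int_val x) / (m * D)%:R).
rewrite -/(k i) in le lt; rewrite ler_pdivlMr// in le; rewrite ltr_pdivrMr// intrD mulrDl mul1r in lt.
by rewrite ger0_norm ?subr_ge0// lerBlDl ltW.
Qed.

Lemma class_of_nat (s : nat) : (0 < s)%N -> exists (T : finType) (f : O -> T),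
  #|T| = N (principal (s%:R : O)) /\
  forall x y : O, f x = f y -> exists t : O, int_val x - int_val y = s%:R * int_val t.
Proof.
move=> s0; have /idxP[T [f [Tn _ fP]]] := finite_ideal (nat_principal_neq0 s0).
exists T, f; split=> // x y /fP => /(_ Logic.I Logic.I)/principalP[t tE]; exists t.
by rewrite -int_valB tE int_valM rmorph_nat mulrC.
Qed.

Lemma small_multiple (s : nat) (x : K) (t : O) (B : rat) : nrm x <= B ->
  2 * nrm_const K * B < s%:R -> x = s%:R * int_val t -> x = 0.
Proof.
move=> xB Bs xE; have c1 := nrm_const_ge1 K.
have s0 : 0 < (s%:R : rat).
  apply: le_lt_trans Bs; rewrite !mulr_ge0//; first by apply: le_trans c1.
  by apply: le_trans xB; exact: nrm_ge0.
suff t0 : int_val t = 0 by rewrite xE t0 mulr0.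
apply: integral_discrete; first exact: int_valP.
have tE : nrm x = s%:R * nrm (int_val t) by rewrite xE mulr_natl -scaler_nat nrmZ normr_nat.
rewrite -(ltr_pM2l s0) mulr1; apply: le_lt_trans Bs.
by rewrite mulrCA -tE; apply: ler_wpM2l => //; rewrite mulr_ge0//; apply: le_trans c1.
Qed.

Lemma nrm_rconv (X : finite_right_set F) (v : {ffun X -> O^o}) (B : rat) y :
  (forall x, nrm (int_val (v x : O)) <= B) ->
  nrm (int_val (rconv a v y : O)) <=
    (nrm_const K * \sum_(w <- finsupp a) nrm (int_val (a w))) * B.
Proof.
move=> vB; rewrite (_ : (rconv a v y : O) = \sum_(w <- finsupp a) (v (ract y (w^-1)%g) : O) * a w); last first.
  rewrite ffunE; apply: eq_bigr => w _; rewrite (big_pred1 (ract y (w^-1)%g))// => x /=.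
  by apply/eqP/eqP => [<-|->]; rewrite -ractM ?mulgV ?mulVg ract1.
rewrite int_val_sum; apply: le_trans (nrm_sum _ _ _) _.
rewrite mulr_sumr mulr_suml; apply: ler_sum => w _; rewrite int_valM.
have c0 : 0 <= nrm_const K by apply: le_trans (nrm_const_ge1 K).
apply: le_trans (nrmM _ _) _; rewrite -mulrA ler_wpM2l// mulrC ler_wpM2l ?nrm_ge0//.
Qed.

(** For [J = (m)] with [m] killing all torsion, the kernel index is the wanted product times
    [N J ^ r]. It is bounded by colouring. Reduce [v] modulo [m] to size O(m); then [a v = m y] with
    [y] bounded, so a fixed modulus [s1] determines [y]. Vectors with the same [y] differ by exact
    kernel vectors of size O(m), determined by at most [r] coordinates modulo [s2 * m]. The
    resulting factor [N J ^ r] cancels, and what is left has a base independent of [m]. *)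
Lemma torsion_bound : exists2 C : nat, (0 < C)%N & forall (X : finite_right_set F) d,
  has_invariants (quotient_module (rconv_image X a)) d -> (\prod_(I <- d.1) N I <= C ^ #|X|)%N.
Proof.
have [B B0 redP] := small_representatives.
have c0 : 0 <= nrm_const K by apply: le_trans (nrm_const_ge1 K).
have [A A0 AE] : exists2 A : rat, 0 <= A & nrm_const K * \sum_(w <- finsupp a) nrm (int_val (a w)) = A.
  by eexists; last reflexivity; rewrite mulr_ge0// sumr_ge0// => w _; exact: nrm_ge0.
have above (b : rat) : 0 <= b -> exists2 s : nat, (0 < s)%N & b < s%:R.
  move=> b0; exists (Num.bound b).+1 => //.
  by apply: lt_trans (archi_boundP b0) _; rewrite ltr_nat.
(* Two vectors [y], each of norm at most [A * B], are to be separated modulo [s1]. *)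
have [|s1 s10 s1P] := above (2 * nrm_const K * (2 * (A * B))); first by rewrite !mulr_ge0.
(* Two kernel vectors [z], each a difference of two reduced vectors and so of norm at most [2 m B],
   are to be separated modulo [s2 * m]. *)
have [|s2 s20 s2P] := above (2 * nrm_const K * (4 * B)); first by rewrite !mulr_ge0.
pose N1 := N (principal (s1%:R : O)); pose N2 := N (principal (s2%:R : O)).
have N10 : (0 < N1)%N by apply/N_gt0/nat_principal_neq0.
have N20 : (0 < N2)%N by apply/N_gt0/nat_principal_neq0.
exists (N1 * N2)%N; first by rewrite muln_gt0 N10.
move=> X d inv.
(* With [m] in every torsion ideal [I], the ideals [I + (m)] in the kernel count are the [I]
   themselves. *)
have [m m0 mI] : exists2 m : nat, (0 < m)%N & forall I, I \in d.1 -> (m%:R : O) \in I.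
  move: inv; case: d => Is r [Is01 _ _] /=.
  elim: Is Is01 => [|I Is IHs] Is01; first by exists 1%N.
  have [|m m0 mP] := IHs; first by move=> J JIs; apply: Is01; rewrite in_cons JIs orbT.
  have [k k0 kP] := nat_in_ideal (Is01 I (mem_head _ _)).1.
  exists (k * m)%N => [|J]; first by rewrite muln_gt0 k0.
  rewrite in_cons natrM => /orP[/eqP->|/mP]; [exact: idealZr | exact: idealZl].
pose J := principal (m%:R : O); have J0 : J != ideal0 O by exact: nat_principal_neq0.
have := index_kerJ J0 inv.
have -> : (\prod_(I <- d.1) N (ideal_add I J) = \prod_(I <- d.1) N I)%N.
  rewrite big_seq [RHS]big_seq; apply: eq_bigr => I Id; congr N; apply: ideal_ext => x; split.
    move=> /ideal_addP[y [z [Iy /principalP[c ->] ->]]]; apply: idealD => //.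
    by apply: idealZl; exact: mI.
  exact: ideal_addl.
move=> /is_indexE ind.
have [h hP] := kernel_coordinates (conv_mx X a).
have [T1 [f1 [T1n f1P]]] := class_of_nat s10.
have sm0 : (0 < s2 * m)%N by rewrite muln_gt0 s20.
have [T2 [f2 [T2n f2P]]] := class_of_nat sm0.
have m0' : (m%:R : K) != 0 by rewrite nat_eq0 -lt0n.
have mQ : 0 < (m%:R : rat) by rewrite ltr0n.
have /choice[red redE] : forall x : O, exists y : O, x - y \in J /\ nrm (int_val y) <= m%:R * B.
  by move=> x; have [y] := redP m x m0; exists y.
pose redv (v : {ffun X -> O^o}) : {ffun X -> O^o} := [ffun x => (red (v x) : O^o)].
have redvE v x : (redv v x : O) = red (v x) by rewrite ffunE.
have redvJ v : zeroJ J (v - redv v).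
  by move=> x _; rewrite /iset (subE v (redv v)) redvE; have [] := redE (v x).
have redvB v x : nrm (int_val (redv v x : O)) <= m%:R * B.
  by rewrite redvE; have [] := redE (v x).
have sK := @subgroup_kerJ K F X a J.
have redvK v : kerJ a J v -> kerJ a J (redv v).
  move=> kv; have -> : redv v = v - (v - redv v) by rewrite opprB addrC subrK.
  by apply: (subgroupB sK kv); apply: zeroJ_sub_kerJ; exact: redvJ.
have /choice[Y YE] : forall v : {ffun X -> O^o}, exists y : X -> O,
    kerJ a J v -> forall x, int_val (rconv a (redv v) x : O) = m%:R * int_val (y x).
  move=> v; have [kv|] := pselect (kerJ a J v); last by exists (fun=> 0).
  have /choice[y yE] x : exists y : O, int_val (rconv a (redv v) x : O) = m%:R * int_val y.
    have /principalP[c ->] := redvK v kv x; exists c.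
    by rewrite int_valM rmorph_nat mulrC.
  by exists y.
pose col1 v : {ffun X -> T1} := [ffun x => f1 (Y v x)].
pose base k : {ffun X -> O^o} := xget 0 [set v | kerJ a J v /\ col1 v = k].
have baseP v : kerJ a J v -> kerJ a J (base (col1 v)) /\ col1 (base (col1 v)) = col1 v.
  move=> kv; suff [] : [set u | kerJ a J u /\ col1 u = col1 v] (base (col1 v)) by [].
  by apply: xgetPex; exists v.
(* Vectors of the same first colour have the same image, exactly. *)
have same v u : kerJ a J v -> kerJ a J u -> col1 v = col1 u ->
    rconv a (redv v - redv u) = 0.
  move=> kv ku /ffunP E; apply/ffunP => x; rewrite [RHS]ffunE linearB.
  apply: int_val_inj; rewrite (subE (rconv a (redv v))) int_valB !YE// -mulrBr [RHS]rmorph0.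
  have := E x; rewrite !ffunE => /f1P[t tE].
  have -> : int_val (Y v x) - int_val (Y u x) = 0; last by rewrite mulr0.
  have bnd w : kerJ a J w -> nrm (int_val (Y w x)) <= A * B.
    move=> kw; have := nrm_rconv x (redvB w); rewrite YE// mulr_natl -scaler_nat nrmZ normr_nat.
    by rewrite AE mulrCA ler_pM2l.
  apply: (small_multiple (B := 2 * (A * B)) _ s1P tE).
  by apply: le_trans (nrmB _ _) _; rewrite mulr_natl mulr2n lerD// bnd.
(* Subtracting a fixed vector of the same first colour turns a reduced vector into an exact kernel
   vector. *)
pose z v := redv v - redv (base (col1 v)).
pose col2 v : {ffun 'I_(#|X| - \rank (conv_mx X a)) -> T2} := [ffun i => f2 (z v (enum_val (h i)) : O)].
have zB v x : nrm (int_val (z v x : O)) <= 2 * (m%:R * B).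
  rewrite (subE (redv v)) int_valB; apply: le_trans (nrmB _ _) _.
  by rewrite mulr_natl mulr2n lerD.
have sZ := @subgroup_zeroJ K F X J.
have [v u kv ku [E1 /ffunP E2]|n hn le] := @index_sep _ (kerJ a J) (zeroJ J) _ (fun v => (col1 v, col2 v)) (subgroup0 sK) sZ.
  have zE : z v - z u = redv v - redv u by rewrite /z E1 opprB addrA subrK.
  have zK : rv (z v - z u) *m conv_mx X a = 0.
    rewrite -rv_rconv zE same//; apply/rowP => j; rewrite !mxE ffunE; exact: rmorph0.
  have z0 : rv (z v - z u) = 0.
    apply: hP => // i; rewrite mxE (subE (z v)) int_valB.
    have := E2 i; rewrite [col2 v i]ffunE [col2 u i]ffunE => /f2P[t tE].
    apply: (small_multiple (B := 4 * (m%:R * B)) _ _ tE).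
      apply: le_trans (nrmB _ _) _; apply: le_trans (lerD (zB _ _) (zB _ _)) _.
      by rewrite -mulrDl -natrD.
    by rewrite natrM; move: s2P; rewrite -(ltr_pM2r mQ); apply: le_lt_trans; lra.
  have vu : redv v = redv u.
    apply/eqP; rewrite -subr_eq0 -zE; apply/eqP/rv_inj; rewrite z0.
    by apply/rowP => j; rewrite !mxE ffunE; apply/esym; exact: rmorph0.
  have -> : v - u = (v - redv v) - (u - redv u) by rewrite vu opprB addrA subrK.
  exact: (subgroupB sZ).
move: le; rewrite -(is_indexE hn) ind card_prod !card_ffun card_ord T1n T2n => le.
have Nm0 : (0 < N J ^ d.2)%N by rewrite expn_gt0 N_gt0.
rewrite -(leq_pmul2r Nm0); apply: leq_trans le _.
rewrite N_principalM// -/N2 -/J -/N1 (expnMn N1) -mulnA leq_mul2l; apply/orP; right.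
rewrite (expnMn N2).
exact: leq_mul (leq_pexp2l N20 (leq_subr _ _)) (leq_pexp2l (N_gt0 J0) (kernel_rank_le inv)).
Qed.

End TorsionBound.

(** * The spectrum of a finite action *)

Section Spectrum.
Variables (R : realType) (K : fieldExtType rat) (F : groupType).
Notation O := (ring_of_integers K).
Variable a : group_ring O F.
Implicit Types (I J : ideal O).

Definition sub_ideal I J := forall x : O, x \in I -> x \in J.

Definition comparable_ideals (l : seq (ideal O)) :=
  forall I J, I \in l -> J \in l -> sub_ideal I J \/ sub_ideal J I.

Definition cnt (Omega : set (ideal O)) (l : seq (ideal O)) : nat := count (fun I => `[< Omega I >]) l.

Notation contains := (fun I I' : ideal O => `[< {subset I' <= I} >]).

Lemma contains_trans : transitive contains.
Proof. by move=> J I I' /asboolP h /asboolP h'; apply/asboolP => x /h'/h. Qed.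

Lemma comparable_sorted (l : seq (ideal O)) : sorted contains l -> comparable_ideals l.
Proof.
rewrite sorted_pairwise; last exact: contains_trans.
elim: l => [_ I J|I l IHl /= /andP[/allP Il /IHl h] J J'] //.
rewrite !in_cons => /orP[/eqP->|Jl] /orP[/eqP->|J'l].
- by left.
- by right; apply/asboolP; exact: Il.
- by left; apply/asboolP; exact: Il.
exact: h.
Qed.

(** For a proper non-zero [J] containing all torsion ideals, namely the largest of them if there is
    one, every summand has [N J] elements modulo [J]. So [N J] to the number of summands is at most
    [N J ^ #|X|], and the truncated subtraction in the measure is exact. *)
Lemma card_invariants_le (X : finite_right_set F) Is r :
  has_invariants (quotient_module (rconv_image X a)) (Is, r) -> (size Is + r <= #|X|)%N.
Proof.
move=> inv; have [Is01 Iss _] := inv.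
have [J J0 [J1 JIs]] : exists2 J, J != ideal0 O & (1 < N J)%N /\ forall I, I \in Is -> sub_ideal I J.
  case: Is Is01 Iss {inv} => [|J Is] Is01 Iss.
    by have [J J0 J1] := N_unbounded K 1; exists J.
  have [J0 J1] := Is01 J (mem_head _ _).
  exists J => //; split; first exact: N_gt1.
  move=> I; rewrite in_cons => /orP[/eqP->//|IIs].
  by have /allP/(_ I IIs)/asboolP := order_path_min contains_trans Iss.
have E : \prod_(I <- Is) N (ideal_add I J) = (N J ^ size Is)%N.
  have -> : \prod_(I <- Is) N (ideal_add I J) = (\prod_(I <- Is) N J)%N.
    rewrite big_seq [RHS]big_seq; apply: eq_bigr => I IIs; congr N; apply: ideal_ext => x; split.
      by move=> /ideal_addP[y [z [Iy Jz ->]]]; apply: idealD => //; exact: JIs IIs _ Iy.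
    exact: ideal_addr.
  by rewrite big_const_seq count_predT iter_muln_1.
have := index_kerJ J0 inv; rewrite /= E -expnD => ind.
have sK := @subgroup_kerJ K F X a J; have sZ := @subgroup_zeroJ K F X J.
have iz := @index_zeroJ K F X J J0.
have [_] := @idx_le_sub _ (kerJ a J) (zeroJ J) setT (zeroJ J) (subgroup0 sK) sZ (ex_intro _ _ iz) (@subsetT _ _) (fun _ _ h => h) sK.
by rewrite (is_indexE ind) (is_indexE iz) leq_exp2l.
Qed.

(** The list contains O with multiplicity [s], the torsion ideals, and 0 with multiplicity [r].
    Since [N (O + J) = 1] and [N (0 + J) = N J], the kernel count becomes a sum over this one
    list. *)
Lemma spectrum (C : nat) : (0 < C)%N -> (forall (X : finite_right_set F) d,
    has_invariants (quotient_module (rconv_image X a)) d -> (\prod_(I <- d.1) N I <= C ^ #|X|)%N) ->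
  forall X : finite_right_set F, exists l : seq (ideal O),
  [/\ size l = #|X|, comparable_ideals l,
      forall Omega, nu R X a Omega = ((cnt Omega l)%:R / #|X|%:R)%:E,
      forall J, J != ideal0 O -> \sum_(I <- l) ln ((N (ideal_add I J))%:R : R) =
        ln (idx (@kerJ K F X a J) (zeroJ J))%:R &
      \sum_(I <- l | I != ideal0 O) ln ((N I)%:R : R) <= ln C%:R * #|X|%:R].
Proof.
move=> C0 CP X; rewrite /nu; case: pselect => [h|/(_ (has_invariants_rconv X a))//].
case: cid => -[Is r] inv /=; have le := card_invariants_le inv.
have [Is01 Iss _] := inv.
set s := (#|X| - size Is - r)%N.
pose l := nseq s (ideal1 O) ++ Is ++ nseq r (ideal0 O).
have ln1 : ln (1 : R) = 0 by exact: ln1.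
have ln_pos (m : nat) : (0 < m)%N -> (m%:R : R) \is Num.pos by move=> m0; rewrite posrE ltr0n.
exists l; split.
- by rewrite !size_cat !size_nseq /s -subnDA subnK.
- have Isc := comparable_sorted Iss.
  have one I : sub_ideal I (ideal1 O) by [].
  have zero I : sub_ideal (ideal0 O) I by move=> x; rewrite mem_ideal0 => /eqP->; exact: ideal_0.
  move=> I J; rewrite !mem_cat !mem_nseq.
  move=> /or3P[/andP[_ /eqP->]|Il|/andP[_ /eqP->]]; [by right| |by left].
  by move=> /or3P[/andP[_ /eqP->]|Jl|/andP[_ /eqP->]]; [left|exact: Isc|right].
- move=> Omega; rewrite invariant_measureE /cnt !count_cat !count_nseq.
  have E I : \d_I Omega = ((`[< Omega I >] : nat)%:R : R)%:E :> \bar R.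
    rewrite diracE; suff -> : (I \in Omega) = `[< Omega I >] by [].
    by apply/idP/asboolP => [/set_mem|/mem_set].
  rewrite !E; under eq_bigr do rewrite E.
  have -> : (\sum_(I <- Is) ((`[< Omega I >] : nat)%:R : R)%:E)%E = ((count (fun I => `[< Omega I >]) Is)%:R)%:E.
    rewrite sumEFin -natr_sum -sum1_count [X in _ = (X%:R)%:E]big_mkcond.
    by congr (_%:R)%:E; apply: eq_bigr => I _; case: `[< _ >].
  rewrite [LHS](_ : _ = (#|X|%:R^-1 * (s%:R * (`[< Omega (ideal1 O) >] : nat)%:R +
    ((count (fun I => `[< Omega I >]) Is)%:R + r%:R * (`[< Omega (ideal0 O) >] : nat)%:R)))%:E)//.
  congr EFin.
  by rewrite mulrC !natrD !natrM; congr (_ / _); rewrite mulrC [r%:R * _]mulrC.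
- move=> J J0; rewrite (is_indexE (index_kerJ J0 inv)) /= natrM natrX.
  have Npos I : (0 < N (ideal_add I J))%N.
    by apply: N_gt0; have [x Jx x0] := ideal0P J0; apply: ideal_neq0 x0; exact: ideal_addr.
  have add1 : ideal_add (ideal1 O) J = ideal1 O by apply: ideal1P; exact: ideal_addl.
  have add0 : ideal_add (ideal0 O) J = J.
    apply: ideal_ext => x; split=> [|Jx]; last exact: ideal_addr.
    by move=> /ideal_addP[y [z [+ Jz ->]]]; rewrite mem_ideal0 => /eqP->; rewrite add0r.
  rewrite !big_cat /= !big_nseq add1 add0 N_ideal1 ln1 !iter_addr_0 mul0rn add0r.
  have prodpos : 0 < (\prod_(I <- Is) N (ideal_add I J))%N%:R :> R.
    by rewrite ltr0n prodn_cond_gt0.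
  have NJpos : 0 < (N J)%:R :> R by rewrite ltr0n N_gt0.
  have NJrpos : 0 < (N J)%:R ^+ r :> R by exact: exprn_gt0.
  rewrite (lnM prodpos NJrpos) (lnXn _ NJpos); congr (_ + _).
  elim: Is {prodpos le inv Is01 Iss s l} => [|I Is IHs]; first by rewrite !big_nil ln1.
  by rewrite !big_cons natrM lnM ?IHs ?ln_pos// ?Npos// prodn_cond_gt0.
rewrite !big_cat /= [X in _ + (_ + X)]big1_seq ?addr0; last first.
  by move=> I; rewrite mem_nseq => /andP[I0 /andP[_ /eqP E]]; rewrite E eqxx in I0.
rewrite [X in X + _]big1_seq ?add0r; last first.
  by move=> I; rewrite mem_nseq => /andP[_ /andP[_ /eqP ->]]; rewrite N_ideal1 ln1.
have := CP X _ inv; rewrite /= -(ler_nat R) natrX => leC.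
have prodpos : (0 < \prod_(I <- Is) N I)%N.
  rewrite big_seq prodn_cond_gt0// => I /Is01[I0 _]; exact: N_gt0.
rewrite [_ * #|X|%:R]mulr_natr -lnXn ?ltr0n//.
apply: (@le_trans _ _ (ln (\prod_(I <- Is) N I)%N%:R)); last first.
  by rewrite ler_ln ?posrE ?ltr0n// exprn_gt0 ?ltr0n.
rewrite big_mkcond /=.
elim: Is Is01 {le inv Iss s l leC prodpos} => [|I Is IHs] Is01; first by rewrite !big_nil ln1.
have [I0 _] := Is01 I (mem_head _ _).
have {}h J : J \in Is -> J != ideal0 O /\ J != ideal1 O by move=> JIs; apply: Is01; rewrite in_cons JIs orbT.
rewrite !big_cons I0 natrM lnM ?lerD2l ?IHs// ln_pos ?N_gt0//.
by rewrite big_seq prodn_cond_gt0// => J /h[J0 _]; exact: N_gt0.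
Qed.

End Spectrum.

(** * Functionals converging along decreasing stages *)

(* Stages are predicates: the finite right sets, to which this is applied, are
   too large for the universe of [set]. *)
Section Settling.
Variables (R : realType) (T : Type) (stage : nat -> T -> Prop) (dom : T -> Prop).
Hypothesis stage_mono : forall m n x, (m <= n)%N -> stage n x -> stage m x.
Hypothesis stage_dom : forall n x, stage n x -> dom x.
Implicit Types u v : T -> R.

(** A Cauchy condition: the centre [c] may change with [e]. It passes to uniform approximations
    without a limit being at hand. *)
Definition settles u := forall e : R, 0 < e ->
  exists n c, forall x, stage n x -> `|u x - c| <= e.

Lemma settles_approx u : (forall e, 0 < e ->
  exists2 v, settles v & forall x, dom x -> `|u x - v x| <= e) -> settles u.
Proof.
move=> h e e0; have [v vS uv] := h (e / 2) (divr_gt0 e0 (ltr0n _ 2)).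
have [n [c vc]] := vS (e / 2) (divr_gt0 e0 (ltr0n _ 2)).
exists n, c => x xn; have h1 := uv x (stage_dom xn); have h2 := vc x xn.
rewrite -(subrKA (v x)); apply: le_trans (ler_normD _ _) _; lra.
Qed.

Lemma settles_ext u v : (forall x, dom x -> u x = v x) -> settles v -> settles u.
Proof.
move=> uv vS; apply: settles_approx => e e0; exists v => // x Dx.
by rewrite uv// subrr normr0 ltW.
Qed.

Lemma settles_cst (c : R) : settles (fun=> c).
Proof. by move=> e e0; exists 0%N, c => x _; rewrite subrr normr0 ltW. Qed.

Lemma settles_lin (p q : R) u v : settles u -> settles v -> settles (fun x => p * u x + q * v x).
Proof.
move=> uS vS e e0; pose k := 1 + `|p| + `|q|.
have k0 : 0 < k by rewrite /k; have := normr_ge0 p; have := normr_ge0 q; lra.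
have [m [c uc]] := uS (e / k) (divr_gt0 e0 k0).
have [n [d vd]] := vS (e / k) (divr_gt0 e0 k0).
exists (maxn m n), (p * c + q * d) => x xmn.
have h1 := uc x (stage_mono (leq_maxl m n) xmn).
have h2 := vd x (stage_mono (leq_maxr m n) xmn).
have -> : p * u x + q * v x - (p * c + q * d) = p * (u x - c) + q * (v x - d) by ring.
apply: le_trans (ler_normD _ _) _; rewrite !normrM.
have h1' := ler_wpM2l (normr_ge0 p) h1; have h2' := ler_wpM2l (normr_ge0 q) h2.
apply: le_trans (lerD h1' h2') _; rewrite -mulrDl mulrA ler_pdivrMr// mulrC ler_pM2l// /k; lra.
Qed.

Lemma settles_min u v : settles u -> settles v -> settles (fun x => Num.min (u x) (v x)).
Proof.
move=> uS vS e e0; have [m [c uc]] := uS e e0; have [n [d vd]] := vS e e0.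
exists (maxn m n), (Num.min c d) => x xmn.
move: (uc x (stage_mono (leq_maxl m n) xmn)) (vd x (stage_mono (leq_maxr m n) xmn)).
rewrite !ler_norml => /andP[h1 h2] /andP[h3 h4].
by case: (leP (u x) (v x)) => huv; case: (leP c d) => hcd; apply/andP; split; lra.
Qed.

Lemma settles_sum I (s : seq I) (u : I -> T -> R) : (forall i, settles (u i)) ->
  settles (fun x => \sum_(i <- s) u i x).
Proof.
move=> uS; elim: s => [|i s IHs].
  by apply: settles_ext (settles_cst 0) => x _; rewrite big_nil.
by apply: settles_ext (settles_lin 1 1 (uS i) IHs) => x _; rewrite big_cons !mul1r.
Qed.

End Settling.

(** * Convergence of the spectral measures *)

Section FewIdeals.
Variable K : fieldExtType rat.
Notation O := (ring_of_integers K).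
Implicit Types (I J C D : ideal O).

(** Among the first [N J + 1] natural numbers two agree modulo [J]; their difference lies in [J] and
    divides [T!]. *)
Lemma factorial_in_ideal J T : J != ideal0 O -> (N J <= T)%N -> (T`!%:R : O) \in J.
Proof.
move=> J0 NT; have /idxP[Q [f [Qn _ fP]]] := finite_ideal J0.
have /injectivePn[i [j ij fij]] : ~~ injectiveb (fun i : 'I_(#|Q|.+1) => f (i : nat)%:R).
  by apply/negP => /injectiveP/leq_card; rewrite card_ord ltnn.
have main (i' j' : 'I_(#|Q|.+1)) : (i' < j')%N -> f (i' : nat)%:R = f (j' : nat)%:R -> (T`!%:R : O) \in J.
  move=> lt /esym E; have Jd : (((j' - i')%N)%:R : O) \in J.
    rewrite natrB ?(ltnW lt)//.
    exact: (fP _ _ Logic.I Logic.I).1 E.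
  have /dvdnP[k ->] : (j' - i' %| T`!)%N.
    apply: dvdn_fact; rewrite subn_gt0 lt /=; apply: leq_trans (leq_subr _ _) _.
    by apply: leq_trans NT; rewrite /N -Qn -ltnS; exact: ltn_ord.
  by rewrite natrM; exact: idealZl.
have [lt|gt|/val_inj E] := ltngtP i j; last by rewrite E eqxx in ij.
  exact: main lt fij.
exact: main gt (esym fij).
Qed.

(** All these ideals contain the non-zero ideal generated by [T!], above which there are finitely
    many. *)
Lemma few_small_ideals T : exists s : seq (ideal O), forall I, I != ideal0 O -> (N I <= T)%N -> I \in s.
Proof.
have [s sP] := finite_over (nat_principal_neq0 K (fact_gt0 T)).
exists s => I I0 NI; apply: sP => x /principalP[c ->].
by apply: idealZl; exact: factorial_in_ideal.
Qed.

(** Among the ideals strictly above [J], one of maximal norm has nothing between it and [J]. *)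
Lemma exists_covering J : J != ideal0 O -> J != ideal1 O -> exists D,
  [/\ sub_ideal J D, J != D & forall C, sub_ideal J C -> sub_ideal C D -> C = J \/ C = D].
Proof.
move=> J0 J1; pose P n := `[< exists D, [/\ sub_ideal J D, J != D & N D = n] >].
have exP : exists n, P n by exists (N (ideal1 O)); apply/asboolP; exists (ideal1 O).
have bP n : P n -> (n <= N J)%N.
  by move=> /asboolP[D [JD _ <-]]; exact: N_le.
have [n /asboolP[D [JD JnD Dn]] nmax] := ex_maxnP exP bP.
exists D; split=> // C JC CD; have [->|CJ] := eqVneq C J; first by left.
have [->|CnD] := eqVneq C D; first by right.
have C0 : C != ideal0 O by have [x Jx x0] := ideal0P J0; apply: ideal_neq0 x0; exact: JC.
have := N_lt CD C0 CnD; rewrite Dn ltnNge => /negP; case.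
by apply: nmax; apply/asboolP; exists C; rewrite eq_sym.
Qed.

Lemma ideal_add_neq0 I J : J != ideal0 O -> ideal_add I J != ideal0 O.
Proof. by move=> /ideal0P[x Jx x0]; apply: ideal_neq0 x0; exact: ideal_addr. Qed.

Definition meets_in D J : set (ideal O) := fun I => forall x : O, x \in I -> x \in D -> x \in J.

(** As nothing lies between [J] and [D], the ideal [J + (I n D)] is one of the two. If it is [J],
    then [(I + D)/(I + J)] is isomorphic to [D/J]; if it is [D], then [I + J = I + D]. *)
Lemma N_add_covering D J I : J != ideal0 O -> sub_ideal J D ->
  (forall C, sub_ideal J C -> sub_ideal C D -> C = J \/ C = D) ->
  N (ideal_add I J) = (N (ideal_add I D) * (if `[< meets_in D J I >] then idx (iset D) (iset J) else 1))%N.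
Proof.
move=> J0 JD cov; case: asboolP => [IDJ|].
  have sub : sub_ideal (ideal_add I J) (ideal_add I D).
    by move=> _ /ideal_addP[x [y [Ix /JD Dy ->]]]; apply/ideal_addP; exists x, y.
  rewrite (N_mul sub (ideal_add_neq0 I J0)); congr muln.
  have fDJ : finite_index (iset D) (iset J) by exact: finite_sub.
  have [|||_ _ ->//] := @index_transfer _ _ (iset D) (iset J) (iset (ideal_add I D)) (iset (ideal_add I J)) id
    (ideal_0 D) (ideal_0 _) (subgroup_iset _) (subgroup_iset _) (or_introl fDJ).
  - by move=> x Dx; exact: ideal_addr.
  - move=> _ /ideal_addP[x [y [Ix Dy ->]]]; exists y => //.
    by rewrite addrK; exact: ideal_addl.
  move=> x y Dx Dy; split=> [h|/ideal_addP[i [j [Ii Jj E]]]]; first exact: ideal_addr.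
  rewrite /iset E; apply: idealD => //; apply: IDJ => //.
  have -> : i = x - y - j by rewrite E addrK.
  by apply: idealB; [exact: idealB | exact: JD].
move=> /existsNP[i /not_implyP[Ii /not_implyP[Di Ji]]]; rewrite muln1; congr N.
have cl : ideal_closed (fun z : O => exists x y : O, [/\ x \in I, x \in D, y \in J & z = x + y]).
  split=> [|c _ _ [x [y [Ix Dx Jy ->]]] [x' [y' [Ix' Dx' Jy' ->]]]].
    by exists 0, 0; rewrite addr0; split=> //; exact: ideal_0.
  exists (c * x + x'), (c * y + y'); split; try by apply: idealD => //; exact: idealZl.
  by ring.
have [||E|E] := cov (mk_ideal cl).
- by move=> x Jx; apply/mk_idealP; exists 0, x; rewrite add0r; split=> //; exact: ideal_0.
- by move=> _ /mk_idealP[x [y [_ Dx /JD Dy ->]]]; exact: idealD.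
- case: Ji; rewrite -E; apply/mk_idealP; exists i, 0; rewrite addr0; split=> //; exact: ideal_0.
apply: ideal_ext => z; split=> /ideal_addP[x [y [Ix yP ->]]].
  by apply/ideal_addP; exists x, y; split=> //; exact: JD.
move: yP; rewrite -E => /mk_idealP[x' [y' [Ix' _ Jy' ->]]]; apply/ideal_addP.
by exists (x + x'), y'; rewrite addrA; split=> //; exact: idealD.
Qed.

End FewIdeals.

Section SpectralConvergence.
Variables (R : realType) (T : Type) (stage : nat -> T -> Prop) (dom : T -> Prop).
Hypothesis stage_mono : forall m n x, (m <= n)%N -> stage n x -> stage m x.
Hypothesis stage_dom : forall n x, stage n x -> dom x.
Variable K : fieldExtType rat.
Notation O := (ring_of_integers K).
Implicit Types (I J C D : ideal O) (P Q Omega : set (ideal O)).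
Variable l : T -> seq (ideal O).
Hypothesis l_gt0 : forall x, dom x -> (0 < size (l x))%N.
Hypothesis l_comparable : forall x, comparable_ideals (l x).
Hypothesis l_settles : forall J, J != ideal0 O ->
  settles stage (fun x => (\sum_(I <- l x) ln ((N (ideal_add I J))%:R : R)) / (size (l x))%:R).
Variable logC : R.
Hypothesis l_torsion : forall x,
  \sum_(I <- l x | I != ideal0 O) ln ((N I)%:R : R) <= logC * (size (l x))%:R.

Notation settles := (settles stage).

Definition freq Omega (x : T) : R := (cnt Omega (l x))%:R / (size (l x))%:R.

Lemma freq_ge0 Omega x : 0 <= freq Omega x.
Proof. by rewrite divr_ge0. Qed.

Lemma freqT x : dom x -> freq setT x = 1.
Proof.
move=> /l_gt0 s0; rewrite /freq /cnt (eq_count (a2 := predT)) ?count_predT ?divff//.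
  by rewrite pnatr_eq0 -lt0n.
by move=> I; apply/asboolP.
Qed.

Lemma freq0 x : freq set0 x = 0.
Proof.
rewrite /freq /cnt (eq_count (a2 := pred0)) ?count_pred0 ?mul0r// => I.
by apply/asboolP.
Qed.

Lemma le_freq P Q x : P `<=` Q -> freq P x <= freq Q x.
Proof.
move=> PQ; rewrite ler_wpM2r ?invr_ge0// ler_nat; apply: sub_count => I /asboolP/PQ h.
exact/asboolP.
Qed.

Lemma freqUI P Q x : freq (P `|` Q) x + freq (P `&` Q) x = freq P x + freq Q x.
Proof.
rewrite /freq -!mulrDl -!natrD /cnt; congr (_%:R / _).
rewrite -(count_predUI (fun I => `[< P I >]) (fun I => `[< Q I >])); congr addn.
  by apply: eq_count => I /=; apply/asboolP/orP => -[h|h]; [left|right|left|right]; exact/asboolP.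
by apply: eq_count => I /=; apply/asboolP/andP => -[/asboolP h /asboolP h']; split=> //; apply/asboolP.
Qed.

Lemma freqU P Q x : P `&` Q = set0 -> freq (P `|` Q) x = freq P x + freq Q x.
Proof. by move=> PQ; rewrite -freqUI PQ freq0 addr0. Qed.

Lemma freqD P Q x : Q `<=` P -> freq P x = freq Q x + freq (P `\` Q) x.
Proof.
move=> QP; rewrite -freqU; first by rewrite setDUK.
by rewrite setDIK.
Qed.

Definition down_closed P := forall I J, sub_ideal I J -> P J -> P I.

(* On a chain, two down-closed sets are comparable. *)
Lemma freq_min P Q x : down_closed P -> down_closed Q ->
  freq (P `&` Q) x = Num.min (freq P x) (freq Q x).
Proof.
move=> dP dQ; wlog PQ : P Q dP dQ / forall I, I \in l x -> P I -> Q I.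
  move=> th; have [|] := pselect (forall I, I \in l x -> P I -> Q I); first exact: th.
  move=> /existsNP[I /not_implyP[Il /not_implyP[PI QI]]].
  rewrite setIC minC; apply: th => // J Jl QJ.
  by have [IJ|/dP] := l_comparable Il Jl; [case: QI; exact: dQ QJ | exact].
have E : freq (P `&` Q) x = freq P x.
  rewrite /freq /cnt; congr (_%:R / _); apply: eq_in_count => I Il.
  by apply/asboolP/asboolP => [[]//|PI]; split=> //; exact: PQ.
rewrite E; apply/esym/min_idPl; rewrite -E; apply: le_freq; exact: subIsetr.
Qed.

Lemma settles_freqI P Q : down_closed P -> down_closed Q ->
  settles (freq P) -> settles (freq Q) -> settles (freq (P `&` Q)).
Proof.
move=> dP dQ sP sQ; apply: settles_ext (settles_min stage_mono sP sQ) => x _ //.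
exact: freq_min.
Qed.

Lemma settles_freqU P Q : down_closed P -> down_closed Q ->
  settles (freq P) -> settles (freq Q) -> settles (freq (P `|` Q)).
Proof.
move=> dP dQ sP sQ; have sPQ := settles_freqI dP dQ sP sQ.
apply: settles_ext (settles_lin stage_mono 1 (-1) (settles_lin stage_mono 1 1 sP sQ) sPQ) => x _ //.
by rewrite !mul1r -freqUI mulN1r addrK.
Qed.

Lemma settles_freqT : settles (freq setT).
Proof.
by apply: (settles_ext stage_dom _ (settles_cst stage 1)) => x Dx; rewrite freqT.
Qed.

Lemma freq_covering D J x : J != ideal0 O -> D != ideal0 O -> sub_ideal J D ->
  (forall C, sub_ideal J C -> sub_ideal C D -> C = J \/ C = D) ->
  \sum_(I <- l x) ln ((N (ideal_add I J))%:R : R) - \sum_(I <- l x) ln ((N (ideal_add I D))%:R : R) =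
  (cnt (meets_in D J) (l x))%:R * ln (idx (iset D) (iset J))%:R.
Proof.
move=> J0 D0 JD cov; rewrite -sumrB.
have idx0 : 0 < (idx (iset D) (iset J))%:R :> R.
  by rewrite ltr0n; apply: idx_gt0; [exists 0; exact: ideal_0 | exact: finite_sub].
rewrite (eq_bigr (fun I => if `[< meets_in D J I >] then ln ((idx (iset D) (iset J))%:R : R) else 0)).
  by rewrite -big_mkcond big_const_seq iter_addr_0 mulr_natl.
move=> I _; rewrite (N_add_covering I J0 JD cov).
have Npos : 0 < (N (ideal_add I D))%:R :> R by rewrite ltr0n N_gt0// ideal_add_neq0.
by case: ifP => _; rewrite ?muln1 ?subrr// natrM lnM// addrAC subrr add0r.
Qed.

Lemma settles_covering D J : J != ideal0 O -> sub_ideal J D -> J != D ->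
  (forall C, sub_ideal J C -> sub_ideal C D -> C = J \/ C = D) ->
  settles (freq (meets_in D J)).
Proof.
move=> J0 JD JnD cov.
have D0 : D != ideal0 O by have [y Jy y0] := ideal0P J0; apply: ideal_neq0 y0; exact: JD.
pose c : R := ln (idx (iset D) (iset J))%:R.
have c0 : c != 0.
  rewrite gt_eqF// ln_gt0// ltr1n; have := N_lt JD J0 JnD.
  by rewrite (N_mul JD J0) -[ltnLHS]muln1 ltn_pmul2l ?N_gt0.
apply: settles_ext (settles_lin stage_mono c^-1 (- c^-1) (l_settles J0) (l_settles D0)) => x _ //.
rewrite mulNr -mulrBr -mulrBl freq_covering// -/c /freq.
by rewrite mulrA [c^-1 * _]mulrC mulfK.
Qed.

Lemma down_closed_sub J : down_closed [set I | sub_ideal I J].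
Proof. by move=> I I' II' I'J x /II'/I'J. Qed.

Lemma down_closed_meets D J : down_closed (meets_in D J).
Proof. by move=> I I' II' h x /II' Ix Dx; exact: h. Qed.

(** For [D] just above [J], an ideal lies in [J] exactly when it lies in [D] and meets [D] inside
    [J]. Both conditions are downward closed, and the first is covered by induction on the norm. *)
Lemma settles_sub J : J != ideal0 O -> settles (freq [set I | sub_ideal I J]).
Proof.
have [n] := ubnP (N J); elim: n J => // n IHn J JN J0.
have [->|J1] := eqVneq J (ideal1 O).
  suff -> : [set I | sub_ideal I (ideal1 O)] = setT by exact: settles_freqT.
  by apply/seteqP; split.
have [D [JD JnD cov]] := exists_covering J0 J1.
have D0 : D != ideal0 O by have [y Jy y0] := ideal0P J0; apply: ideal_neq0 y0; exact: JD.
have -> : [set I | sub_ideal I J] = [set I | sub_ideal I D] `&` meets_in D J.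
  apply/seteqP; split=> [I IJ|I [ID h]]; first by split=> x Ix; [exact: JD (IJ _ Ix) | move=> _; exact: IJ].
  by move=> x Ix; apply: h => //; exact: ID.
apply: settles_freqI; [exact: down_closed_sub | exact: down_closed_meets | | exact: settles_covering].
by apply: IHn => //; rewrite ltnS in JN; apply: leq_trans JN; exact: N_lt.
Qed.

Definition large_ideals (n : nat) : set (ideal O) := [set I | I != ideal0 O /\ (n < N I)%N].

(** Markov's inequality for the logarithm of the norm, with threshold [2 ^ k] where [k] satisfies
    [logC <= e * k * ln 2]. *)
Lemma freq_large (e : R) : 0 < e -> exists n, forall x, dom x -> freq (large_ideals n) x <= e.
Proof.
move=> e0; have ln2 : 0 < ln (2 : R) by rewrite ln_gt0// ltr1n.
have eln : 0 < e * ln 2 by rewrite mulr_gt0.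
pose k := Num.bound (`|logC| / (e * ln 2)).
have kE : logC <= e * (k%:R * ln 2).
  rewrite mulrCA -ler_pdivrMr//; apply: ltW; apply: le_lt_trans (archi_boundP _).
    by apply: ler_wpM2r; [rewrite invr_ge0 ltW | exact: ler_norm].
  by rewrite divr_ge0// ltW.
have [k0|k0] := posnP k.
  exists 0%N => x Dx; exfalso.
  have : 0 <= `|logC| / (e * ln 2) by rewrite divr_ge0// ltW.
  by move=> /archi_boundP; rewrite -/k k0 ltNge divr_ge0// ltW.
exists (2 ^ k)%N => x Dx; have s0 := l_gt0 Dx.
have klog : 0 < k%:R * ln (2 : R) by rewrite mulr_gt0// ltr0n.
rewrite /freq ler_pdivrMr ?ltr0n// -(ler_pM2r klog).
apply: le_trans (_ : logC * (size (l x))%:R <= _); last first.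
  by rewrite mulrAC; apply: ler_wpM2r.
apply: le_trans (l_torsion x).
rewrite big_mkcond /= /cnt [leLHS]mulr_natl.
rewrite -(iter_addr_0 (count (fun I => `[< large_ideals (2 ^ k) I >]) (l x))) -big_const_seq big_mkcond.
apply: ler_sum => I _; case: asboolP => [[-> NI]|_].
  rewrite mulr_natl -lnXn// ler_ln ?posrE ?exprn_gt0 ?ltr0n//; last exact: leq_trans NI.
  by rewrite -natrX ler_nat ltnW.
case: ifP => // I0; rewrite ln_ge0// ler1n N_gt0//.
Qed.

(** The ideals below a [J] of large norm are 0 and ideals of norm at least [N J], which carry little
    mass. *)
Lemma settles_zero : settles (freq [set ideal0 O]).
Proof.
apply: (settles_approx stage_dom) => e e0; have [n nP] := freq_large e0.
have [J J0 NJ] := N_unbounded K n; exists (freq [set I | sub_ideal I J]); first exact: settles_sub.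
move=> x Dx; have s0 : [set ideal0 O] `<=` [set I | sub_ideal I J].
  by move=> _ -> y; rewrite mem_ideal0 => /eqP->; exact: ideal_0.
rewrite (freqD _ s0) opprD addrA subrr add0r normrN ger0_norm ?freq_ge0//.
apply: le_trans (nP x Dx); apply: le_freq => I [IJ /= I0].
have {}I0 : I != ideal0 O by apply/eqP.
by split=> //; apply: leq_trans NJ _; exact: N_le.
Qed.

(** From the ideals below [J], remove 0 and everything below one of the finitely many non-zero
    ideals of norm at most [n] strictly inside [J]. The removed set is a finite union of downward
    closed sets, and besides [J] only ideals of large norm remain. *)
Lemma settles_single J : J != ideal0 O -> settles (freq [set J]).
Proof.
move=> J0; apply: (settles_approx stage_dom) => e e0; have [n nP] := freq_large e0.
have [s sP] := few_small_ideals K n.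
pose s' := [seq I <- s | `[< I != ideal0 O /\ (sub_ideal I J /\ I != J) >]].
pose Q (t : seq (ideal O)) : set (ideal O) :=
  [set I | I = ideal0 O \/ exists2 I', I' \in t & sub_ideal I I'].
have dQ t : down_closed (Q t).
  move=> I I' II' [E|[I'' h I'I'']]; last by right; exists I'' => // x /II'/I'I''.
  left; apply: ideal_ext => x; split=> [/II'|]; first by rewrite E.
  by rewrite mem_ideal0 => /eqP->; exact: ideal_0.
have sQ t : (forall I, I \in t -> I != ideal0 O) -> settles (freq (Q t)).
  elim: t => [_|I t IHt tI].
    suff -> : Q [::] = [set ideal0 O] by exact: settles_zero.
    by apply/seteqP; split=> [I [->//|[]]//|I ->]; left.
  have -> : Q (I :: t) = [set I' | sub_ideal I' I] `|` Q t.
    apply/seteqP; split=> I' /=.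
      case=> [->|[J']]; first by right; left.
      by rewrite in_cons => /orP[/eqP-> h|tJ' h]; [left | right; right; exists J'].
    case=> [h|[->|[J' tJ' h]]]; [right; exists I => //; exact: mem_head | by left|].
    by right; exists J' => //; rewrite in_cons tJ' orbT.
  apply: settles_freqU; [exact: down_closed_sub | exact: dQ | | ].
    by apply: settles_sub; apply: tI; exact: mem_head.
  by apply: IHt => J' tJ'; apply: tI; rewrite in_cons tJ' orbT.
have s's : forall I, I \in s' -> I != ideal0 O by move=> I; rewrite mem_filter => /andP[/asboolP[]].
exists (fun x => 1 * freq [set I | sub_ideal I J] x + (-1) * freq (Q s') x).
  exact: settles_lin (settles_sub J0) (sQ _ s's).
move=> x Dx; rewrite mul1r mulN1r.
have QJ : Q s' `|` [set J] `<=` [set I | sub_ideal I J].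
  move=> I [[->|[I' + II']]|->//]; first by move=> y; rewrite mem_ideal0 => /eqP->; exact: ideal_0.
  by rewrite mem_filter => /andP[/asboolP[_ [I'J _]] _] y /II'/I'J.
have disj : Q s' `&` [set J] = set0.
  apply/seteqP; split=> // I [[->|[I' + II']]] E; first by case/eqP: J0; rewrite -E.
  rewrite mem_filter => /andP[/asboolP[_ [I'J /eqP I'nJ]] _]; case: I'nJ.
  by apply: ideal_ext => y; split=> [/I'J//|]; rewrite -E; exact: II'.
rewrite (_ : _ - _ = - freq ([set I | sub_ideal I J] `\` (Q s' `|` [set J])) x); last first.
  by rewrite (freqD _ QJ) (freqU _ disj); ring.
rewrite normrN ger0_norm ?freq_ge0//.
apply: le_trans (nP x Dx); apply: le_freq => I [IJ /= /not_orP[nQ nJ]].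
have I0 : I != ideal0 O by apply/eqP => E; apply: nQ; left.
split=> //; rewrite ltnNge; apply/negP => /(sP I I0) Is; apply: nQ; right.
exists I => //; rewrite mem_filter Is andbT; apply/asboolP; split=> //; split=> //.
exact/eqP.
Qed.

Lemma settles_all Omega : settles (freq Omega).
Proof.
apply: (settles_approx stage_dom) => e e0; have [n nP] := freq_large e0.
have [s sP] := few_small_ideals K n.
pose t := undup [seq I <- ideal0 O :: s | `[< Omega I >]].
exists (fun x => \sum_(I <- t) freq [set I] x).
  apply: (settles_sum stage_mono stage_dom) => I; have [->|I0] := eqVneq I (ideal0 O); first exact: settles_zero.
  exact: settles_single.
move=> x Dx; have tE (t' : seq (ideal O)) : uniq t' -> \sum_(I <- t') freq [set I] x = freq [set` t'] x.
  elim: t' => [_|I t' IHt /= /andP[It' ut']].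
    by rewrite big_nil -[LHS](freq0 x); congr freq; apply/seteqP; split.
  rewrite big_cons IHt// -freqU.
    congr freq; apply/seteqP; split=> J /=; rewrite in_cons.
      by case=> [->|->]; rewrite ?eqxx ?orbT.
    by case/orP => [/eqP->|]; [left | right].
  by apply/seteqP; split=> // J [/= ->]; rewrite (negbTE It').
rewrite tE ?undup_uniq//.
have sub : [set` t] `<=` Omega.
  by move=> I /=; rewrite mem_undup mem_filter => /andP[/asboolP].
rewrite (freqD _ sub) addrAC subrr add0r ger0_norm ?freq_ge0//.
apply: le_trans (nP x Dx); apply: le_freq => I [OI /= nt].
have {}nt : I \notin ideal0 O :: s.
  by apply/negP => Is; apply: nt; rewrite mem_undup mem_filter Is andbT; exact/asboolP.
rewrite in_cons negb_or in nt; case/andP: nt => I0 Is.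
by split=> //; rewrite ltnNge; apply/negP => /(sP I I0); exact/negP.
Qed.

End SpectralConvergence.

(** * From limits of masses to a probability measure *)

Section TightLimit.
Variables (R : realType) (A : comNzRingType) (L : set (ideal A) -> R).
Implicit Types (P Q : set (ideal A)) (s : seq (ideal A)).
Hypothesis L_ge0 : forall P, 0 <= L P.
Hypothesis L_total : L setT = 1.
Hypothesis L_additive : forall P Q, P `&` Q = set0 -> L (P `|` Q) = L P + L Q.
Hypothesis L_tight : forall e : R, 0 < e -> exists s, L (~` [set` s]) <= e.

Definition tight_limit P : \bar R := (L P)%:E.

Lemma L_empty : L set0 = 0.
Proof.
by have := L_additive (setI0 set0); rewrite setU0 => /eqP; rewrite -subr_eq0 opprD addNKr oppr_eq0 => /eqP.
Qed.

Let tight_limit0 : tight_limit set0 = 0%E.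
Proof. by rewrite /tight_limit L_empty. Qed.

Let tight_limit_ge0 P : (0 <= tight_limit P)%E.
Proof. by rewrite lee_fin. Qed.

Lemma le_L P Q : P `<=` Q -> L P <= L Q.
Proof.
move=> PQ; rewrite -(setDUK PQ) L_additive ?lerDl//.
by rewrite setDIK.
Qed.

Lemma L_bigcup (F : (set (ideal A))^nat) n : trivIset setT F ->
  L (\bigcup_(i in `I_n) F i) = \sum_(i < n) L (F i).
Proof.
move=> tF; elim: n => [|n IHn]; first by rewrite II0 bigcup_set0 big_ord0 L_empty.
rewrite bigcup_mkord big_ord_recr /= -bigcup_mkord L_additive ?IHn ?big_ord_recr//.
apply/seteqP; split=> // I [[i /= ltin Fi] Fn].
by have E := tF i n Logic.I Logic.I (ex_intro _ I (conj Fi Fn)); rewrite E ltnn in ltin.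
Qed.

Let tight_limit_sigma_additive : semi_sigma_additive tight_limit.
Proof.
move=> F _ tF _; set U := \bigcup_n F n.
rewrite (_ : (fun n => _) = EFin \o (fun n : nat => L (\bigcup_(i in `I_n) F i))); last first.
  by apply/funext => n /=; rewrite L_bigcup// big_mkord sumEFin.
apply: cvg_EFin; first by near=> n.
apply/cvgrPdist_le => e e0 /=; have [s sP] := L_tight e0.
(* The first [M] sets already contain every point of the finite set [s] that lies in the union, so
   what is missing has mass at most [e] by tightness. *)
have [M MP] : exists M, forall I, I \in s -> U I -> exists2 i, (i < M)%N & F i I.
  elim: (s) => [|I t [M MP]]; first by exists 0%N.
  have [[i _ Fi]|nU] := pselect (U I).
    exists (maxn i.+1 M) => J; rewrite in_cons => /orP[/eqP-> _|Jt /(MP J Jt)[j jM Fj]].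
      by exists i => //; rewrite leq_max ltnSn.
    by exists j => //; rewrite leq_max jM orbT.
  exists M => J; rewrite in_cons => /orP[/eqP->//|]; exact: MP.
near=> n; have sub : \bigcup_(i in `I_n) F i `<=` U by apply: bigcup_sub => i _; exact: bigcup_sup.
rewrite -[L U](congr1 L (setDUK sub)) L_additive; last by rewrite setDIK.
rewrite addrAC subrr add0r ger0_norm//; apply: le_trans sP; apply: le_L => I [UI nI] /= Is.
have [i iM FiI] := MP I Is UI; apply: nI; exists i => //=.
by apply: leq_trans iM _; near: n; exact: nbhs_infty_ge.
Unshelve. all: by end_near. Qed.

HB.instance Definition _ := isMeasure.Build _ _ _ tight_limit
  tight_limit0 tight_limit_ge0 tight_limit_sigma_additive.

Let tight_limitT : tight_limit setT = 1%E.
Proof. by rewrite /tight_limit L_total. Qed.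

HB.instance Definition _ := Measure_isProbability.Build _ _ _ tight_limit tight_limitT.

Lemma tight_probability : exists mu : probability (ideal A) R, forall P, mu P = (L P)%:E.
Proof. by exists tight_limit. Qed.

End TightLimit.

Section Limits.
Variables (R : realType) (T : Type) (stage : nat -> T -> Prop) (dom : T -> Prop).
Hypothesis stage_mono : forall m n x, (m <= n)%N -> stage n x -> stage m x.
Hypothesis stage_dom : forall n x, stage n x -> dom x.
Hypothesis stage_inhabited : forall n, exists x, stage n x.
Implicit Types u v : T -> R.

Definition tends u (c : R) := forall e : R, 0 < e ->
  exists n, forall x, stage n x -> `|u x - c| <= e.

(** The limit is the supremum of the eventual lower bounds of [u]. *)
Lemma settles_tends u : settles stage u -> exists c, tends u c.
Proof.
move=> uS; pose E := [set y | exists n, forall x, stage n x -> y <= u x].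
have Ebound e m c y : (forall x, stage m x -> `|u x - c| <= e) -> E y -> y <= c + e.
  move=> uc [n uy]; have [x xmn] := stage_inhabited (maxn m n).
  move: (uc x (stage_mono (leq_maxl m n) xmn)) (uy x (stage_mono (leq_maxr m n) xmn)).
  by rewrite ler_norml => /andP[_]; lra.
have Emem e n c : (forall x, stage n x -> `|u x - c| <= e) -> E (c - e).
  by move=> uc; exists n => x /uc; rewrite ler_norml => /andP[+ _]; lra.
exists (sup E) => e e0; have [n [c uc]] := uS (e / 2) (divr_gt0 e0 (ltr0n _ 2)).
exists n => x xn; have h1 : sup E <= c + e / 2.
  by apply: ge_sup; [exists (c - e / 2); exact: Emem uc | move=> y; exact: Ebound uc].
have h2 : c - e / 2 <= sup E.
  by apply: ub_le_sup; [exists (c + e / 2) => y; exact: Ebound uc | exact: Emem uc].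
by have := uc x xn; rewrite !ler_norml => /andP[h3 h4]; apply/andP; split; lra.
Qed.

Lemma tends_le u v c d : (forall x, dom x -> u x <= v x) -> tends u c -> tends v d -> c <= d.
Proof.
move=> uv uc vd; apply/ler_addgt0Pr => e e0.
have [m um] := uc (e / 2) (divr_gt0 e0 (ltr0n _ 2)).
have [n vn] := vd (e / 2) (divr_gt0 e0 (ltr0n _ 2)).
have [x xmn] := stage_inhabited (maxn m n); have h3 := uv x (stage_dom xmn).
move: (um x (stage_mono (leq_maxl m n) xmn)) (vn x (stage_mono (leq_maxr m n) xmn)).
by rewrite !ler_norml => /andP[h4 h5] /andP[h6 h7]; lra.
Qed.

Lemma tends_eq u v c d : (forall x, dom x -> u x = v x) -> tends u c -> tends v d -> c = d.
Proof.
move=> uv uc vd; apply/eqP; rewrite eq_le; apply/andP; split.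
  by apply: tends_le uc vd => x /uv ->.
by apply: tends_le vd uc => x /uv ->.
Qed.

Lemma tends_cst (c : R) : tends (fun=> c) c.
Proof. by move=> e e0; exists 0%N => x _; rewrite subrr normr0 ltW. Qed.

Lemma tendsD u v c d : tends u c -> tends v d -> tends (fun x => u x + v x) (c + d).
Proof.
move=> uc vd e e0; have [m um] := uc (e / 2) (divr_gt0 e0 (ltr0n _ 2)).
have [n vn] := vd (e / 2) (divr_gt0 e0 (ltr0n _ 2)).
exists (maxn m n) => x xmn.
have h1 := um x (stage_mono (leq_maxl m n) xmn).
have h2 := vn x (stage_mono (leq_maxr m n) xmn).
rewrite (_ : _ - _ = (u x - c) + (v x - d)); last by ring.
apply: le_trans (ler_normD _ _) _; lra.
Qed.

End Limits.

Section LimitMeasure.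
Variables (R : realType) (T : Type) (stage : nat -> T -> Prop) (dom : T -> Prop).
Hypothesis stage_mono : forall m n x, (m <= n)%N -> stage n x -> stage m x.
Hypothesis stage_dom : forall n x, stage n x -> dom x.
Hypothesis stage_inhabited : forall n, exists x, stage n x.
Variable K : fieldExtType rat.
Notation O := (ring_of_integers K).
Variable l : T -> seq (ideal O).
Hypothesis l_gt0 : forall x, dom x -> (0 < size (l x))%N.
Hypothesis l_comparable : forall x, comparable_ideals (l x).
Hypothesis l_settles : forall J, J != ideal0 O ->
  settles stage (fun x => (\sum_(I <- l x) ln ((N (ideal_add I J))%:R : R)) / (size (l x))%:R).
Variable logC : R.
Hypothesis l_torsion : forall x,
  \sum_(I <- l x | I != ideal0 O) ln ((N I)%:R : R) <= logC * (size (l x))%:R.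

Lemma exists_limit_measure : exists mu : probability (ideal O) R,
  forall Omega, exists2 c, tends stage (freq R l Omega) c & mu Omega = c%:E.
Proof.
have ex Omega : exists c, tends stage (freq R l Omega) c.
  apply: settles_tends => //.
  exact: (settles_all stage_mono stage_dom l_gt0 l_comparable l_settles l_torsion).
have [L LP] := choice ex; have le := tends_le stage_mono stage_dom stage_inhabited.
have eq := tends_eq stage_mono stage_dom stage_inhabited.
have [|||e e0|mu muP] := @tight_probability R O L; last by exists mu => Omega; exists (L Omega).
- by move=> P; apply: le (tends_cst stage 0) (LP P) => x _; exact: freq_ge0.
- by apply: eq (LP setT) (tends_cst stage 1) => x; exact: freqT.
- move=> P Q PQ; apply: eq (LP _) (tendsD stage_mono (LP P) (LP Q)) => x _; exact: freqU.
have [n nP] := freq_large l_gt0 l_torsion e0; have [s sP] := few_small_ideals K n.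
exists (ideal0 O :: s); apply: le (LP _) (tends_cst stage e) => x Dx.
apply: le_trans (nP x Dx); apply: le_freq => I /=.
rewrite in_cons => /negP; rewrite negb_or => /andP[I0 Is].
by split=> //; rewrite ltnNge; apply/negP => /(sP I I0); exact/negP.
Qed.

End LimitMeasure.

(** * Stages of nearly free actions *)

Section SoficStages.
Variables (R : realType) (G : groupType) (S : {fset G}).
Notation F := (free_group S).

(** One index serves as radius and as inverse tolerance, so that the stages decrease. *)
Definition nearly_free (n : nat) (X : finite_right_set F) : Prop :=
  (0 < #|{: X}|)%N /\ (bad_points n X)%:R <= n.+1%:R^-1 * #|{: X}|%:R :> R.

Lemma bad_points_mono r r' (X : finite_right_set F) : (r <= r')%N ->
  (bad_points r X <= bad_points r' X)%N.
Proof.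
move=> rr; apply: subset_leq_card; apply/fintype.subsetP => x; rewrite !inE; apply: contra.
by move=> /asboolP h; apply/asboolP => w wr; apply: h; exact: leq_trans wr rr.
Qed.

Lemma nearly_free_mono m n (X : finite_right_set F) : (m <= n)%N -> nearly_free n X -> nearly_free m X.
Proof.
move=> mn [X0 bX]; split=> //; apply: le_trans (_ : (bad_points n X)%:R <= _).
  by rewrite ler_nat bad_points_mono.
by apply: le_trans bX _; rewrite ler_wpM2r// lef_pV2 ?posrE ?ltr0n// ler_nat.
Qed.

Lemma nearly_free_bad (r : nat) (eta : R) : 0 < eta -> exists n, forall X : finite_right_set F,
  nearly_free n X -> (0 < #|{: X}|)%N /\ (bad_points r X)%:R <= eta * #|{: X}|%:R.
Proof.
move=> eta0; pose k := Num.bound eta^-1; exists (maxn r k) => X [X0 bX]; split=> //.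
apply: le_trans (_ : (bad_points (maxn r k) X)%:R <= _).
  by rewrite ler_nat bad_points_mono// leq_maxl.
apply: le_trans bX _; apply: ler_wpM2r => //.
rewrite -[eta]invrK lef_pV2 ?posrE ?invr_gt0 ?ltr0n//.
apply: le_trans (_ : k%:R <= _); last by rewrite ler_nat leqW// leq_maxr.
by apply/ltW/archi_boundP; rewrite invr_ge0 ltW.
Qed.

Lemma sofic_nearly_free (X : nat -> finite_right_set F) m :
  sofic_approximation R X -> \forall n \near \oo, nearly_free m (X n).
Proof.
(* The tolerance 1/2 excludes an empty [X n], whose ratio 0/0 is 0 by convention and thus at
   distance 1 from the limit. *)
move=> sX; have := sX m => /cvgrPdist_le /(_ (Num.min m.+1%:R^-1 2^-1)).
rewrite lt_min !invr_gt0 !ltr0n => /(_ isT); apply: filterS => n /=.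
rewrite le_min => /andP[h1 h2]; have X0 : (0 < #|{: X n}|)%N.
  rewrite lt0n; apply/eqP => E; move: h2; rewrite E invr0 mulr0 subr0 normr1; lra.
split=> //; have X0R : 0 < #|{: X n}|%:R :> R by rewrite ltr0n.
have E : #|{: X n}|%:R = #|good_points m (X n)|%:R + (bad_points m (X n))%:R :> R.
  by rewrite -natrD -(cardC (good_points m (X n))).
move: h1 => /(le_trans (ler_norm _)); rewrite -{1}(divff (lt0r_neq0 X0R)) -mulrBl {1}E.
by rewrite ler_pdivrMr// addrAC subrr add0r.
Qed.

End SoficStages.

Unset Implicit Arguments.
Set Strict Implicit.
Set Printing Implicit Defensive.

Theorem mainTheorem1 (R : realType) (G : groupType) (S : {fset G})
    (S_generates : forall g : G, exists w : free_group S, free_eval w = g)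
    (G_amenable : amenable G) (K : fieldExtType rat)
    (a : group_ring (ring_of_integers K) (free_group S)) :
  exists nu_G : probability (ideal (ring_of_integers K)) R,
  forall X : nat -> finite_right_set (free_group S),
    sofic_approximation R X ->
    forall Omega : set (ideal (ring_of_integers K)),
      nu R (X n) a Omega @[n --> \oo] --> nu_G Omega.
Proof.
(* If some stage is empty there is no sofic approximation at all, and any probability measure will
   do. *)
have [inh|] := pselect (forall n, exists X, @nearly_free R G S n X); last first.
  move=> /existsNP[m nX]; exists \d_(ideal0 _) => X /(sofic_nearly_free m).
  by case=> n _ /(_ n (leqnn n)) Xn; case: nX; exists (X n).
have [C C0 Cbound] := torsion_bound a.
pose l X := projT1 (cid (spectrum R C0 Cbound X)).
have lP X := projT2 (cid (spectrum R C0 Cbound X)).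
have size_l X : size (l X) = #|X| by case: (lP X).
have [|||J J0||mu muP] := @exists_limit_measure R _ (@nearly_free R G S)
  (fun X => (0 < #|{: X}|)%N) (@nearly_free_mono R G S) _ inh K l _ _ _ (ln C%:R).
- by move=> n X [].
- by move=> X; rewrite size_l.
- by move=> X; case: (lP X).
- move=> e e0; have [r [eta [c [eta0 rP]]]] := kernel_limit S_generates G_amenable a J0 e0.
  have [n nP] := nearly_free_bad S r eta0; exists n, c => X /nP[X0 bX].
  by rewrite size_l; have [_ _ _ -> // _] := lP X; exact: rP.
- by move=> X; rewrite size_l; case: (lP X).
exists mu => X sX Omega; have [c cP ->] := muP Omega.
have E n : nu R (X n) a Omega = (freq R l Omega (X n))%:E.
  by have [_ _ -> _ _] := lP (X n); rewrite /freq size_l.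
rewrite (eq_cvg _ _ E); apply: cvg_EFin; first by near=> n.
apply/cvgrPdist_le => e e0; have [m mP] := cP e e0.
by apply: filterS (sofic_nearly_free m sX) => n /mP; rewrite distrC.
Unshelve. all: by end_near. Qed.
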